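(* Let $N\in\mathbb{N}$, let $b=0$ if $N$ is odd and $b=1$ if $N$ is even, and let $\mathrm{Re}(y)>0$. Then $$\begin{aligned}\sum_{n=1}^\infty \sigma_{N}^{(N)}(n) e^{-ny} + \frac{1}{2}\zeta(-N) &=-\frac{1}{2y}-\frac{1}{2N\sin\left(\frac{\pi}{2N}\right)}\left(\frac{2\pi}{y}\right)^{1+\frac1N}\zeta\left(-\frac1N\right) \\ &\quad-\frac1N\left(\frac{2\pi}{y}\right)^{1+\frac1N}\sum_{j=-\frac{N-1+b}{2}}^{\frac{N-1-b}{2}}\sum_{n=1}^\infty \frac{n^{\frac1N}\,e^{\frac{i\pi(2j+b)}{2N}}}{\exp \left(2 \pi e^{\frac{i\pi (2j+b)}{2N}}\left(\frac{2\pi n}{y} \right)^{\frac1N}\right) -1}.\end{aligned}$$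
   Context: $\sigma_a^{(N)}(n)=\sum_{d^N\mid n}d^a$ (sum over positive integers $d$ with $d^N\mid n$), $\zeta$ is the (analytically continued) Riemann zeta function, and powers take principal values. *)

(* Defs.v *)
From Stdlib Require Import Reals ZArith List ClassicalEpsilon.
From Coquelicot Require Import Coquelicot.

Open Scope R_scope.

(** * Exponential, principal logarithm and principal powers on [C] *)

Definition Cexp (z : C) : C :=
  RtoC (exp (Re z)) * (cos (Im z), sin (Im z)).

(* The principal argument, with values in ]-PI, PI]; meaningful for z <> 0. *)
Definition Carg (z : C) : R :=
  if Rle_dec 0 (Im z) then acos (Re z / Cmod z) else - acos (Re z / Cmod z).

Definition Clog (z : C) : C := (ln (Cmod z), Carg z).

(* [Cpower z a] is z^a for z <> 0; its value at z = 0 is a junk value. *)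
Definition Cpower (z a : C) : C := Cexp (a * Clog z).

(** * Series and finite sums of complex numbers *)

(* Coquelicot's total [Series] is real-valued.  Like it, [CSeries] is the sum of
   the series when [Cex_series] holds, and carries no information otherwise. *)
Definition CSeries (a : nat -> C) : C :=
  (Series (fun n => Re (a n)), Series (fun n => Im (a n))).

Definition Cis_series (a : nat -> C) (l : C) : Prop :=
  @is_series C_AbsRing C_NormedModule a l.

Definition Cex_series (a : nat -> C) : Prop :=
  @ex_series C_AbsRing C_NormedModule a.

Definition Csum {I : Type} (s : list I) (f : I -> C) : C :=
  fold_right Cplus (RtoC 0) (map f s).

(* The integers lo, lo + 1, ..., hi (none if hi < lo). *)
Definition Zinterval (lo hi : Z) : list Z :=
  map (fun k => (lo + Z.of_nat k)%Z) (seq 0 (Z.to_nat (hi - lo + 1))).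

(** * The divisor function *)

(* The sum of d^a over the d >= 1 with d^N | n.  For N, n >= 1 all of these
   satisfy d <= n. *)
Definition divisor_sigma (N : nat) (a : C) (n : nat) : C :=
  Csum (filter (fun d => Nat.eqb (n mod d ^ N) 0) (seq 1 n))
       (fun d => Cpower (RtoC (INR d)) a).

(** * The Riemann zeta function *)

(* Near s0, [f] is the sum of a convergent power series in s - s0. *)
Definition Canalytic_at (f : C -> C) (s0 : C) : Prop :=
  exists (r : posreal) (a : nat -> C),
    forall s : C, Cmod (s - s0) < r ->
      @is_pseries C_AbsRing C_NormedModule a (s - s0)%C (f s).

(* The index is shifted: the series is the sum of n^(-s) over n >= 1. *)
Definition is_zeta (f : C -> C) : Prop :=
  (forall s : C, 1 < Re s ->
     Cis_series (fun n => Cpower (RtoC (INR (S n))) (- s)) (f s)) /\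
  (forall s : C, s <> RtoC 1 -> Canalytic_at f s).

(* By the identity theorem [is_zeta] determines the values off the pole s = 1;
   the value at 1 is left unspecified. *)
Definition zeta : C -> C := epsilon (inhabits (fun _ : C => RtoC 0)) is_zeta.

(* Main.v *)
(* Put c = 2 pi / y and D = d^N / c. As a Lambert series the left-hand sum is
   sum_d d^N / (e^{d^N y} - 1), and the Mittag-Leffler expansion of 1 / (e^z - 1) turns its d-th
   summand into the limit of the defect in n of summing x^2 / (x^2 + D^2) over x = 1, ..., n.
   With x = u^N and gam^N = c, x^2 / (x^2 + D^2) splits into partial fractions over the roots
   e^{i pi (2j+b)/(2N)} gam u, and summing these over d by Mittag-Leffler again gives, at u = n^{1/N},
   exactly the n-th terms of the right-hand series plus a multiple of n^{1/N}.
   The double sum converges only conditionally, so the two orders of summation are compared through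
   Euler-Maclaurin summation in x: the defect is bounded by a summable function of d uniformly in n.
   In the limit the multiple of n^{1/N} contributes zeta(-1/N), the endpoint x = oo contributes
   1/(2y), and the antiderivative of the d-sum, evaluated at x = 0, contributes zeta(N+1), which
   becomes zeta(-N) through the Bernoulli numbers.
   Here zeta is identified with the continuation given by Euler-Maclaurin summation; two analytic
   functions agreeing for Re s > 1 agree everywhere by continuing along segments avoiding s = 1. *)

Require Import Defs.
From Stdlib Require Import Reals Lra Lia ZArith List ClassicalEpsilon.
From Coquelicot Require Import Coquelicot.

Open Scope C_scope.

(** * Series of complex numbers *)

(** No contour integral and no functional equation of zeta is used: every analytic fact is an
    estimate along the real line or a limit of finite partial fractions over roots of unity. Put
    [kap] = y/(2 pi), r = d^N and let [gam] be the principal N-th root of 2 pi/y. The summand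
    x^2/(x^2 + (kap r)^2) tends to 1, so its sum over x needs counterterms. A primitive and half the
    summand would leave increments of size 1/(x^2 + r^2), whose double sum diverges for N = 1.
    Adding 1/12 of the derivative leaves x/(x^2 + r^2)^2, which is at most x^(-3/2) r^(-3/2), a
    product summable in both variables for every N >= 1. The Bernoulli numbers are introduced
    through Euler's formula for zeta(k) and their recursion is derived from Mittag-Leffler, so
    zeta(N+1) turns into zeta(-N) by comparing two expressions for the same Bernoulli number.
    Branches cause no trouble because every root times [gam] stays in the open right half-plane. *)

Fixpoint csum (f : nat -> C) (n : nat) : C :=
  match n with 0 => RtoC 0 | S n => csum f n + f n end.

Fixpoint rsum (f : nat -> R) (n : nat) : R :=
  match n with 0 => 0%R | S n => (rsum f n + f n)%R end.

(** Convergence is reduced to that of a real sequence of moduli, so that the real limit lemmas apply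
    directly. *)
Definition Clim (u : nat -> C) (l : C) : Prop :=
  is_lim_seq (fun n => Cmod (u n - l)) 0.

Definition Csums (f : nat -> C) (l : C) : Prop := Clim (csum f) l.

Lemma C_ext (a b : C) : Re a = Re b -> Im a = Im b -> a = b.
Proof. destruct a, b; simpl; intros; subst; reflexivity. Qed.

Lemma csum_ext (f g : nat -> C) n :
  (forall k, (k < n)%nat -> f k = g k) -> csum f n = csum g n.
Proof.
  induction n as [|n IH]; simpl; intros H; [reflexivity|].
  rewrite IH, H; auto with arith.
Qed.

Lemma csum_plus f g n : csum (fun k => f k + g k) n = csum f n + csum g n.
Proof. induction n; simpl; [|rewrite IHn]; ring. Qed.

Lemma csum_scal a f n : csum (fun k => a * f k) n = a * csum f n.
Proof. induction n; simpl; [|rewrite IHn]; ring. Qed.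

Lemma csum_minus f g n : csum (fun k => f k - g k) n = csum f n - csum g n.
Proof. induction n; simpl; [|rewrite IHn]; ring. Qed.

Lemma csum_const (a : C) n : csum (fun _ => a) n = RtoC (INR n) * a.
Proof.
  induction n; [simpl; ring|]. rewrite S_INR, RtoC_plus. simpl csum. rewrite IHn. ring.
Qed.

Lemma csum_zero f n : (forall k, (k < n)%nat -> f k = RtoC 0) -> csum f n = RtoC 0.
Proof. intros H. rewrite (csum_ext f (fun _ => RtoC 0)), csum_const by exact H. ring. Qed.

Lemma csum_swap (f : nat -> nat -> C) n m :
  csum (fun i => csum (fun j => f i j) m) n = csum (fun j => csum (fun i => f i j) n) m.
Proof.
  induction n; simpl.
  - symmetry; apply csum_zero; auto.
  - rewrite IHn, <- csum_plus. reflexivity.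
Qed.

Lemma csum_add f n m : csum f (n + m) = csum f n + csum (fun k => f (n + k)%nat) m.
Proof.
  induction m; simpl; [rewrite Nat.add_0_r; ring|].
  rewrite Nat.add_succ_r. simpl. rewrite IHm. ring.
Qed.

Lemma csum_S_l f n : csum f (S n) = f 0%nat + csum (fun k => f (S k)) n.
Proof. change (S n) with (1 + n)%nat. rewrite csum_add. simpl. ring. Qed.

Lemma csum_telescope (t : nat -> C) n : csum (fun k => t (S k) - t k) n = t n - t 0%nat.
Proof. induction n; simpl; [|rewrite IHn]; ring. Qed.

Lemma csum_single f n k : (k < n)%nat ->
  (forall i, (i < n)%nat -> i <> k -> f i = RtoC 0) -> csum f n = f k.
Proof.
  intros Hk H. replace n with (k + S (n - k - 1))%nat by lia.
  rewrite csum_add, csum_S_l, Nat.add_0_r, !csum_zero; [ring| |].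
  - intros i Hi. apply H; lia.
  - intros i Hi. apply H; lia.
Qed.

Lemma csum_rev f n : csum (fun k => f (n - 1 - k)%nat) n = csum f n.
Proof.
  induction n; [reflexivity|]. rewrite csum_S_l. simpl csum at 2.
  rewrite <- IHn, Cplus_comm. f_equal.
  - apply csum_ext; intros k Hk; f_equal; lia.
  - f_equal; lia.
Qed.

Lemma rsum_le f g n : (forall k, (k < n)%nat -> f k <= g k) -> rsum f n <= rsum g n.
Proof.
  induction n as [|n IH]; simpl; intros H; [lra|].
  assert (f n <= g n) by (apply H; lia).
  assert (rsum f n <= rsum g n) by (apply IH; intros; apply H; lia). lra.
Qed.

Lemma rsum_scal a f n : rsum (fun k => (a * f k)%R) n = (a * rsum f n)%R.
Proof. induction n; simpl; [|rewrite IHn]; ring. Qed.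

Lemma rsum_ge_0 f n : (forall k, 0 <= f k) -> 0 <= rsum f n.
Proof. intros H; induction n; simpl; [lra|]. specialize (H n). lra. Qed.

Lemma Cmod_csum f n : Cmod (csum f n) <= rsum (fun k => Cmod (f k)) n.
Proof.
  induction n; simpl; [rewrite Cmod_0; lra|].
  eapply Rle_trans; [apply Cmod_triangle|lra].
Qed.

Lemma Cmod_csum_le f g n :
  (forall k, (k < n)%nat -> Cmod (f k) <= g k) -> Cmod (csum f n) <= rsum g n.
Proof.
  intros H. eapply Rle_trans; [apply Cmod_csum|]. now apply rsum_le.
Qed.

Lemma Re_csum f n : Re (csum f n) = rsum (fun k => Re (f k)) n.
Proof. induction n; simpl; [reflexivity|]. rewrite <- IHn. reflexivity. Qed.

Lemma Im_csum f n : Im (csum f n) = rsum (fun k => Im (f k)) n.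
Proof. induction n; simpl; [reflexivity|]. rewrite <- IHn. reflexivity. Qed.

Lemma csum_RtoC (f : nat -> R) n : csum (fun k => RtoC (f k)) n = RtoC (rsum f n).
Proof. induction n; [reflexivity|]. simpl. rewrite RtoC_plus, IHn. reflexivity. Qed.

Lemma rsum_sum_n f n : sum_n f n = rsum f (S n).
Proof.
  induction n; [rewrite sum_O; simpl; now rewrite Rplus_0_l|].
  rewrite sum_Sn, IHn. reflexivity.
Qed.

Lemma csum_sum_n (f : nat -> C) n : @sum_n C_AbsRing f n = csum f (S n).
Proof.
  induction n; [rewrite sum_O; simpl; now rewrite Cplus_0_l|].
  rewrite sum_Sn, IHn. reflexivity.
Qed.

Lemma Cmod_sub_sym (a b : C) : Cmod (a - b) = Cmod (b - a).
Proof. replace (a - b) with (- (b - a)) by ring. apply Cmod_opp. Qed.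

Lemma Cmod_triangle3 (a b c : C) : Cmod (a - c) <= Cmod (a - b) + Cmod (b - c).
Proof. replace (a - c) with ((a - b) + (b - c)) by ring. apply Cmod_triangle. Qed.

Lemma Cmod_rev_triangle (a b : C) : Cmod a - Cmod b <= Cmod (a + b).
Proof.
  assert (H := Cmod_triangle (a + b) (- b)). rewrite Cmod_opp in H.
  replace (a + b + - b) with a in H by ring. lra.
Qed.

Lemma im_le_Cmod (z : C) : Rabs (Im z) <= Cmod z.
Proof.
  eapply Rle_trans; [|apply Rmax_Cmod]. apply Rmax_r.
Qed.

Lemma Cmod_le_re_im (z : C) : Cmod z <= Rabs (Re z) + Rabs (Im z).
Proof.
  destruct z as [a b].
  assert (E : ((a, b) : C) = RtoC a + RtoC b * Ci) by (apply C_ext; simpl; ring).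
  rewrite E at 1. eapply Rle_trans; [apply Cmod_triangle|].
  rewrite Cmod_mult, Cmod_Ci, !Cmod_R. cbn [Re Im fst snd]. lra.
Qed.

(** * Limits of complex sequences *)

Lemma Clim_le (u : nat -> C) l (e : nat -> R) :
  (forall n, Cmod (u n - l) <= e n) -> is_lim_seq e 0 -> Clim u l.
Proof.
  intros H He. apply (is_lim_seq_le_le (fun _ => 0%R) _ e).
  - intros n; split; [apply Cmod_ge_0|apply H].
  - apply is_lim_seq_const.
  - exact He.
Qed.

Lemma Clim_eps (u : nat -> C) l :
  Clim u l <-> forall eps, 0 < eps ->
    exists n0, forall n, (n0 <= n)%nat -> Cmod (u n - l) < eps.
Proof.
  unfold Clim. rewrite <- is_lim_seq_spec. split; intros H.
  - intros eps He. destruct (H (mkposreal eps He)) as [n0 Hn]. exists n0. intros n Hle.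
    specialize (Hn n Hle). simpl in Hn. rewrite Rminus_0_r, Rabs_pos_eq in Hn; auto.
    apply Cmod_ge_0.
  - intros [eps He]. destruct (H eps He) as [n0 Hn]. exists n0. intros n Hle. simpl.
    rewrite Rminus_0_r, Rabs_pos_eq; auto. apply Cmod_ge_0.
Qed.

Lemma Clim_ext u v l : (forall n, u n = v n) -> Clim u l -> Clim v l.
Proof. intros H. apply is_lim_seq_ext. intros n; now rewrite H. Qed.

Lemma Clim_ext_loc u v l n0 :
  (forall n, (n0 <= n)%nat -> u n = v n) -> Clim u l -> Clim v l.
Proof.
  intros H. apply is_lim_seq_ext_loc. exists n0. intros n Hn. now rewrite H.
Qed.

Lemma Clim_const a : Clim (fun _ => a) a.
Proof.
  apply (Clim_le _ _ (fun _ => 0%R)); [|apply is_lim_seq_const].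
  intros _. replace (a - a) with (RtoC 0) by ring. rewrite Cmod_0. lra.
Qed.

Lemma Clim_plus u v a b : Clim u a -> Clim v b -> Clim (fun n => u n + v n) (a + b).
Proof.
  intros Hu Hv. apply (Clim_le _ _ (fun n => Cmod (u n - a) + Cmod (v n - b))%R).
  - intros n. replace (u n + v n - (a + b)) with ((u n - a) + (v n - b)) by ring.
    apply Cmod_triangle.
  - replace (Finite 0) with (Finite (0 + 0)) by (f_equal; ring).
    now apply is_lim_seq_plus'.
Qed.

Lemma Clim_scal c u a : Clim u a -> Clim (fun n => c * u n) (c * a).
Proof.
  intros Hu. apply (Clim_le _ _ (fun n => Cmod c * Cmod (u n - a))%R).
  - intros n. replace (c * u n - c * a) with (c * (u n - a)) by ring.
    rewrite Cmod_mult. lra.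
  - replace (Finite 0) with (Rbar_mult (Cmod c) 0) by (simpl; f_equal; ring).
    now apply is_lim_seq_scal_l.
Qed.

Lemma Clim_opp u a : Clim u a -> Clim (fun n => - u n) (- a).
Proof.
  intros H. apply (Clim_ext (fun n => (- RtoC 1) * u n)); [intros; ring|].
  replace (- a) with ((- RtoC 1) * a) by ring. now apply Clim_scal.
Qed.

Lemma Clim_minus u v a b : Clim u a -> Clim v b -> Clim (fun n => u n - v n) (a - b).
Proof. intros Hu Hv. apply Clim_plus; [exact Hu|now apply Clim_opp]. Qed.

Lemma Clim_csum (u : nat -> nat -> C) (a : nat -> C) K :
  (forall k, (k < K)%nat -> Clim (fun n => u n k) (a k)) ->
  Clim (fun n => csum (u n) K) (csum a K).
Proof.
  induction K; simpl; intros H; [apply Clim_const|].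
  apply Clim_plus; auto with arith.
Qed.

Lemma Clim_Cmod u a : Clim u a -> is_lim_seq (fun n => Cmod (u n)) (Cmod a).
Proof.
  intros H. apply is_lim_seq_spec. intros [eps He].
  destruct (proj1 (Clim_eps u a) H eps He) as [n0 Hn]. exists n0. intros n Hle.
  specialize (Hn n Hle). simpl.
  assert (H1 := Cmod_rev_triangle (u n) (a - u n)).
  replace (u n + (a - u n)) with a in H1 by ring.
  assert (H2 := Cmod_rev_triangle a (u n - a)).
  replace (a + (u n - a)) with (u n) in H2 by ring.
  rewrite (Cmod_sub_sym a (u n)) in H1. apply Rabs_def1; lra.
Qed.

Lemma Clim_bounded u a : Clim u a -> exists B, 0 < B /\ forall n, Cmod (u n) <= B.
Proof.
  intros H. destruct (proj1 (Clim_eps u a) H 1%R Rlt_0_1) as [n0 Hn].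
  exists (rsum (fun k => Cmod (u k)) n0 + Cmod a + 1)%R.
  assert (H0 : forall n, 0 <= rsum (fun k => Cmod (u k)) n)
    by (intros n; apply rsum_ge_0; intros; apply Cmod_ge_0).
  assert (H1 := Cmod_ge_0 a). split; [specialize (H0 n0); lra|]. intros n.
  destruct (Nat.le_gt_cases n0 n) as [Hle|Hlt].
  - specialize (Hn n Hle). assert (H2 := Cmod_rev_triangle (u n) (a - u n)).
    replace (u n + (a - u n)) with a in H2 by ring. rewrite (Cmod_sub_sym a) in H2.
    specialize (H0 n0). lra.
  - enough (Cmod (u n) <= rsum (fun k => Cmod (u k)) n0) by lra.
    clear Hn. induction n0; [lia|]. simpl. specialize (H0 n0). assert (H2 := Cmod_ge_0 (u n0)).
    destruct (Nat.eq_dec n n0) as [->|Hne]; [lra|]. assert (n < n0)%nat by lia.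
    specialize (IHn0 H3). lra.
Qed.

Lemma Clim_mult u v a b : Clim u a -> Clim v b -> Clim (fun n => u n * v n) (a * b).
Proof.
  intros Hu Hv. destruct (Clim_bounded u a Hu) as [B [_ HB]].
  apply (Clim_le _ _ (fun n => B * Cmod (v n - b) + Cmod b * Cmod (u n - a))%R).
  - intros n. replace (u n * v n - a * b) with (u n * (v n - b) + b * (u n - a)) by ring.
    eapply Rle_trans; [apply Cmod_triangle|]. rewrite !Cmod_mult.
    specialize (HB n). assert (H := Cmod_ge_0 (v n - b)). nra.
  - replace (Finite 0) with (Finite (B * 0 + Cmod b * 0)) by (f_equal; ring).
    apply is_lim_seq_plus'; apply (is_lim_seq_scal_l _ _ (Finite 0)); assumption.
Qed.

Lemma Clim_inv u a : a <> RtoC 0 -> Clim u a -> Clim (fun n => / u n) (/ a).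
Proof.
  intros Ha H. assert (Ha' : 0 < Cmod a) by now apply Cmod_gt_0.
  apply Clim_eps. intros eps He.
  (* The first bound keeps |u n| above |a|/2; the second makes |a - u n| / (|u n| |a|) smaller than
     [eps]. *)
  set (e := Rmin (Cmod a / 2) (eps * Cmod a * Cmod a / 2)).
  assert (He' : 0 < e).
  { apply Rmin_pos; [lra|]. assert (0 < eps * Cmod a) by nra. nra. }
  destruct (proj1 (Clim_eps u a) H e He') as [n0 Hn]. exists n0. intros n Hle.
  specialize (Hn n Hle).
  assert (e <= Cmod a / 2) by apply Rmin_l.
  assert (e <= eps * Cmod a * Cmod a / 2) by apply Rmin_r.
  assert (H2 := Cmod_rev_triangle a (u n - a)).
  replace (a + (u n - a)) with (u n) in H2 by ring.
  assert (Hu : 0 < Cmod (u n)) by lra.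
  assert (Hu0 : u n <> RtoC 0) by now apply Cmod_gt_0.
  replace (/ u n - / a) with ((a - u n) / (u n * a)) by (field; auto).
  rewrite Cmod_div, Cmod_mult, (Cmod_sub_sym a) by now apply Cmult_neq_0.
  assert (0 < Cmod (u n) * Cmod a) by nra.
  apply Rlt_div_l; [assumption|].
  assert (eps * Cmod a * Cmod a / 2 <= eps * (Cmod (u n) * Cmod a)); [|lra].
  assert (0 < eps * Cmod a) by nra. nra.
Qed.

Lemma Clim_unique u a b : Clim u a -> Clim u b -> a = b.
Proof.
  intros Ha Hb. assert (H := Clim_minus u u a b Ha Hb).
  apply Clim_Cmod in H.
  apply (is_lim_seq_ext _ (fun _ => 0%R)) in H.
  - assert (H0 := is_lim_seq_const 0). apply is_lim_seq_unique in H. apply is_lim_seq_unique in H0.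
    rewrite H0 in H. injection H as H. symmetry in H. apply Cmod_eq_0 in H.
    replace a with (b + (a - b)) by ring. rewrite H. ring.
  - intros n. replace (u n - u n) with (RtoC 0) by ring. apply Cmod_0.
Qed.

Lemma Clim_incr u a : Clim u a -> Clim (fun n => u (S n)) a.
Proof. apply (is_lim_seq_incr_1 (fun n => Cmod (u n - a))). Qed.

Lemma Clim_decr u a : Clim (fun n => u (S n)) a -> Clim u a.
Proof. apply (is_lim_seq_incr_1 (fun n => Cmod (u n - a))). Qed.

Lemma Clim_incr_n u a k : Clim u a -> Clim (fun n => u (n + k)%nat) a.
Proof. apply (is_lim_seq_incr_n (fun n => Cmod (u n - a)) k). Qed.

Lemma Clim_RtoC (u : nat -> R) (a : R) : is_lim_seq u a -> Clim (fun n => RtoC (u n)) (RtoC a).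
Proof.
  intros H. unfold Clim. apply (is_lim_seq_ext (fun n => Rabs (u n - a))).
  - intros n. rewrite <- RtoC_minus, Cmod_R. reflexivity.
  - apply (proj1 (is_lim_seq_abs_0 _)). replace (Finite 0) with (Finite (a - a)) by (f_equal; ring).
    apply is_lim_seq_minus'; [exact H|apply is_lim_seq_const].
Qed.

Lemma Clim_Re u a : Clim u a -> is_lim_seq (fun n => Re (u n)) (Re a).
Proof.
  intros H. apply is_lim_seq_spec. intros [eps He].
  destruct (proj1 (Clim_eps u a) H eps He) as [n0 Hn]. exists n0. intros n Hle.
  specialize (Hn n Hle). simpl. eapply Rle_lt_trans; [|exact Hn].
  apply (re_le_Cmod (u n - a)).
Qed.

Lemma Clim_Im u a : Clim u a -> is_lim_seq (fun n => Im (u n)) (Im a).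
Proof.
  intros H. apply is_lim_seq_spec. intros [eps He].
  destruct (proj1 (Clim_eps u a) H eps He) as [n0 Hn]. exists n0. intros n Hle.
  specialize (Hn n Hle). simpl. eapply Rle_lt_trans; [|exact Hn].
  apply (im_le_Cmod (u n - a)).
Qed.

Lemma Clim_Re_Im u (a : C) :
  is_lim_seq (fun n => Re (u n)) (Re a) -> is_lim_seq (fun n => Im (u n)) (Im a) -> Clim u a.
Proof.
  intros H1 H2.
  apply (Clim_le _ _ (fun n => Rabs (Re (u n) - Re a) + Rabs (Im (u n) - Im a))%R).
  - intros n. apply (Cmod_le_re_im (u n - a)).
  - replace (Finite 0) with (Finite (0 + 0)) by (f_equal; ring). apply is_lim_seq_plus'.
    + apply (proj1 (is_lim_seq_abs_0 _)). replace (Finite 0) with (Finite (Re a - Re a)) by (f_equal; ring).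
      apply is_lim_seq_minus'; [exact H1|apply is_lim_seq_const].
    + apply (proj1 (is_lim_seq_abs_0 _)). replace (Finite 0) with (Finite (Im a - Im a)) by (f_equal; ring).
      apply is_lim_seq_minus'; [exact H2|apply is_lim_seq_const].
Qed.

Lemma Clim_Cmod_le u a B : Clim u a -> (forall n, Cmod (u n) <= B) -> Cmod a <= B.
Proof.
  intros H HB. apply Clim_Cmod in H.
  apply (is_lim_seq_le _ (fun _ => B) (Finite (Cmod a)) (Finite B) HB H (is_lim_seq_const B)).
Qed.

(** * Sums of complex series *)

Lemma is_series_rsum g G : is_series g G <-> is_lim_seq (rsum g) G.
Proof.
  split; intros H.
  - apply is_lim_seq_incr_1. apply (is_lim_seq_ext (sum_n g)); [apply rsum_sum_n|exact H].
  - change (is_lim_seq (sum_n g) G). apply (is_lim_seq_ext (fun n => rsum g (S n))).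
    + intros n; symmetry; apply rsum_sum_n.
    + now apply is_lim_seq_incr_1 in H.
Qed.

Lemma Cis_series_Csums f l : Cis_series f l <-> Csums f l.
Proof.
  split; intros H.
  - apply Clim_decr. apply Clim_eps. intros eps He.
    destruct (proj1 (filterlim_locally_ball_norm (K := C_AbsRing) (U := C_NormedModule)
       (F := eventually) (sum_n f) l) H (mkposreal eps He)) as [n0 Hn].
    exists n0. intros n Hle. specialize (Hn n Hle).
    unfold ball_norm in Hn. rewrite <- csum_sum_n. exact Hn.
  - apply (filterlim_locally_ball_norm (K := C_AbsRing) (U := C_NormedModule)
       (F := eventually) (sum_n f) l). intros [eps He].
    destruct (proj1 (Clim_eps _ _) H eps He) as [n0 Hn]. exists n0. intros n Hle.
    unfold ball_norm. simpl.
    assert (H1 : Cmod (csum f (S n) - l) < eps) by (apply Hn; lia).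
    rewrite <- csum_sum_n in H1. exact H1.
Qed.

Lemma CSeries_unique f l : Csums f l -> CSeries f = l.
Proof.
  intros H. unfold CSeries. apply C_ext; simpl.
  - apply is_series_unique, is_series_rsum.
    apply (is_lim_seq_ext (fun n => Re (csum f n))); [apply Re_csum|now apply Clim_Re].
  - apply is_series_unique, is_series_rsum.
    apply (is_lim_seq_ext (fun n => Im (csum f n))); [apply Im_csum|now apply Clim_Im].
Qed.

Lemma Csums_unique f a b : Csums f a -> Csums f b -> a = b.
Proof. apply Clim_unique. Qed.

Lemma Csums_ext f g l : (forall n, f n = g n) -> Csums f l -> Csums g l.
Proof. intros H. apply Clim_ext. intros n. apply csum_ext. auto. Qed.

Lemma Csums_plus f g a b : Csums f a -> Csums g b -> Csums (fun n => f n + g n) (a + b).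
Proof.
  intros Hf Hg. apply (Clim_ext (fun n => csum f n + csum g n)).
  - intros n; symmetry; apply csum_plus.
  - now apply Clim_plus.
Qed.

Lemma Csums_scal c f a : Csums f a -> Csums (fun n => c * f n) (c * a).
Proof.
  intros Hf. apply (Clim_ext (fun n => c * csum f n)).
  - intros n; symmetry; apply csum_scal.
  - now apply Clim_scal.
Qed.

Lemma Csums_minus f g a b : Csums f a -> Csums g b -> Csums (fun n => f n - g n) (a - b).
Proof.
  intros Hf Hg. apply (Clim_ext (fun n => csum f n - csum g n)).
  - intros n; symmetry; apply csum_minus.
  - now apply Clim_minus.
Qed.

Lemma Csums_csum (f : nat -> nat -> C) (l : nat -> C) K :
  (forall k, (k < K)%nat -> Csums (f k) (l k)) ->
  Csums (fun n => csum (fun k => f k n) K) (csum l K).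
Proof.
  intros H. apply (Clim_ext (fun n => csum (fun k => csum (f k) n) K)).
  - intros n. apply csum_swap.
  - now apply Clim_csum.
Qed.

Lemma Csums_zero : Csums (fun _ => RtoC 0) (RtoC 0).
Proof.
  apply (Clim_ext (fun _ => RtoC 0)); [|apply Clim_const].
  intros n; symmetry; now apply csum_zero.
Qed.

Lemma Csums_shift f l n0 : Csums f l -> Csums (fun n => f (n0 + n)%nat) (l - csum f n0).
Proof.
  intros H. apply (Clim_ext (fun n => csum f (n + n0) - csum f n0)).
  - intros n. rewrite Nat.add_comm, csum_add. ring.
  - apply Clim_minus; [now apply Clim_incr_n|apply Clim_const].
Qed.

Lemma Csums_S f l : Csums (fun n => f (S n)) l -> Csums f (f 0%nat + l).
Proof.
  intros H. apply Clim_decr.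
  apply (Clim_ext (fun n => f 0%nat + csum (fun k => f (S k)) n)).
  - intros n. symmetry; apply csum_S_l.
  - apply Clim_plus; [apply Clim_const|exact H].
Qed.

Lemma Csums_terms f l : Csums f l -> Clim f (RtoC 0).
Proof.
  intros H. apply (Clim_ext (fun n => csum f (S n) - csum f n)); [intros; simpl; ring|].
  replace (RtoC 0) with (l - l) by ring. apply Clim_minus; [now apply Clim_incr|exact H].
Qed.

(** * Dominated convergence and interchange of summations *)

Lemma Csums_dominated f g :
  (forall n, Cmod (f n) <= g n) -> ex_series g -> exists l, Csums f l.
Proof.
  intros H Hg.
  assert (HR : ex_series (fun n => Re (f n))).
  { apply (ex_series_le (K := R_AbsRing) (V := R_CompleteNormedModule) _ g); [|exact Hg]. intros n. eapply Rle_trans; [|apply H].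
    apply re_le_Cmod. }
  assert (HI : ex_series (fun n => Im (f n))).
  { apply (ex_series_le (K := R_AbsRing) (V := R_CompleteNormedModule) _ g); [|exact Hg]. intros n. eapply Rle_trans; [|apply H].
    apply im_le_Cmod. }
  destruct HR as [a Ha]. destruct HI as [b Hb]. exists (a, b).
  apply Clim_Re_Im.
  - apply (is_lim_seq_ext (rsum (fun k => Re (f k)))); [intros; now rewrite Re_csum|].
    now apply is_series_rsum.
  - apply (is_lim_seq_ext (rsum (fun k => Im (f k)))); [intros; now rewrite Im_csum|].
    now apply is_series_rsum.
Qed.

Lemma rsum_le_Series g n : (forall k, 0 <= g k) -> ex_series g -> rsum g n <= Series g.
Proof.
  intros Hg [G HG]. rewrite (is_series_unique _ _ HG).
  apply is_series_rsum in HG.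
  apply (is_lim_seq_incr_compare (rsum g)); [exact HG|].
  intros k; simpl. specialize (Hg k). lra.
Qed.

Lemma Csums_tail_le f g l n :
  (forall k, Cmod (f k) <= g k) -> ex_series g -> Csums f l ->
  Cmod (l - csum f n) <= Series g - rsum g n.
Proof.
  intros H Hg Hl. assert (H1 := Csums_shift f l n Hl).
  apply (Clim_Cmod_le _ _ _ H1). intros m.
  eapply Rle_trans; [apply (Cmod_csum_le _ (fun k => g (n + k)%nat)); intros; apply H|].
  assert (rsum g (n + m) <= Series g).
  { apply rsum_le_Series; [|exact Hg]. intros k. eapply Rle_trans; [apply Cmod_ge_0|apply H]. }
  enough (rsum g (n + m) = rsum g n + rsum (fun k => g (n + k)%nat) m)%R by lra.
  clear. induction m; simpl; [rewrite Nat.add_0_r; ring|].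
  rewrite Nat.add_succ_r. simpl. rewrite IHm. ring.
Qed.

Lemma Csums_bound f g l :
  (forall k, Cmod (f k) <= g k) -> ex_series g -> Csums f l -> Cmod l <= Series g.
Proof.
  intros H Hg Hl. assert (H1 := Csums_tail_le f g l 0 H Hg Hl). simpl in H1.
  replace (l - RtoC 0) with l in H1 by ring. lra.
Qed.

Lemma tail_lim g : ex_series g -> is_lim_seq (fun n => Series g - rsum g n)%R 0.
Proof.
  intros [G HG]. rewrite (is_series_unique _ _ HG). apply is_series_rsum in HG.
  replace (Finite 0) with (Finite (G - G)) by (f_equal; ring).
  apply is_lim_seq_minus'; [apply is_lim_seq_const|exact HG].
Qed.

(** Tannery's theorem, dominated convergence for series: the tails beyond some K are small uniformly
    in n, and the first K terms converge one by one. The limit series converges by the same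
    majorant, so its sum is produced rather than assumed. *)
Lemma tannery (a : nat -> nat -> C) (b : nat -> C) (A : nat -> C) (g : nat -> R) :
  (forall n k, Cmod (a n k) <= g k) -> ex_series g ->
  (forall k, Clim (fun n => a n k) (b k)) ->
  (forall n, Csums (a n) (A n)) ->
  exists B, Csums b B /\ Clim A B.
Proof.
  intros H Hg Hlim HA.
  assert (Hb : forall k, Cmod (b k) <= g k).
  { intros k. apply (Clim_Cmod_le _ _ _ (Hlim k)). intros n; apply H. }
  destruct (Csums_dominated b g Hb Hg) as [B HB]. exists B; split; [exact HB|].
  apply Clim_eps. intros eps He.
  assert (Ht := tail_lim g Hg). apply is_lim_seq_spec in Ht.
  assert (He3 : 0 < eps / 3) by lra.
  destruct (Ht (mkposreal _ He3)) as [K HK]. specialize (HK K (le_n _)). simpl in HK.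
  apply Rabs_def2 in HK.
  assert (Hf : Clim (fun n => csum (a n) K) (csum b K)) by (apply Clim_csum; auto).
  destruct (proj1 (Clim_eps _ _) Hf (eps / 3)%R He3) as [n0 Hn]. exists n0. intros n Hle.
  specialize (Hn n Hle).
  assert (H1 := Csums_tail_le (a n) g (A n) K (H n) Hg (HA n)).
  assert (H2 := Csums_tail_le b g B K Hb Hg HB).
  assert (H3 := Cmod_triangle3 (A n) (csum (a n) K) B).
  assert (H4 := Cmod_triangle3 (csum (a n) K) (csum b K) B).
  rewrite (Cmod_sub_sym (csum b K)) in H4. lra.
Qed.

Lemma tannery_lim (a : nat -> nat -> C) (b : nat -> C) (A : nat -> C) (B : C) (g : nat -> R) :
  (forall n k, Cmod (a n k) <= g k) -> ex_series g ->
  (forall k, Clim (fun n => a n k) (b k)) ->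
  (forall n, Csums (a n) (A n)) -> Csums b B -> Clim A B.
Proof.
  intros H Hg Hlim HA HB. destruct (tannery a b A g H Hg Hlim HA) as [B' [HB' HA']].
  now rewrite (Csums_unique _ _ _ HB HB').
Qed.

(** Tannery's theorem for the sequence of partial sums over columns. Only the partial sums of each
    row need a summable bound, which is weaker than absolute summability of the double series. *)
Lemma Csums_swap (a : nat -> nat -> C) (r c : nat -> C) (g : nat -> R) (S : C) :
  (forall n k, Cmod (csum (a n) k) <= g n) -> ex_series g ->
  (forall n, Csums (a n) (r n)) ->
  (forall k, Csums (fun n => a n k) (c k)) ->
  Csums r S -> Csums c S.
Proof.
  intros H Hg Hr Hc HS.
  apply (tannery_lim (fun k n => csum (a n) k) r (csum c) S g); auto.
  intros k. apply (Csums_csum (fun j n => a n j) c k). auto.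
Qed.

(** * The exponential and derivatives along the real line *)

Lemma Cexp_plus a b : Cexp (a + b) = Cexp a * Cexp b.
Proof.
  unfold Cexp. destruct a as [a1 a2], b as [b1 b2]. cbn [Re Im fst snd Cplus].
  rewrite exp_plus, cos_plus, sin_plus. apply C_ext; simpl; ring.
Qed.

Lemma Cexp_R (x : R) : Cexp (RtoC x) = RtoC (exp x).
Proof.
  unfold Cexp. cbn [Re Im fst snd RtoC]. rewrite cos_0, sin_0. apply C_ext; simpl; ring.
Qed.

Lemma Cexp_0 : Cexp (RtoC 0) = RtoC 1.
Proof. now rewrite Cexp_R, exp_0. Qed.

Lemma Cmod_Cexp z : Cmod (Cexp z) = exp (Re z).
Proof.
  unfold Cexp. rewrite Cmod_mult, Cmod_R, Rabs_pos_eq by (left; apply exp_pos).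
  unfold Cmod; cbn [fst snd]. replace (cos (Im z) ^ 2 + sin (Im z) ^ 2)%R with 1%R.
  - rewrite sqrt_1. ring.
  - assert (H := sin2_cos2 (Im z)). unfold Rsqr in H. lra.
Qed.

Lemma Cexp_neq_0 z : Cexp z <> RtoC 0.
Proof. apply Cmod_gt_0. rewrite Cmod_Cexp. apply exp_pos. Qed.

Lemma Cexp_opp z : Cexp (- z) = / Cexp z.
Proof.
  assert (H : Cexp (- z) * Cexp z = RtoC 1).
  { rewrite <- Cexp_plus. replace (- z + z) with (RtoC 0) by ring. apply Cexp_0. }
  assert (Hz := Cexp_neq_0 z).
  replace (Cexp (- z)) with (Cexp (- z) * Cexp z / Cexp z) by (field; exact Hz).
  rewrite H. field. exact Hz.
Qed.

Lemma Cexp_nat (n : nat) z : Cexp (RtoC (INR n) * z) = Cexp z ^ n.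
Proof.
  induction n.
  - simpl. replace (RtoC 0 * z) with (RtoC 0) by ring. apply Cexp_0.
  - rewrite S_INR, RtoC_plus, Cmult_plus_distr_r, Cexp_plus, IHn. simpl Cpow. rewrite Cmult_1_l. ring.
Qed.

Lemma Cexp_Ci (t : R) : Cexp (Ci * RtoC t) = (cos t, sin t).
Proof.
  unfold Cexp. assert (E1 : Re (Ci * RtoC t) = 0%R) by (simpl; ring).
  assert (E2 : Im (Ci * RtoC t) = t) by (simpl; ring).
  rewrite E1, E2, exp_0. apply C_ext; simpl; ring.
Qed.

Lemma RtoC_neq_0 (x : R) : x <> 0%R -> RtoC x <> RtoC 0.
Proof. intros H E. apply H. now injection E. Qed.

(** Derivative of a complex function of a real variable, taken componentwise. All differentiation
    below is along the real line; complex analyticity enters through power series only. *)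
Definition cderiv (f : R -> C) (x : R) (l : C) : Prop :=
  is_derive (fun t => Re (f t)) x (Re l) /\ is_derive (fun t => Im (f t)) x (Im l).

Lemma cderiv_ext f g x l : (forall t, f t = g t) -> cderiv f x l -> cderiv g x l.
Proof.
  intros H [H1 H2]. split; [eapply is_derive_ext; [|exact H1]|eapply is_derive_ext; [|exact H2]];
  intros; simpl; now rewrite H.
Qed.

Lemma cderiv_const a x : cderiv (fun _ => a) x (RtoC 0).
Proof. split; apply is_derive_Reals, derivable_pt_lim_const. Qed.

Lemma cderiv_RtoC (f : R -> R) x l : is_derive f x l -> cderiv (fun t => RtoC (f t)) x (RtoC l).
Proof. intros H. split; [exact H|apply is_derive_Reals, derivable_pt_lim_const]. Qed.

Lemma cderiv_plus f g x a b :
  cderiv f x a -> cderiv g x b -> cderiv (fun t => f t + g t) x (a + b).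
Proof.
  intros [Hf1 Hf2] [Hg1 Hg2]. split; simpl.
  - apply (is_derive_plus (V := R_NormedModule) (fun t => Re (f t)) (fun t => Re (g t))); assumption.
  - apply (is_derive_plus (V := R_NormedModule) (fun t => Im (f t)) (fun t => Im (g t))); assumption.
Qed.

Lemma cderiv_mult f g x a b :
  cderiv f x a -> cderiv g x b -> cderiv (fun t => f t * g t) x (a * g x + f x * b).
Proof.
  intros [Hf1 Hf2] [Hg1 Hg2].
  assert (Hm : forall u v p q, is_derive u x p -> is_derive v x q ->
    is_derive (fun t => (u t * v t)%R) x (p * v x + u x * q)%R).
  { intros u v p q Hu Hv. apply is_derive_Reals.
    apply (derivable_pt_lim_mult u v); now apply is_derive_Reals. }
  split; simpl.
  - evar_last. apply (is_derive_minus (V := R_NormedModule)).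
    apply (Hm (fun t => Re (f t)) (fun t => Re (g t))); eassumption.
    apply (Hm (fun t => Im (f t)) (fun t => Im (g t))); eassumption.
    unfold minus, plus, opp, Re, Im; simpl. ring.
  - evar_last. apply (is_derive_plus (V := R_NormedModule)).
    apply (Hm (fun t => Re (f t)) (fun t => Im (g t))); eassumption.
    apply (Hm (fun t => Im (f t)) (fun t => Re (g t))); eassumption.
    unfold minus, plus, opp, Re, Im; simpl. ring.
Qed.

Lemma cderiv_scal c f x a : cderiv f x a -> cderiv (fun t => c * f t) x (c * a).
Proof.
  intros H. replace (c * a) with (RtoC 0 * f x + c * a) by ring.
  apply (cderiv_mult (fun _ => c)); [apply cderiv_const|exact H].
Qed.

Lemma cderiv_opp f x a : cderiv f x a -> cderiv (fun t => - f t) x (- a).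
Proof.
  intros H. apply (cderiv_ext (fun t => (- RtoC 1) * f t)); [intros; ring|].
  replace (- a) with ((- RtoC 1) * a) by ring. now apply cderiv_scal.
Qed.

Lemma cderiv_minus f g x a b :
  cderiv f x a -> cderiv g x b -> cderiv (fun t => f t - g t) x (a - b).
Proof. intros Hf Hg. apply cderiv_plus; [exact Hf|now apply cderiv_opp]. Qed.

Lemma cderiv_csum (f : nat -> R -> C) (d : nat -> C) x n :
  (forall k, (k < n)%nat -> cderiv (f k) x (d k)) ->
  cderiv (fun t => csum (fun k => f k t) n) x (csum d n).
Proof.
  induction n; intros H; simpl; [apply cderiv_const|].
  apply cderiv_plus; auto with arith.
Qed.

Lemma cderiv_comp f (h : R -> R) x l (d : R) :
  cderiv f (h x) l -> is_derive h x d -> cderiv (fun t => f (h t)) x (RtoC d * l).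
Proof.
  intros [H1 H2] Hh. split.
  - evar_last. apply (is_derive_comp (V := R_NormedModule) (fun t => Re (f t)) h x (Re l) d); assumption.
    unfold scal; simpl; unfold mult, Re, Im; simpl; ring.
  - evar_last. apply (is_derive_comp (V := R_NormedModule) (fun t => Im (f t)) h x (Im l) d); assumption.
    unfold scal; simpl; unfold mult, Re, Im; simpl; ring.
Qed.

Lemma cderiv_line z x : cderiv (fun t => RtoC t * z) x z.
Proof.
  assert (H : cderiv (fun t => RtoC t) x (RtoC 1)).
  { apply cderiv_RtoC. auto_derive; auto. }
  apply (cderiv_scal z) in H. rewrite Cmult_1_r in H.
  apply (cderiv_ext (fun t => z * RtoC t)); [intros; ring|exact H].
Qed.

Lemma cderiv_Cexp g x l : cderiv g x l -> cderiv (fun t => Cexp (g t)) x (l * Cexp (g x)).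
Proof.
  assert (H : forall u v p q : R -> R, is_derive u x (p x) -> is_derive v x (q x) ->
    is_derive (fun t => exp (u t) * cos (v t))%R x
      (p x * (exp (u x) * cos (v x)) - q x * (exp (u x) * sin (v x)))%R /\
    is_derive (fun t => exp (u t) * sin (v t))%R x
      (p x * (exp (u x) * sin (v x)) + q x * (exp (u x) * cos (v x)))%R).
  { intros u v p q Hu Hv.
    assert (E1 := is_derive_unique _ _ _ Hu). assert (E2 := is_derive_unique _ _ _ Hv).
    split; auto_derive; try (repeat split; eexists; eassumption);
      change (fun x : R => u x) with u; change (fun x : R => v x) with v; rewrite E1, E2; ring. }
  intros [H1 H2].
  destruct (H (fun t => Re (g t)) (fun t => Im (g t)) (fun _ => Re l) (fun _ => Im l) H1 H2)
    as [H3 H4].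
  split.
  - eapply is_derive_ext; [|evar_last; [exact H3|]].
    + intros t; unfold Cexp; simpl; ring.
    + unfold Cexp; simpl; unfold Re, Im; ring.
  - eapply is_derive_ext; [|evar_last; [exact H4|]].
    + intros t; unfold Cexp; simpl; ring.
    + unfold Cexp; simpl; unfold Re, Im; ring.
Qed.

Lemma cderiv_inv g x l : g x <> RtoC 0 -> cderiv g x l ->
  cderiv (fun t => / g t) x (- l / (g x * g x)).
Proof.
  assert (H : forall u v p q : R -> R, (u x ^ 2 + v x ^ 2 <> 0)%R ->
    is_derive u x (p x) -> is_derive v x (q x) ->
    is_derive (fun t => u t / (u t ^ 2 + v t ^ 2))%R x
      ((p x * (v x ^ 2 - u x ^ 2) - 2 * u x * v x * q x) / (u x ^ 2 + v x ^ 2) ^ 2)%R).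
  { intros u v p q Hn Hu Hv.
    assert (E1 := is_derive_unique _ _ _ Hu). assert (E2 := is_derive_unique _ _ _ Hv).
    auto_derive; [repeat split; try (eexists; eassumption); exact Hn|].
    change (fun x : R => u x) with u; change (fun x : R => v x) with v. rewrite E1, E2.
    field. exact Hn. }
  intros Hg [H1 H2].
  assert (Hn : (Re (g x) ^ 2 + Im (g x) ^ 2 <> 0)%R).
  { intros E. apply Hg. apply C_ext; simpl; nra. }
  assert (Hn' : (Im (g x) ^ 2 + Re (g x) ^ 2 <> 0)%R) by (rewrite Rplus_comm; exact Hn).
  assert (H3 := H (fun t => Re (g t)) (fun t => Im (g t)) (fun _ => Re l) (fun _ => Im l) Hn H1 H2).
  assert (H4 := H (fun t => Im (g t)) (fun t => Re (g t)) (fun _ => Im l) (fun _ => Re l) Hn' H2 H1).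
  assert (E : / g x * / g x = / (g x * g x)) by (field; exact Hg).
  assert (Ed : - l / (g x * g x) = - l * (/ g x * / g x)) by (rewrite E; reflexivity).
  rewrite Ed. split.
  - eapply is_derive_ext; [|evar_last; [exact H3|]].
    + intros t; unfold Cinv; simpl; reflexivity.
    + unfold Cinv; simpl; unfold Re, Im in *; simpl in *; field; intros Hc; apply Hn; lra.
  - eapply is_derive_ext;
      [|evar_last; [apply (is_derive_opp (V := R_NormedModule) _ _ _ H4)|]].
    + intros t; unfold Cinv; simpl; unfold opp, Re, Im; simpl. unfold Rdiv.
      rewrite Ropp_mult_distr_l_reverse. do 3 f_equal. ring.
    + unfold Cinv, opp; simpl; unfold Re, Im in *; simpl in *; field; repeat split; intros Hc; apply Hn; lra.
Qed.

(** * Mean value inequalities *)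

Lemma nondecreasing_of_derive (h h' : R -> R) a b : a <= b ->
  (forall t, a <= t <= b -> is_derive h t (h' t)) ->
  (forall t, a <= t <= b -> 0 <= h' t) -> h a <= h b.
Proof.
  intros Hab Hd Hp.
  destruct (MVT_gen h a b h') as [c [Hc Heq]].
  - intros t Ht. rewrite Rmin_left, Rmax_right in Ht by lra. apply Hd; lra.
  - intros t Ht. rewrite Rmin_left, Rmax_right in Ht by lra.
    apply derivable_continuous_pt. exists (h' t). apply is_derive_Reals, Hd; lra.
  - rewrite Rmin_left, Rmax_right in Hc by lra.
    assert (H := Hp c Hc). assert (0 <= h' c * (b - a)) by nra. lra.
Qed.

(** The increment is paired with its own conjugate [v]: the real function [m * h - Re (v * f)] is
    nondecreasing because |v| = m, while Re (v (f b - f a)) = m^2. Dividing by m gives the claim. *)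
Lemma Cmod_diff_le (f f' : R -> C) (h h' : R -> R) a b : a <= b ->
  (forall t, a <= t <= b -> cderiv f t (f' t)) ->
  (forall t, a <= t <= b -> is_derive h t (h' t)) ->
  (forall t, a <= t <= b -> Cmod (f' t) <= h' t) ->
  Cmod (f b - f a) <= h b - h a.
Proof.
  intros Hab Hf Hh Hle.
  destruct (Ceq_dec (f b - f a) (RtoC 0)) as [E|E].
  { rewrite E, Cmod_0. enough (h a <= h b) by lra.
    apply (nondecreasing_of_derive h h'); auto. intros t Ht.
    eapply Rle_trans; [apply Cmod_ge_0|apply Hle, Ht]. }
  set (m := Cmod (f b - f a)). assert (Hm : 0 < m) by now apply Cmod_gt_0.
  set (v := Cconj (f b - f a)).
  assert (H : (m * h a - Re (v * f a) <= m * h b - Re (v * f b))%R).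
  { apply (nondecreasing_of_derive (fun t => m * h t - Re (v * f t))%R
      (fun t => m * h' t - Re (v * f' t))%R); [exact Hab| |].
    - intros t Ht. apply (is_derive_minus (V := R_NormedModule)).
      + apply is_derive_scal; auto.
      + apply (cderiv_scal v f t (f' t)); auto.
    - intros t Ht. assert (H1 := re_le_Cmod (v * f' t)).
      rewrite Cmod_mult in H1. unfold v in H1. rewrite Cmod_conj in H1. fold m v in H1.
      assert (H2 := Rle_abs (Re (v * f' t))). assert (H3 := Hle t Ht). nra. }
  assert (Hv : (Re (v * f b) - Re (v * f a))%R = (m * m)%R).
  { unfold v, m. change (Re (v * f b) - Re (v * f a))%R with (Re (v * f b - v * f a)).
    assert (E2 := Cmod2_conj (f b - f a)).
    replace (v * f b - v * f a) with ((f b - f a) * Cconj (f b - f a)) by (unfold v; ring).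
    unfold v. replace (Re (Cconj (f b - f a) * f b) - Re (Cconj (f b - f a) * f a))%R with
      (Re ((f b - f a) * Cconj (f b - f a))) by (simpl; unfold Re, Im; ring).
    rewrite <- E2. simpl. unfold Re; simpl. ring. }
  assert (m * m <= m * (h b - h a)) by nra. nra.
Qed.

Lemma Cmod_diff_le_const (f f' : R -> C) B a b : a <= b ->
  (forall t, a <= t <= b -> cderiv f t (f' t)) ->
  (forall t, a <= t <= b -> Cmod (f' t) <= B) ->
  Cmod (f b - f a) <= B * (b - a).
Proof.
  intros Hab Hf Hle.
  replace (B * (b - a))%R with (B * b - B * a)%R by ring.
  apply (Cmod_diff_le f f' (fun t => B * t)%R (fun _ => B)); auto.
  intros t _. auto_derive; auto; ring.
Qed.

Lemma is_derive_taylor_term (a t : R) k :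
  is_derive (fun s => ((s - a) ^ S k / INR (fact (S k)))%R) t ((t - a) ^ k / INR (fact k))%R.
Proof.
  apply (is_derive_ext (fun s => (/ INR (fact (S k)) * (s - a) ^ S k)%R));
    [intros; unfold Rdiv; apply Rmult_comm|].
  evar_last.
  - apply is_derive_scal. apply (is_derive_pow (fun s => (s - a)%R) (S k) t 1%R).
    auto_derive; auto; ring.
  - change (Init.Nat.pred (S k)) with k. rewrite fact_simpl, mult_INR.
    assert (H1 := INR_fact_neq_0 k). assert (H2 := not_0_INR (S k) (Nat.neq_succ_0 k)).
    field. auto.
Qed.

(** * Taylor and Euler-Maclaurin estimates *)

(** Induction on n: as a function of the upper endpoint, a Taylor remainder of [F 0] has as
    derivative the remainder of [F 1] of one order less, and the mean value inequality takes the
    place of the remainder integral. *)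
Lemma taylor_bound (F : nat -> R -> C) B a n : forall b, a <= b ->
  (forall k t, (k < n)%nat -> a <= t <= b -> cderiv (F k) t (F (S k) t)) ->
  (forall t, a <= t <= b -> Cmod (F n t) <= B) ->
  Cmod (F 0%nat b - csum (fun k => RtoC ((b - a) ^ k / INR (fact k)) * F k a) n)
    <= B * ((b - a) ^ n / INR (fact n)).
Proof.
  revert F. induction n; intros F b Hab HF HB.
  - simpl. replace (F 0%nat b - RtoC 0) with (F 0%nat b) by ring.
    assert (H := HB b (conj Hab (Rle_refl b))). lra.
  - set (G := fun t => F 0%nat t - csum (fun k => RtoC ((t - a) ^ k / INR (fact k)) * F k a) (S n)).
    assert (Ga : G a = RtoC 0).
    { unfold G. rewrite csum_S_l, csum_zero.
      - simpl. replace (1 / 1)%R with 1%R by field. ring.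
      - intros k _. replace (a - a)%R with 0%R by ring. rewrite pow_i by lia.
        unfold Rdiv. rewrite Rmult_0_l. ring. }
    replace (F 0%nat b - csum (fun k => RtoC ((b - a) ^ k / INR (fact k)) * F k a) (S n))
      with (G b - G a) by (rewrite Ga; unfold G; ring).
    replace (B * ((b - a) ^ S n / INR (fact (S n))))%R with
      (B * ((b - a) ^ S n / INR (fact (S n))) - B * ((a - a) ^ S n / INR (fact (S n))))%R
      by (replace (a - a)%R with 0%R by ring; rewrite pow_i by lia; unfold Rdiv; ring).
    apply (Cmod_diff_le G
      (fun t => F 1%nat t - csum (fun k => RtoC ((t - a) ^ k / INR (fact k)) * F (S k) a) n)
      (fun t => B * ((t - a) ^ S n / INR (fact (S n))))%R
      (fun t => B * ((t - a) ^ n / INR (fact n)))%R); [exact Hab| | |].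
    + intros t Ht. apply cderiv_minus; [apply HF; [lia|exact Ht]|].
      apply (cderiv_ext (fun t => F 0%nat a +
        csum (fun k => RtoC ((t - a) ^ S k / INR (fact (S k))) * F (S k) a) n)).
      { intros s. rewrite csum_S_l. simpl ((s - a) ^ 0)%R. simpl (fact 0). simpl INR.
        replace (1 / 1)%R with 1%R by field. ring. }
      replace (csum (fun k => RtoC ((t - a) ^ k / INR (fact k)) * F (S k) a) n) with
        (RtoC 0 + csum (fun k => RtoC ((t - a) ^ k / INR (fact k)) * F (S k) a) n) by ring.
      apply cderiv_plus; [apply cderiv_const|].
      apply (cderiv_csum (fun k t => RtoC ((t - a) ^ S k / INR (fact (S k))) * F (S k) a)).
      intros k _.
      replace (RtoC ((t - a) ^ k / INR (fact k)) * F (S k) a) with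
        (F (S k) a * RtoC ((t - a) ^ k / INR (fact k))) by ring.
      apply (cderiv_ext (fun t => F (S k) a * RtoC ((t - a) ^ S k / INR (fact (S k)))));
        [intros; ring|].
      apply cderiv_scal, cderiv_RtoC, is_derive_taylor_term.
    + intros t Ht. apply is_derive_scal, is_derive_taylor_term.
    + intros t Ht. apply (IHn (fun k => F (S k))); [lra| |].
      * intros k s Hk Hs. apply HF; [lia|lra].
      * intros s Hs. apply HB; lra.
Qed.

(** * Euler-Maclaurin summation over one unit interval *)

Lemma csum_triangle (a : nat -> nat -> C) n :
  csum (fun i => csum (fun j => a i (i + j)%nat) (n - i)) n
  = csum (fun m => csum (fun i => a i m) (S m)) n.
Proof.
  induction n; [reflexivity|].
  change (csum (fun i => csum (fun j => a i (i + j)%nat) (S n - i)) n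
    + csum (fun j => a n (n + j)%nat) (S n - n)
    = csum (fun m => csum (fun i => a i m) (S m)) n + (csum (fun i => a i n) n + a n n)).
  rewrite <- IHn. replace (S n - n)%nat with 1%nat by lia.
  rewrite (csum_ext _ (fun i => csum (fun j => a i (i + j)%nat) (n - i) + a i n)).
  - rewrite csum_plus. simpl. rewrite Nat.add_0_r. ring.
  - intros k Hk. replace (S n - k)%nat with (S (n - k)) by lia. simpl.
    do 2 f_equal. lia.
Qed.

(* The values [beta i] play the role of the Bernoulli numbers B_i / i!. *)
Definition bernoulli_like (beta : nat -> C) : Prop :=
  forall m, csum (fun i => beta i / RtoC (INR (fact (S m - i)))) (S m)
            = if Nat.eqb m 0 then RtoC 1 else RtoC 0.

(* Here [F 1] is the summand, [F 0] an antiderivative and [F (S k)] the k-th derivative. *)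
Lemma euler_maclaurin_step (beta : nat -> C) (Hb : bernoulli_like beta)
    (F : nat -> R -> C) B x K :
  (forall k t, (k <= S K)%nat -> x <= t <= x + 1 -> cderiv (F k) t (F (S k) t)) ->
  (forall t, x <= t <= x + 1 -> Cmod (F (S (S K)) t) <= B) ->
  Cmod (F 1%nat x - csum (fun i => beta i * (F i (x + 1)%R - F i x)) (S K))
    <= B * rsum (fun i => Cmod (beta i)) (S K).
Proof.
  intros HF HB.
  (* [T i] is the Taylor expansion at [x] of the increment of [F i] over the unit interval, stopped
     at the term with [F (S K)]. *)
  set (T := fun i => csum (fun l => F (i + S l)%nat x / RtoC (INR (fact (S l)))) (S K - i)).
  assert (HT : csum (fun i => beta i * T i) (S K) = F 1%nat x).
  { rewrite (csum_ext _ (fun i => csum (fun l => beta i * (F (i + S l)%nat x /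
      RtoC (INR (fact (S l))))) (S K - i))) by (intros; unfold T; now rewrite <- csum_scal).
    (* Collecting the coefficient of [F (S m) x] along diagonals gives the left-hand side of the
       Bernoulli recursion, so only m = 0 survives. *)
    assert (E := csum_triangle
      (fun i m => F (S m) x * (beta i / RtoC (INR (fact (S m - i))))) (S K)).
    cbv beta in E.
    rewrite (csum_ext _ (fun i => csum (fun l => F (S (i + l)) x *
       (beta i / RtoC (INR (fact (S (i + l) - i))))) (S K - i))).
    - rewrite E.
      rewrite (csum_ext _ (fun m => F (S m) x * (if Nat.eqb m 0 then RtoC 1 else RtoC 0))).
      + rewrite (csum_single _ (S K) 0%nat); [simpl; ring|lia|].
        intros i _ Hi. destruct i; [congruence|]. simpl. ring.
      + intros m _. rewrite csum_scal, (Hb m). reflexivity.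
    - intros i Hi. apply csum_ext. intros l Hl.
      replace (S (i + l) - i)%nat with (S l) by lia. rewrite Nat.add_succ_r.
      field. apply RtoC_neq_0, INR_fact_neq_0. }
  rewrite <- HT at 1. rewrite <- csum_minus.
  rewrite <- rsum_scal. apply Cmod_csum_le. intros i Hi.
  replace (beta i * T i - beta i * (F i (x + 1)%R - F i x)) with
    (- (beta i * (F i (x + 1)%R - (F i x + T i)))) by ring.
  rewrite Cmod_opp, Cmod_mult.
  enough (Cmod (F i (x + 1)%R - (F i x + T i)) <= B) by (assert (H1 := Cmod_ge_0 (beta i)); nra).
  (* The order of the expansion depends on [i] so that the remainder always involves [F (S (S K))];
     hence the single bound [B], the factorial being at least 1. *)
  assert (H := taylor_bound (fun k => F (i + k)%nat) B x (S (S K - i)) (x + 1)%R).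
  assert (Hx : x <= x + 1) by lra. specialize (H Hx).
  assert (HB0 : 0 <= B) by (eapply Rle_trans; [apply Cmod_ge_0|apply (HB x); lra]).
  eapply Rle_trans; [|eapply Rle_trans; [apply H|]].
  - rewrite csum_S_l, Nat.add_0_r. replace (x + 1 - x)%R with 1%R by ring.
    apply Req_le. f_equal. f_equal. f_equal. f_equal.
    + simpl. replace (1 / 1)%R with 1%R by field. ring.
    + apply csum_ext. intros l Hl. rewrite pow1. unfold Rdiv.
      rewrite Rmult_1_l, RtoC_inv by apply INR_fact_neq_0. unfold Cdiv. ring.
  - intros k t Hk Ht. rewrite Nat.add_succ_r. apply HF; [lia|exact Ht].
  - intros t Ht. replace (i + S (S K - i))%nat with (S (S K)) by lia. now apply HB.
  - replace (x + 1 - x)%R with 1%R by ring. rewrite pow1.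
    set (m := fact _). assert (H1 : 1 <= INR m).
    { apply (le_INR 1). assert (0 < m)%nat by apply lt_O_fact. lia. }
    assert (1 / INR m <= 1) by (apply Rle_div_l; lra). nra.
Qed.

(** * The Taylor series of the exponential *)

Lemma exp_le_exp x y : x <= y -> exp x <= exp y.
Proof. intros [H| ->]; [left; now apply exp_increasing|right; reflexivity]. Qed.

Lemma pow_fact_lim (x : R) : is_lim_seq (fun n => x ^ n / INR (fact n))%R 0.
Proof.
  assert (H := is_exp_Reals x). apply is_pseries_R in H.
  assert (E : ex_series (fun n => / INR (fact n) * x ^ n)%R) by now exists (exp x).
  apply ex_series_lim_0 in E. eapply is_lim_seq_ext; [|exact E].
  intros n; simpl; unfold Rdiv; ring.
Qed.

Lemma Cexp_taylor z n :
  Cmod (Cexp z - csum (fun k => z ^ k / RtoC (INR (fact k))) n)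
    <= exp (Cmod z) * (Cmod z ^ n / INR (fact n)).
Proof.
  assert (H := taylor_bound (fun k t => z ^ k * Cexp (RtoC t * z))
    (Cmod z ^ n * exp (Cmod z)) 0 n 1).
  assert (H01 : 0 <= 1) by lra. specialize (H H01).
  eapply Rle_trans; [|eapply Rle_trans; [apply H|]].
  - apply Req_le. f_equal. unfold Cminus at 1 2. f_equal.
    + rewrite !Cmult_1_l. reflexivity.
    + f_equal. apply csum_ext. intros k _. cbv beta. replace (1 - 0)%R with 1%R by ring.
      rewrite pow1, Cmult_0_l, Cexp_0. unfold Rdiv.
      rewrite Rmult_1_l, RtoC_inv by apply INR_fact_neq_0. unfold Cdiv; ring.
  - intros k t _ _. simpl Cpow. replace (z * z ^ k * Cexp (RtoC t * z)) with
      (z ^ k * (z * Cexp (RtoC t * z))) by ring.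
    apply cderiv_scal. apply (cderiv_Cexp (fun t => RtoC t * z)), cderiv_line.
  - intros t Ht. rewrite Cmod_mult, Cmod_pow, Cmod_Cexp.
    apply Rmult_le_compat_l; [apply pow_le, Cmod_ge_0|].
    apply exp_le_exp. assert (H1 := re_le_Cmod (RtoC t * z)). rewrite Cmod_mult, Cmod_R in H1.
    rewrite (Rabs_pos_eq t) in H1 by lra. assert (H2 := Rle_abs (Re (RtoC t * z))).
    assert (H3 := Cmod_ge_0 z). nra.
  - replace (1 - 0)%R with 1%R by ring. rewrite pow1. apply Req_le. field. apply INR_fact_neq_0.
Qed.

Lemma Csums_Cexp z : Csums (fun k => z ^ k / RtoC (INR (fact k))) (Cexp z).
Proof.
  apply (Clim_le _ _ (fun n => exp (Cmod z) * (Cmod z ^ n / INR (fact n)))%R).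
  - intros n. rewrite Cmod_sub_sym. apply Cexp_taylor.
  - replace (Finite 0) with (Rbar_mult (exp (Cmod z)) 0) by (simpl; f_equal; ring).
    apply is_lim_seq_scal_l, pow_fact_lim.
Qed.

Lemma Cexp_bound1 z : Cmod (Cexp z - RtoC 1) <= exp (Cmod z) * Cmod z.
Proof.
  assert (H := Cexp_taylor z 1). simpl in H.
  replace (RtoC 0 + RtoC 1 / RtoC 1) with (RtoC 1) in H by field.
  replace (Cmod z * 1 / 1)%R with (Cmod z) in H by field. exact H.
Qed.

Lemma Cexp_bound2 z : Cmod (Cexp z - RtoC 1 - z) <= exp (Cmod z) * Cmod z ^ 2.
Proof.
  assert (H := Cexp_taylor z 2). simpl in H.
  replace (RtoC 0 + RtoC 1 / RtoC 1 + z * RtoC 1 / RtoC 1) with (RtoC 1 + z) in H by field.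
  replace (Cexp z - RtoC 1 - z) with (Cexp z - (RtoC 1 + z)) by ring.
  eapply Rle_trans; [exact H|]. apply Rmult_le_compat_l; [left; apply exp_pos|].
  assert (H1 := Cmod_ge_0 z). simpl. assert (0 <= Cmod z * (Cmod z * 1)) by nra.
  apply Rle_div_l; lra.
Qed.

(** * Cauchy products *)

Lemma ex_series_mult_l (c : R) (a : nat -> R) : ex_series a -> ex_series (fun n => c * a n)%R.
Proof.
  intros [l Hl]. exists (c * l)%R. apply (is_series_scal (V := R_NormedModule) c a l Hl).
Qed.

Lemma ex_series_mult_r (c : R) (a : nat -> R) : ex_series a -> ex_series (fun n => a n * c)%R.
Proof.
  intros H. apply (ex_series_ext (fun n => c * a n)%R); [intros; apply Rmult_comm|].
  now apply ex_series_mult_l.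
Qed.

Lemma Csums_finite f n : (forall k, (n <= k)%nat -> f k = RtoC 0) -> Csums f (csum f n).
Proof.
  intros H. apply (Clim_ext_loc (fun _ => csum f n) _ _ n); [|apply Clim_const].
  intros m Hm. replace m with (n + (m - n))%nat by lia. rewrite csum_add.
  rewrite (csum_zero (fun k => f (n + k)%nat)); [ring|]. intros; apply H; lia.
Qed.

(** The n-th partial sum of the product is the sum of a_i times the partial sum of b of length n -
    i. For fixed i the second factor tends to B, and [ga i * Series gb] is a majorant. *)
Lemma Csums_cauchy_product a b A B (ga gb : nat -> R) :
  (forall k, Cmod (a k) <= ga k) -> ex_series ga ->
  (forall k, Cmod (b k) <= gb k) -> ex_series gb ->
  Csums a A -> Csums b B ->
  Csums (fun m => csum (fun i => a i * b (m - i)%nat) (S m)) (A * B).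
Proof.
  intros Ha Hga Hb Hgb HA HB.
  apply (Clim_ext (fun n => csum (fun i => a i * csum b (n - i)) n)).
  { intros n. assert (E := csum_triangle (fun i m => a i * b (m - i)%nat) n). cbv beta in E.
    rewrite <- E. apply csum_ext. intros i Hi. rewrite <- csum_scal. apply csum_ext.
    intros j Hj. do 2 f_equal. lia. }
  (* Padding with zeros turns the finite sum into a series, the form in which Tannery's theorem
     applies. *)
  set (t := fun n i => if Nat.ltb i n then a i * csum b (n - i) else RtoC 0).
  assert (Hgb0 : forall k, 0 <= gb k) by (intros k; eapply Rle_trans; [apply Cmod_ge_0|apply Hb]).
  apply (tannery_lim t (fun i => a i * B) _ _ (fun i => ga i * Series gb)%R).
  - intros n i. unfold t. destruct (Nat.ltb i n).
    + rewrite Cmod_mult. apply Rmult_le_compat; try apply Cmod_ge_0; [apply Ha|].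
      eapply Rle_trans; [apply (Cmod_csum_le _ gb); intros; apply Hb|].
      now apply rsum_le_Series.
    + rewrite Cmod_0. apply Rmult_le_pos.
      * eapply Rle_trans; [apply Cmod_ge_0|apply Ha].
      * apply (rsum_le_Series gb 0 Hgb0 Hgb).
  - now apply ex_series_mult_r.
  - intros i. apply (Clim_ext_loc (fun n => a i * csum b (n - i)) _ _ (S i)).
    + intros n Hn. unfold t. destruct (Nat.ltb_spec i n); [reflexivity|lia].
    + apply Clim_scal. apply Clim_eps. intros eps He.
      destruct (proj1 (Clim_eps _ _) HB eps He) as [n0 Hn]. exists (n0 + i)%nat.
      intros n Hle. apply Hn. lia.
  - intros n. rewrite (csum_ext _ (t n)).
    + apply Csums_finite. intros k Hk. unfold t. destruct (Nat.ltb_spec k n); [lia|reflexivity].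
    + intros i Hi. unfold t. destruct (Nat.ltb_spec i n); [reflexivity|lia].
  - apply (Csums_ext (fun i => B * a i)); [intros; ring|].
    rewrite Cmult_comm. now apply Csums_scal.
Qed.

(** * Power series and the identity theorem *)

(** The radius is part of the predicate, so that sums, products and series of functions are formed
    on one fixed disc; [Canalytic_at] hides the radius. *)
Definition power_series_on (f : C -> C) (s0 : C) (r : R) : Prop :=
  exists a : nat -> C, forall z, Cmod z < r -> Csums (fun k => a k * z ^ k) (f (s0 + z)).

Lemma ex_series_geom_dominated (q B : R) : 0 <= q < 1 -> ex_series (fun k => B * q ^ k)%R.
Proof.
  intros Hq. apply (ex_series_mult_l B (fun k => q ^ k)%R), ex_series_geom.
  rewrite Rabs_pos_eq; lra.
Qed.

(** Abel's lemma: convergence at a radius [rho] strictly between [x] and [r] bounds the terms there,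
    and at [x] they are smaller by a geometric factor. *)
Lemma power_series_abs (a : nat -> C) (h : C -> C) r :
  (forall z, Cmod z < r -> Csums (fun k => a k * z ^ k) (h z)) ->
  forall x : R, 0 <= x < r -> ex_series (fun k => Cmod (a k) * x ^ k)%R.
Proof.
  intros H x [Hx0 Hxr]. set (rho := ((x + r) / 2)%R).
  assert (Hrho : 0 < rho) by (unfold rho; lra).
  assert (Hm : Cmod (RtoC rho) < r) by (rewrite Cmod_R, Rabs_pos_eq; unfold rho; lra).
  destruct (Clim_bounded _ _ (Csums_terms _ _ (H _ Hm))) as [B [HB0 HB]].
  apply (ex_series_le (K := R_AbsRing) (V := R_CompleteNormedModule) _
    (fun k => B * (x / rho) ^ k)%R).
  - intros k. change (Rabs (Cmod (a k) * x ^ k) <= B * (x / rho) ^ k).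
    rewrite Rabs_pos_eq by (apply Rmult_le_pos; [apply Cmod_ge_0|now apply pow_le]).
    specialize (HB k). rewrite Cmod_mult, Cmod_pow, Cmod_R, Rabs_pos_eq in HB by lra.
    replace (x ^ k)%R with ((x / rho) ^ k * rho ^ k)%R.
    + assert (0 <= (x / rho) ^ k) by (apply pow_le, Rdiv_le_0_compat; lra). nra.
    + rewrite <- Rpow_mult_distr. f_equal. field. lra.
  - apply ex_series_geom_dominated. split.
    + apply Rdiv_le_0_compat; lra.
    + apply Rlt_div_l; [exact Hrho|]. unfold rho; lra.
Qed.

Lemma power_series_on_ext f g s0 r : (forall z, Cmod z < r -> f (s0 + z) = g (s0 + z)) ->
  power_series_on f s0 r -> power_series_on g s0 r.
Proof. intros H [a Ha]. exists a. intros z Hz. rewrite <- H; auto. Qed.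

Lemma power_series_on_const c s0 r : power_series_on (fun _ => c) s0 r.
Proof.
  exists (fun k => if Nat.eqb k 0 then c else RtoC 0). intros z _.
  assert (H := Csums_finite (fun k => (if Nat.eqb k 0 then c else RtoC 0) * z ^ k) 1).
  simpl in H. replace (RtoC 0 + c * RtoC 1) with c in H by ring. apply H.
  intros k Hk. destruct k; [lia|]. simpl. ring.
Qed.

Lemma power_series_on_id s0 r : power_series_on (fun s => s) s0 r.
Proof.
  exists (fun k => match k with 0 => s0 | 1 => RtoC 1 | _ => RtoC 0 end). intros z _.
  assert (H := Csums_finite (fun k => match k with 0%nat => s0 | 1%nat => RtoC 1 | _ => RtoC 0 end * z ^ k) 2).
  simpl in H. replace (RtoC 0 + s0 * RtoC 1 + RtoC 1 * (z * RtoC 1)) with (s0 + z) in H by ring.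
  apply H. intros k Hk. destruct k as [|[|k]]; try lia. simpl. ring.
Qed.

Lemma power_series_on_plus f g s0 r :
  power_series_on f s0 r -> power_series_on g s0 r -> power_series_on (fun s => f s + g s) s0 r.
Proof.
  intros [a Ha] [b Hb]. exists (fun k => a k + b k). intros z Hz.
  apply (Csums_ext (fun k => a k * z ^ k + b k * z ^ k)); [intros; ring|].
  apply Csums_plus; auto.
Qed.

Lemma power_series_on_mult f g s0 r :
  power_series_on f s0 r -> power_series_on g s0 r -> power_series_on (fun s => f s * g s) s0 r.
Proof.
  intros [a Ha] [b Hb]. exists (fun m => csum (fun i => a i * b (m - i)%nat) (S m)).
  intros z Hz.
  apply (Csums_ext (fun m => csum (fun i => (a i * z ^ i) * (b (m - i)%nat * z ^ (m - i))) (S m))).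
  - intros m. rewrite Cmult_comm, <- csum_scal. apply csum_ext. intros i Hi.
    replace (z ^ m) with (z ^ i * z ^ (m - i)) by (rewrite <- Cpow_add_r; f_equal; lia). ring.
  - assert (Hz' : 0 <= Cmod z < r) by (split; [apply Cmod_ge_0|exact Hz]).
    apply (Csums_cauchy_product (fun i => a i * z ^ i) (fun j => b j * z ^ j) _ _
      (fun k => Cmod (a k) * Cmod z ^ k)%R
      (fun k => Cmod (b k) * Cmod z ^ k)%R); auto.
    + intros k. rewrite Cmod_mult, Cmod_pow. lra.
    + now apply (power_series_abs a (fun z => f (s0 + z)) r).
    + intros k. rewrite Cmod_mult, Cmod_pow. lra.
    + now apply (power_series_abs b (fun z => g (s0 + z)) r).
Qed.

Lemma power_series_on_scal c f s0 r :
  power_series_on f s0 r -> power_series_on (fun s => c * f s) s0 r.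
Proof. intros H. apply power_series_on_mult; [apply power_series_on_const|exact H]. Qed.

Lemma power_series_on_minus f g s0 r :
  power_series_on f s0 r -> power_series_on g s0 r -> power_series_on (fun s => f s - g s) s0 r.
Proof.
  intros Hf Hg. apply (power_series_on_ext (fun s => f s + (- RtoC 1) * g s)); [intros; ring|].
  apply power_series_on_plus; [exact Hf|now apply power_series_on_scal].
Qed.

Lemma power_series_on_csum (f : nat -> C -> C) s0 r n :
  (forall k, (k < n)%nat -> power_series_on (f k) s0 r) ->
  power_series_on (fun s => csum (fun k => f k s) n) s0 r.
Proof.
  induction n; intros H; simpl; [apply power_series_on_const|].
  apply power_series_on_plus; auto with arith.
Qed.

Lemma power_series_on_Cexp c s0 r : power_series_on (fun s => Cexp (c * s)) s0 r.
Proof.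
  exists (fun k => Cexp (c * s0) * (c ^ k / RtoC (INR (fact k)))). intros z _.
  rewrite Cmult_plus_distr_l, Cexp_plus.
  apply (Csums_ext (fun k => Cexp (c * s0) * ((c * z) ^ k / RtoC (INR (fact k))))).
  - intros k. rewrite Cpow_mult_l. field. apply RtoC_neq_0, INR_fact_neq_0.
  - apply Csums_scal, Csums_Cexp.
Qed.

Lemma csum_geom q n : (RtoC 1 - q) * csum (fun k => q ^ k) n = RtoC 1 - q ^ n.
Proof. induction n; simpl; [ring|]. rewrite Cmult_plus_distr_l, IHn. ring. Qed.

Lemma one_minus_neq_0 q : Cmod q < 1 -> RtoC 1 - q <> RtoC 0.
Proof.
  intros Hq E. replace q with (RtoC 1) in Hq.
  - rewrite Cmod_1 in Hq. lra.
  - replace q with (RtoC 1 - (RtoC 1 - q)) by ring. rewrite E. ring.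
Qed.

Lemma Csums_geom q : Cmod q < 1 -> Csums (fun k => q ^ k) (/ (RtoC 1 - q)).
Proof.
  intros Hq.
  assert (Hn := one_minus_neq_0 q Hq).
  apply (Clim_ext (fun n => (RtoC 1 - q ^ n) * / (RtoC 1 - q))).
  { intros n. rewrite <- csum_geom. field. exact Hn. }
  replace (/ (RtoC 1 - q)) with ((RtoC 1 - RtoC 0) * / (RtoC 1 - q)) at 1 by (field; exact Hn).
  apply Clim_mult; [|apply Clim_const].
  apply Clim_minus; [apply Clim_const|].
  apply (Clim_le _ _ (fun n => Cmod q ^ n)%R).
  - intros n. replace (q ^ n - RtoC 0) with (q ^ n) by ring. rewrite Cmod_pow. lra.
  - apply is_lim_seq_geom. rewrite Rabs_pos_eq; [exact Hq|apply Cmod_ge_0].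
Qed.

(** Geometric series in -z/(s0 - p); the disc reaches exactly to the pole. *)
Lemma power_series_on_inv p s0 : s0 <> p ->
  power_series_on (fun s => / (s - p)) s0 (Cmod (s0 - p)).
Proof.
  intros Hp.
  assert (Hd : s0 - p <> RtoC 0).
  { intros E. apply Hp. replace s0 with (p + (s0 - p)) by ring. rewrite E. ring. }
  exists (fun k => / (s0 - p) * (- / (s0 - p)) ^ k). intros z Hz.
  set (q := - / (s0 - p) * z).
  assert (Hq : Cmod q < 1).
  { unfold q. rewrite Cmod_mult, Cmod_opp, Cmod_inv by exact Hd.
    assert (0 < Cmod (s0 - p)) by now apply Cmod_gt_0.
    rewrite Rmult_comm. apply Rlt_div_l; lra. }
  assert (Hn : s0 + z - p <> RtoC 0).
  { intros E. replace z with (- (s0 - p)) in Hz.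
    - rewrite Cmod_opp in Hz. lra.
    - replace z with (s0 + z - p - (s0 - p)) by ring. rewrite E. ring. }
  apply (Csums_ext (fun k => / (s0 - p) * q ^ k)).
  - intros k. unfold q. rewrite Cpow_mult_l. ring.
  - replace (/ (s0 + z - p)) with (/ (s0 - p) * / (RtoC 1 - q)).
    + apply Csums_scal, Csums_geom, Hq.
    + unfold q. field. repeat split; auto.
Qed.

(** * Roots of unity and the Cauchy estimates *)

Lemma Cexp_Ci_neq_1 t : t <> 0%R -> Rabs t < 2 * PI -> Cexp (Ci * RtoC t) <> RtoC 1.
Proof.
  intros H0 H1 E. rewrite Cexp_Ci in E.
  assert (E1 : cos t = 1%R) by (injection E; auto).
  replace t with (2 * (t / 2))%R in E1 by field. rewrite cos_2a_sin in E1.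
  assert (Hs : sin (t / 2) = 0%R) by nra. clear E E1.
  destruct (Rlt_or_le 0 t) as [Ht|Ht].
  - rewrite Rabs_pos_eq in H1 by lra.
    assert (0 < sin (t / 2)) by (apply sin_gt_0; lra). lra.
  - rewrite Rabs_left in H1 by lra.
    assert (0 < sin (- (t / 2))) by (apply sin_gt_0; lra). rewrite sin_neg in H. lra.
Qed.

Lemma Cexp_2PI (n : nat) : Cexp (Ci * RtoC (2 * PI * INR n)) = RtoC 1.
Proof.
  rewrite Cexp_Ci. replace (2 * PI * INR n)%R with (0 + 2 * INR n * PI)%R by ring.
  rewrite cos_period, sin_period, cos_0, sin_0. reflexivity.
Qed.

Definition unity (m : nat) : C := Cexp (Ci * RtoC (2 * PI / INR m)).

Lemma unity_pow m k : unity m ^ k = Cexp (Ci * RtoC (2 * PI * INR k / INR m)).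
Proof.
  unfold unity. rewrite <- Cexp_nat. f_equal.
  replace (2 * PI * INR k / INR m)%R with (INR k * (2 * PI / INR m))%R by (unfold Rdiv; ring).
  rewrite RtoC_mult. ring.
Qed.

Lemma unity_pow_m m : (0 < m)%nat -> unity m ^ m = RtoC 1.
Proof.
  intros Hm. rewrite unity_pow. assert (INR m <> 0%R) by (apply not_0_INR; lia).
  replace (2 * PI * INR m / INR m)%R with (2 * PI * INR 1)%R by (simpl; field; auto).
  apply Cexp_2PI.
Qed.

Lemma unity_neq_0 m : unity m <> RtoC 0.
Proof. apply Cexp_neq_0. Qed.

Lemma Cmod_unity_pow m k : Cmod (unity m ^ k) = 1%R.
Proof.
  rewrite Cmod_pow. unfold unity. rewrite Cmod_Cexp.
  replace (Re (Ci * RtoC (2 * PI / INR m))) with 0%R by (simpl; ring).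
  rewrite exp_0. apply pow1.
Qed.

Lemma unity_pow_neq m i k : (i < m)%nat -> (k < m)%nat -> i <> k -> unity m ^ i <> unity m ^ k.
Proof.
  assert (H : forall i k, (i < k)%nat -> (k < m)%nat -> unity m ^ i <> unity m ^ k).
  { intros i' k' Hik Hk E. replace k' with (i' + (k' - i'))%nat in E by lia.
    rewrite Cpow_add_r in E.
    assert (E1 : unity m ^ (k' - i') = RtoC 1).
    { assert (Hn := Cpow_nz (unity m) i' (unity_neq_0 m)).
      replace (unity m ^ (k' - i')) with (unity m ^ i' * unity m ^ (k' - i') / unity m ^ i')
        by (field; exact Hn).
      rewrite <- E. field. exact Hn. }
    rewrite unity_pow in E1. revert E1.
    assert (Hm : 0 < INR m) by (apply lt_0_INR; lia).
    assert (Hd : 0 < INR (k' - i')) by (apply lt_0_INR; lia).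
    assert (Hd2 : INR (k' - i') < INR m) by (apply lt_INR; lia).
    assert (Hpi := PI_RGT_0).
    apply Cexp_Ci_neq_1.
    - apply Rgt_not_eq. apply Rdiv_lt_0_compat; nra.
    - rewrite Rabs_pos_eq by (apply Rdiv_le_0_compat; nra).
      apply Rlt_div_l; nra. }
  intros Hi Hk Hne. destruct (Nat.lt_total i k) as [Hl|[He|Hl]].
  - now apply H.
  - contradiction.
  - intros E; symmetry in E; revert E; now apply H.
Qed.

Lemma unity_orthogonality m i k : (i < m)%nat -> (k < m)%nat -> i <> k ->
  csum (fun l => (unity m ^ i / unity m ^ k) ^ l) m = RtoC 0.
Proof.
  intros Hi Hk Hne. set (q := unity m ^ i / unity m ^ k).
  assert (Hk0 := Cpow_nz (unity m) k (unity_neq_0 m)).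
  assert (Hq : RtoC 1 - q <> RtoC 0).
  { intros E. apply (unity_pow_neq m i k Hi Hk Hne).
    replace (unity m ^ i) with (q * unity m ^ k) by (unfold q; field; exact Hk0).
    replace q with (RtoC 1 - (RtoC 1 - q)) by ring. rewrite E. ring. }
  assert (Hm : q ^ m = RtoC 1).
  { unfold q, Cdiv. rewrite Cpow_mult_l, Cpow_inv by exact Hk0.
    rewrite <- !Cpow_mult_r, (Nat.mul_comm i), (Nat.mul_comm k), !Cpow_mult_r.
    rewrite unity_pow_m by lia. rewrite !Cpow_1_l. field. }
  assert (E := csum_geom q m). rewrite Hm in E.
  replace (csum (fun l => q ^ l) m) with ((RtoC 1 - q) * csum (fun l => q ^ l) m / (RtoC 1 - q))
    by (field; exact Hq).
  rewrite E. field. exact Hq.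
Qed.

(** The contour integral is replaced by a mean over the m-th roots of unity, which extracts a_k
    rho^k exactly from the partial sum of length m. The truncation error is at most a tail of the
    absolutely convergent series and disappears as m grows. *)
Lemma cauchy_estimate (a : nat -> C) (h : C -> C) r M rho k :
  (forall z, Cmod z < r -> Csums (fun k => a k * z ^ k) (h z)) ->
  (forall z, Cmod z < r -> Cmod (h z) <= M) ->
  0 <= rho < r -> Cmod (a k) * rho ^ k <= M.
Proof.
  intros H HM Hrho.
  set (g := fun k => (Cmod (a k) * rho ^ k)%R).
  assert (Hg : ex_series g) by now apply (power_series_abs a h r).
  enough (Hm : forall m, (k < m)%nat -> g k <= M + (Series g - rsum g m)).
  { apply (is_lim_seq_le_loc (fun _ => g k) (fun m => M + (Series g - rsum g m))%R
      (Finite (g k)) (Finite M)).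
    - exists (S k). intros m Hkm. apply Hm. lia.
    - apply is_lim_seq_const.
    - replace (Finite M) with (Finite (M + 0)) by (f_equal; ring).
      apply is_lim_seq_plus'; [apply is_lim_seq_const|now apply tail_lim]. }
  intros m Hkm.
  assert (Hm0 : 0 < INR m) by (apply lt_0_INR; lia).
  set (w := fun l => RtoC rho * unity m ^ l).
  assert (Hw : forall l, Cmod (w l) = rho).
  { intros l. unfold w. rewrite Cmod_mult, Cmod_unity_pow, Cmod_R, Rabs_pos_eq; lra. }
  assert (Hwr : forall l, Cmod (w l) < r) by (intros l; rewrite Hw; lra).
  assert (Hk0 := Cpow_nz (unity m) k (unity_neq_0 m)).
  assert (Hv : forall l, Cmod ((/ unity m ^ k) ^ l) = 1%R).
  { intros l. rewrite Cmod_pow, Cmod_inv, Cmod_unity_pow, Rinv_1 by exact Hk0. apply pow1. }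
  (* By orthogonality of the m-th roots of unity, only the index i = k contributes to the mean. *)
  assert (Emain : csum (fun l => (/ unity m ^ k) ^ l * csum (fun i => a i * w l ^ i) m) m
     = RtoC (INR m) * (a k * RtoC rho ^ k)).
  { rewrite (csum_ext _ (fun l => csum (fun i =>
       (a i * RtoC rho ^ i) * (unity m ^ i / unity m ^ k) ^ l) m)).
    - rewrite csum_swap, (csum_single _ m k Hkm).
      + rewrite csum_scal, (csum_ext _ (fun _ => RtoC 1)).
        * rewrite csum_const. ring.
        * intros l _. unfold Cdiv. rewrite Cinv_r by exact Hk0. apply Cpow_1_l.
      + intros i Hi Hne. rewrite csum_scal, unity_orthogonality by auto. ring.
    - intros l _. rewrite <- csum_scal. apply csum_ext. intros i _. unfold w, Cdiv.
      rewrite !Cpow_mult_l, <- (Cpow_mult_r (unity m) l i), (Nat.mul_comm l i), Cpow_mult_r. ring. }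
  assert (E2 : RtoC (INR m) * (a k * RtoC rho ^ k) =
     csum (fun l => (/ unity m ^ k) ^ l * h (w l)) m -
     csum (fun l => (/ unity m ^ k) ^ l * (h (w l) - csum (fun i => a i * w l ^ i) m)) m).
  { rewrite <- Emain, <- csum_minus. apply csum_ext. intros; ring. }
  assert (E3 : INR m * g k <= INR m * M + INR m * (Series g - rsum g m)).
  { replace (INR m * g k)%R with (Cmod (RtoC (INR m) * (a k * RtoC rho ^ k))).
    2:{ rewrite !Cmod_mult, Cmod_pow, !Cmod_R, !Rabs_pos_eq by lra. reflexivity. }
    rewrite E2. unfold Cminus at 1. eapply Rle_trans; [apply Cmod_triangle|].
    rewrite Cmod_opp.
    assert (Hc : forall x, rsum (fun _ => x) m = (INR m * x)%R).
    { intros x. clear. induction m; [simpl; ring|]. rewrite S_INR. simpl. rewrite IHm. ring. }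
    rewrite <- !Hc. apply Rplus_le_compat; apply Cmod_csum_le; intros l _;
      rewrite Cmod_mult, Hv, Rmult_1_l.
    - now apply HM.
    - apply Csums_tail_le; auto. intros i. unfold g. rewrite Cmod_mult, Cmod_pow, Hw. lra. }
  nra.
Qed.

(* Weierstrass' theorem; the Cauchy estimates control the rearranged double series. *)
Lemma power_series_on_series (f : nat -> C -> C) (M : nat -> R) (F : C -> C) s0 r : 0 < r ->
  (forall n, power_series_on (f n) s0 r) ->
  (forall n z, Cmod z < r -> Cmod (f n (s0 + z)) <= M n) -> ex_series M ->
  (forall z, Cmod z < r -> Csums (fun n => f n (s0 + z)) (F (s0 + z))) ->
  power_series_on F s0 r.
Proof.
  intros Hr Hf HM HMs HF.
  set (a := fun n => proj1_sig (constructive_indefinite_description _ (Hf n))).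
  assert (Ha : forall n z, Cmod z < r -> Csums (fun k => a n k * z ^ k) (f n (s0 + z))).
  { intros n. exact (proj2_sig (constructive_indefinite_description _ (Hf n))). }
  clearbody a.
  assert (Hc : forall rho n k, 0 < rho < r -> Cmod (a n k) <= M n * / rho ^ k).
  { intros rho n k Hrho.
    assert (H := cauchy_estimate (a n) (fun z => f n (s0 + z)) r (M n) rho k (Ha n) (HM n)).
    assert (0 < rho ^ k) by (apply pow_lt; lra).
    apply Rle_div_r; [assumption|]. apply H. lra. }
  assert (HM0 : forall n, 0 <= M n).
  { intros n. eapply Rle_trans; [apply Cmod_ge_0|apply (HM n (RtoC 0)); rewrite Cmod_0; lra]. }
  assert (Hb : forall k, exists bk, Csums (fun n => a n k) bk).
  { intros k. apply (Csums_dominated _ (fun n => M n * / (r / 2) ^ k)%R).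
    - intros n. apply Hc. lra.
    - now apply ex_series_mult_r. }
  set (b := fun k => proj1_sig (constructive_indefinite_description _ (Hb k))).
  assert (Hb' : forall k, Csums (fun n => a n k) (b k)).
  { intros k. exact (proj2_sig (constructive_indefinite_description _ (Hb k))). }
  clearbody b.
  exists b. intros z Hz. set (rho := ((Cmod z + r) / 2)%R). assert (Hz0 := Cmod_ge_0 z).
  assert (Hrho : 0 < rho < r) by (unfold rho; lra).
  assert (Hq : 0 <= Cmod z / rho < 1).
  { split; [apply Rdiv_le_0_compat; lra|]. apply Rlt_div_l; [lra|]. unfold rho; lra. }
  set (q := (Cmod z / rho)%R) in *.
  assert (HG : ex_series (fun k => q ^ k)%R) by (apply ex_series_geom; rewrite Rabs_pos_eq; lra).
  apply (Csums_swap (fun n k => a n k * z ^ k) (fun n => f n (s0 + z)) _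
    (fun n => M n * Series (fun k => q ^ k))%R).
  - intros n k. eapply Rle_trans; [apply (Cmod_csum_le _ (fun k => M n * q ^ k)%R)|].
    + intros j _. rewrite Cmod_mult, Cmod_pow.
      replace (M n * q ^ j)%R with (M n * / rho ^ j * Cmod z ^ j)%R.
      * apply Rmult_le_compat_r; [now apply pow_le|now apply Hc].
      * unfold q, Rdiv. rewrite Rpow_mult_distr, pow_inv. ring.
    + rewrite rsum_scal. apply Rmult_le_compat_l; [apply HM0|].
      apply rsum_le_Series; [|exact HG]. intros j. apply pow_le. lra.
  - now apply ex_series_mult_r.
  - intros n. now apply Ha.
  - intros k. apply (Csums_ext (fun n => z ^ k * a n k)); [intros; ring|].
    replace (b k * z ^ k) with (z ^ k * b k) by ring. now apply Csums_scal.
  - now apply HF.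
Qed.

(** * The identity theorem *)

Lemma Canalytic_power_series f s0 : Canalytic_at f s0 <-> exists r, 0 < r /\ power_series_on f s0 r.
Proof.
  assert (Hp : forall (z : C) k, @pow_n C_AbsRing z k = z ^ k).
  { intros z k. induction k; [reflexivity|]. simpl. now rewrite <- IHk. }
  split.
  - intros [[r Hr] [a Ha]]. exists r. split; [exact Hr|]. exists a. intros z Hz.
    assert (E : s0 + z - s0 = z) by ring.
    specialize (Ha (s0 + z)). rewrite E in Ha. specialize (Ha Hz).
    apply Cis_series_Csums in Ha. eapply Csums_ext; [|exact Ha].
    intros k. cbv beta. rewrite Hp. apply Cmult_comm.
  - intros [r [Hr [a Ha]]]. exists (mkposreal r Hr), a. intros s Hs.
    specialize (Ha _ Hs). apply Cis_series_Csums.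
    replace (s0 + (s - s0)) with s in Ha by ring. eapply Csums_ext; [|exact Ha].
    intros k. cbv beta. rewrite <- Hp. apply Cmult_comm.
Qed.

(** If a_k were the first nonzero coefficient, a_k z^k would outweigh the rest of the series for
    small z. Zeros are required along a single ray from the centre, which is what continuation along
    a segment provides. *)
Lemma power_series_zero (a : nat -> C) (h : C -> C) r v eta : 0 < r -> v <> RtoC 0 -> 0 < eta ->
  (forall z, Cmod z < r -> Csums (fun k => a k * z ^ k) (h z)) ->
  (forall t : R, 0 < t < eta -> h (RtoC t * v) = RtoC 0) ->
  forall k, a k = RtoC 0.
Proof.
  intros Hr Hv Heta H Hz k. induction k as [k IH] using (well_founded_induction lt_wf).
  destruct (Ceq_dec (a k) (RtoC 0)) as [E|E]; [exact E|exfalso].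
  apply Cmod_gt_0 in E. assert (Hv' : 0 < Cmod v) by now apply Cmod_gt_0.
  set (rho := (r / 2)%R). assert (Hrho : 0 < rho < r) by (unfold rho; lra).
  assert (Hg := power_series_abs a h r H rho ltac:(lra)).
  set (G := Series (fun k => Cmod (a k) * rho ^ k)%R) in *.
  assert (HG : 0 <= G).
  { apply (rsum_le_Series (fun k => Cmod (a k) * rho ^ k)%R 0); auto.
    intros j. apply Rmult_le_pos; [apply Cmod_ge_0|apply pow_le; lra]. }
  assert (Hpk : 0 < rho ^ k) by (apply pow_lt; lra).
  (* [q] bounds |z|/rho. The terms after the k-th add up to at most (|z|/rho)^(k+1) G, so 2 q (G +
     1) <= |a_k| rho^k makes them too small to cancel the k-th. *)
  set (q := Rmin (1 / 2) (Cmod (a k) * rho ^ k / (2 * (G + 1)))).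
  assert (Hq0 : 0 < q).
  { apply Rmin_pos; [lra|]. apply Rdiv_lt_0_compat; [apply Rmult_lt_0_compat|]; lra. }
  set (t := Rmin (eta / 2) (q * rho / Cmod v)).
  assert (Ht0 : 0 < t).
  { apply Rmin_pos; [lra|]. apply Rdiv_lt_0_compat; [apply Rmult_lt_0_compat|]; lra. }
  assert (Ht1 : t <= eta / 2) by apply Rmin_l.
  assert (Ht2 : t <= q * rho / Cmod v) by apply Rmin_r.
  assert (Hq1 : q <= 1 / 2) by apply Rmin_l.
  assert (Hq2 : q <= Cmod (a k) * rho ^ k / (2 * (G + 1))) by apply Rmin_r.
  set (z := RtoC t * v).
  assert (Hzm : Cmod z = (t * Cmod v)%R) by (unfold z; rewrite Cmod_mult, Cmod_R, Rabs_pos_eq; lra).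
  assert (Hz1 : 0 < Cmod z) by (rewrite Hzm; nra).
  assert (Hz2 : Cmod z <= q * rho) by (rewrite Hzm; apply Rle_div_r; lra).
  assert (Hzr : Cmod z < r) by nra.
  assert (Hs := H z Hzr). unfold z in Hs at 2. rewrite Hz in Hs by lra.
  apply (Csums_shift _ _ (S k)) in Hs. simpl in Hs.
  rewrite csum_zero in Hs by (intros i Hi; rewrite IH by exact Hi; ring).
  set (x := Cmod z) in *. set (p := (x / rho)%R).
  assert (Hp : 0 < p <= q).
  { unfold p. split; [apply Rdiv_lt_0_compat; lra|]. apply Rle_div_l; lra. }
  assert (Hb : Cmod (RtoC 0 - (RtoC 0 + a k * z ^ k)) <= p ^ S k * G).
  { apply (Clim_Cmod_le _ _ _ Hs). intros n.
    eapply Rle_trans; [apply (Cmod_csum_le _ (fun j => p ^ S k * (Cmod (a (S (k + j))) * rho ^ (S (k + j))))%R)|].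
    - intros j _. change (Cmod (a (S (k + j)) * z ^ (S (k + j))) <=
        p ^ S k * (Cmod (a (S (k + j))) * rho ^ (S (k + j)))).
      rewrite Cmod_mult, Cmod_pow. fold x.
      replace x with (p * rho)%R by (unfold p; field; lra).
      rewrite Rpow_mult_distr.
      replace (p ^ S (k + j))%R with (p ^ S k * p ^ j)%R by (rewrite <- pow_add; f_equal; lia).
      assert (p ^ j <= 1) by (rewrite <- (pow1 j); apply pow_incr; lra).
      assert (0 <= p ^ S k) by (apply pow_le; lra).
      assert (0 <= Cmod (a (S (k + j))) * rho ^ S (k + j))
        by (apply Rmult_le_pos; [apply Cmod_ge_0|apply pow_le; lra]).
      assert (0 <= p ^ S k * (Cmod (a (S (k + j))) * rho ^ S (k + j))) by now apply Rmult_le_pos.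
      nra.
    - rewrite rsum_scal. apply Rmult_le_compat_l; [apply pow_le; lra|].
      eapply Rle_trans; [|apply (rsum_le_Series (fun k => Cmod (a k) * rho ^ k)%R (S k + n)); auto].
      + clear -Hrho. assert (Hp : forall j, 0 <= Cmod (a j) * rho ^ j)
          by (intros; apply Rmult_le_pos; [apply Cmod_ge_0|apply pow_le; lra]).
        assert (Hs : forall m, rsum (fun k => Cmod (a k) * rho ^ k)%R (S k + m) =
          (rsum (fun k => Cmod (a k) * rho ^ k)%R (S k) +
           rsum (fun j => Cmod (a (S (k + j))) * rho ^ S (k + j))%R m)%R).
        { induction m; [rewrite Nat.add_0_r; simpl; ring|].
          rewrite Nat.add_succ_r. cbn [rsum]. cbn [rsum] in IHm. rewrite IHm. simpl. ring. }
        rewrite Hs. assert (H0 := rsum_ge_0 _ (S k) Hp). lra.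
      + intros j. apply Rmult_le_pos; [apply Cmod_ge_0|apply pow_le; lra]. }
  replace (RtoC 0 - (RtoC 0 + a k * z ^ k)) with (- (a k * z ^ k)) in Hb by ring.
  rewrite Cmod_opp, Cmod_mult, Cmod_pow in Hb. fold x in Hb.
  replace x with (p * rho)%R in Hb by (unfold p; field; lra).
  rewrite Rpow_mult_distr in Hb. simpl in Hb.
  assert (Hpp : 0 < p ^ k) by (apply pow_lt; lra).
  assert (Hb2 : Cmod (a k) * rho ^ k <= p * G) by nra.
  assert (Hb3 : q * (2 * (G + 1)) <= Cmod (a k) * rho ^ k) by (apply Rle_div_r; lra).
  nra.
Qed.

Lemma Canalytic_minus f g s0 : Canalytic_at f s0 -> Canalytic_at g s0 ->
  Canalytic_at (fun s => f s - g s) s0.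
Proof.
  rewrite !Canalytic_power_series. intros [r1 [Hr1 [a Ha]]] [r2 [Hr2 [b Hb]]].
  exists (Rmin r1 r2). split; [now apply Rmin_pos|].
  assert (H1 := Rmin_l r1 r2). assert (H2 := Rmin_r r1 r2).
  apply power_series_on_minus; [exists a|exists b]; intros z Hz; [apply Ha|apply Hb]; lra.
Qed.

(** [T] is the supremum of the parameters up to which [h] vanishes on the segment. The power series
    at the corresponding point vanishes along the ray pointing back to [p], hence on a whole disc,
    so T < 1 would contradict the choice of [T]. *)
Lemma identity_theorem_segment (h : C -> C) (p q : C) eta : p <> q -> 0 < eta ->
  (forall t : R, 0 <= t <= 1 -> Canalytic_at h (p + RtoC t * (q - p))) ->
  (forall t : R, 0 <= t < eta -> h (p + RtoC t * (q - p)) = RtoC 0) ->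
  h q = RtoC 0.
Proof.
  intros Hpq Heta Han Hz.
  assert (Hd : q - p <> RtoC 0).
  { intros E. apply Hpq. replace q with (p + (q - p)) by ring. rewrite E. ring. }
  set (gam := fun t : R => p + RtoC t * (q - p)) in *.
  set (E := fun t : R => 0 <= t <= 1 /\ forall u : R, 0 <= u <= t -> h (gam u) = RtoC 0).
  assert (HE0 : E 0%R).
  { split; [lra|]. intros u Hu. apply Hz. lra. }
  destruct (completeness E) as [T [HT1 HT2]].
  - exists 1%R. intros t [Ht _]. lra.
  - now exists 0%R.
  - set (e1 := Rmin (eta / 2) 1).
    assert (He1 : E e1).
    { split; [split; [apply Rmin_glb; lra|apply Rmin_r]|].
      intros u Hu. apply Hz. assert (e1 <= eta / 2) by apply Rmin_l. lra. }
    assert (HTpos : 0 < T).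
    { apply Rlt_le_trans with e1; [apply Rmin_pos; lra|]. now apply HT1. }
    assert (HTle : T <= 1) by (apply HT2; intros t [Ht _]; lra).
    assert (Hbelow : forall u, 0 <= u < T -> h (gam u) = RtoC 0).
    { intros u Hu. destruct (classic (exists t, E t /\ u < t)) as [[t [Ht Hut]]|Hn].
      - apply Ht. lra.
      - exfalso. assert (T <= u); [|lra]. apply HT2. intros t Ht.
        apply Rnot_lt_le. intros Hlt. apply Hn. now exists t. }
    destruct (proj1 (Canalytic_power_series _ _) (Han T ltac:(lra))) as [r [Hr [a Ha]]].
    assert (Hzero : forall k, a k = RtoC 0).
    (* The direction is reversed because zeros are known only behind the point with parameter
       [T]. *)
    { apply (power_series_zero a (fun z => h (gam T + z)) r (- (q - p)) T); auto.
      - intros E1. apply Hd. replace (q - p) with (- - (q - p)) by ring. rewrite E1. ring.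
      - intros t Ht. replace (gam T + RtoC t * - (q - p)) with (gam (T - t)%R).
        + apply Hbelow. lra.
        + unfold gam. rewrite RtoC_minus. ring. }
    assert (Hball : forall z, Cmod z < r -> h (gam T + z) = RtoC 0).
    { intros z Hzr. apply (Csums_unique _ _ _ (Ha z Hzr)).
      apply (Csums_ext (fun _ => RtoC 0)); [intros; rewrite Hzero; ring|apply Csums_zero]. }
    assert (HTz : h (gam T) = RtoC 0).
    { replace (gam T) with (gam T + RtoC 0) by ring. apply Hball. rewrite Cmod_0. exact Hr. }
    destruct (Rle_lt_or_eq_dec _ _ HTle) as [HT|HT].
    + exfalso. assert (Hdm : 0 < Cmod (q - p)) by now apply Cmod_gt_0.
      set (e := Rmin (1 - T) (r / 2 / Cmod (q - p))).
      assert (He : 0 < e).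
      { apply Rmin_pos; [lra|]. apply Rdiv_lt_0_compat; lra. }
      assert (He2 : e <= 1 - T) by apply Rmin_l.
      assert (He3 : e <= r / 2 / Cmod (q - p)) by apply Rmin_r.
      apply Rle_div_r in He3; [|lra].
      assert (HE : E (T + e)%R); [|assert (T + e <= T) by (now apply HT1); lra].
      split; [lra|]. intros u Hu. destruct (Rlt_or_le u T) as [H|H]; [apply Hbelow; lra|].
      replace (gam u) with (gam T + RtoC (u - T) * (q - p)).
      * apply Hball. rewrite Cmod_mult, Cmod_R, Rabs_pos_eq by lra. nra.
      * unfold gam. rewrite RtoC_minus. ring.
    + replace q with (gam T); [exact HTz|]. rewrite HT. unfold gam. ring.
Qed.

(** * The Mittag-Leffler expansion and Bernoulli numbers *)

Lemma ex_series_telescope (g t : nat -> R) :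
  (forall n, 0 <= g n <= t n - t (S n)) -> (forall n, 0 <= t n) -> ex_series g.
Proof.
  intros Hg Ht. destruct (ex_finite_lim_seq_incr (rsum g) (t 0%nat)) as [l Hl].
  - intros n. simpl. specialize (Hg n). lra.
  - intros n. enough (rsum g n <= t 0%nat - t n) by (specialize (Ht n); lra).
    induction n; simpl; [lra|]. specialize (Hg n). lra.
  - exists l. now apply is_series_rsum.
Qed.

Lemma INR_S_ge_1 n : 1 <= INR (S n).
Proof. rewrite S_INR. assert (H := pos_INR n). lra. Qed.

Lemma ex_series_inv_sq : ex_series (fun n => / INR (S n) ^ 2)%R.
Proof.
  apply (ex_series_telescope _ (fun n => 2 / INR (S n))%R).
  - intros n. rewrite (S_INR (S n)). assert (Hx := INR_S_ge_1 n). set (x := INR (S n)) in *.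
    split; [left; apply Rinv_0_lt_compat, pow_lt; lra|].
    replace (2 / x - 2 / (x + 1))%R with (2 * / (x * (x + 1)))%R by (field; lra).
    replace (2 * / (x * (x + 1)))%R with (/ (x * (x + 1) / 2))%R by (field; lra).
    apply Rinv_le_contravar; nra.
  - intros n. assert (Hx := INR_S_ge_1 n). apply Rdiv_le_0_compat; lra.
Qed.

(** Comparison with the telescoping series of 4 / sqrt n. This majorant is used twice for the double
    sum: over x and over d. *)
Lemma ex_series_inv_three_halves : ex_series (fun n => / (INR (S n) * sqrt (INR (S n))))%R.
Proof.
  apply (ex_series_telescope _ (fun n => 4 / sqrt (INR (S n)))%R).
  - intros n. rewrite (S_INR (S n)). assert (Hx := INR_S_ge_1 n). set (x := INR (S n)) in *.
    assert (Ha : 1 <= sqrt x) by (rewrite <- sqrt_1; apply sqrt_le_1; lra).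
    assert (Hb : sqrt x <= sqrt (x + 1)) by (apply sqrt_le_1; lra).
    assert (Ha2 : (sqrt x * sqrt x = x)%R) by (apply sqrt_sqrt; lra).
    assert (Hb2 : (sqrt (x + 1) * sqrt (x + 1) = x + 1)%R) by (apply sqrt_sqrt; lra).
    set (a := sqrt x) in *. set (b := sqrt (x + 1)) in *.
    assert (Hba : b <= 3 / 2 * a) by nra.
    split; [left; apply Rinv_0_lt_compat; nra|].
    replace (4 / a - 4 / b)%R with (4 * (b * b - a * a) / (a * b * (a + b)))%R by (field; lra).
    rewrite Ha2, Hb2. replace (4 * (x + 1 - x))%R with 4%R by ring.
    replace (4 / (a * b * (a + b)))%R with (/ (a * b * (a + b) / 4))%R by (field; nra).
    apply Rinv_le_contravar; [|rewrite <- Ha2].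
    + apply Rdiv_lt_0_compat; [|lra]. apply Rmult_lt_0_compat; nra.
    + apply Rle_div_l; [lra|]. assert (0 < a * a) by nra.
      assert (b * (a + b) <= 15 / 4 * (a * a)) by nra. nra.
  - intros n. apply Rdiv_le_0_compat; [lra|]. apply sqrt_lt_R0. assert (Hx := INR_S_ge_1 n). lra.
Qed.

(** The first [n0] members of the sequence and the first [k0] terms of each series are split off: in
    the expansion of coth the denominators are bounded below only from some index on. *)
Lemma tannery_eventually (a : nat -> nat -> C) (b : nat -> C) (A : nat -> C) (g : nat -> R) n0 k0 :
  (forall n k, (n0 <= n)%nat -> (k0 <= k)%nat -> Cmod (a n k) <= g k) -> ex_series g ->
  (forall k, Clim (fun n => a n k) (b k)) ->
  (forall n, Csums (a n) (A n)) ->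
  exists B, Csums b B /\ Clim A B.
Proof.
  intros H Hg Hlim HA.
  destruct (tannery (fun n k => a (n + n0)%nat (k0 + k)%nat) (fun k => b (k0 + k)%nat)
    (fun n => A (n + n0)%nat - csum (a (n + n0)%nat) k0) (fun k => g (k0 + k)%nat))
    as [B' [HB1 HB2]].
  - intros n k. apply H; lia.
  - now apply (ex_series_incr_n g k0).
  - intros k. apply (Clim_incr_n (fun n => a n (k0 + k)%nat)), Hlim.
  - intros n. apply Csums_shift, HA.
  - exists (B' + csum b k0). split.
    + apply Clim_eps. intros eps He. destruct (proj1 (Clim_eps _ _) HB1 eps He) as [m Hm].
      exists (m + k0)%nat. intros n Hn. replace n with (k0 + (n - k0))%nat by lia.
      rewrite csum_add.
      replace (csum b k0 + csum (fun k => b (k0 + k)%nat) (n - k0) - (B' + csum b k0)) with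
        (csum (fun k => b (k0 + k)%nat) (n - k0) - B') by ring.
      apply Hm. lia.
    + assert (H1 : Clim (fun n => A (n + n0)%nat) (B' + csum b k0)).
      { apply (Clim_ext (fun n => (A (n + n0)%nat - csum (a (n + n0)%nat) k0) +
          csum (a (n + n0)%nat) k0)); [intros; ring|].
        apply Clim_plus; [exact HB2|].
        apply (Clim_incr_n (fun n => csum (a n) k0)), Clim_csum. auto. }
      apply Clim_eps. intros eps He. destruct (proj1 (Clim_eps _ _) H1 eps He) as [m Hm].
      exists (m + n0)%nat. intros n Hn. replace n with (n - n0 + n0)%nat by lia. apply Hm. lia.
Qed.

Lemma sin_le_x x : 0 <= x -> sin x <= x.
Proof. intros [H| <-]; [left; now apply sin_lt_x|rewrite sin_0; lra]. Qed.

Lemma cos_ge x : 0 <= x -> 1 - x ^ 2 / 2 <= cos x.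
Proof.
  intros Hx. enough (cos 0 - 1 + 0 ^ 2 / 2 <= cos x - 1 + x ^ 2 / 2)%R.
  { rewrite cos_0 in H. simpl in *. lra. }
  apply (nondecreasing_of_derive (fun t => cos t - 1 + t ^ 2 / 2)%R (fun t => - sin t + t)%R).
  - exact Hx.
  - intros t _. auto_derive; auto. field.
  - intros t Ht. assert (H := sin_le_x t (proj1 Ht)). lra.
Qed.

Lemma sin_ge x : 0 <= x -> x - x ^ 3 / 6 <= sin x.
Proof.
  intros Hx. enough (sin 0 - 0 + 0 ^ 3 / 6 <= sin x - x + x ^ 3 / 6)%R.
  { rewrite sin_0 in H. simpl in *. lra. }
  apply (nondecreasing_of_derive (fun t => sin t - t + t ^ 3 / 6)%R (fun t => cos t - 1 + t ^ 2 / 2)%R).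
  - exact Hx.
  - intros t _. auto_derive; auto. field.
  - intros t Ht. assert (H := cos_ge t (proj1 Ht)). lra.
Qed.

Lemma sin_ge_third x : 0 <= x <= PI / 2 -> x / 3 <= sin x.
Proof.
  intros [H0 H1]. assert (H := sin_ge x H0). assert (Hp := PI_4). assert (x <= 2) by lra.
  assert (x ^ 3 <= 4 * x) by (simpl; nra). lra.
Qed.

(** * From finite partial fractions to the Mittag-Leffler expansion *)

Lemma sq_plus_sq_neq_0 (a : C) (x : R) : 0 < Re a -> a * a + RtoC x * RtoC x <> RtoC 0.
Proof.
  intros Ha E. destruct a as [p q]. simpl in Ha.
  assert (E1 := f_equal Re E). assert (E2 := f_equal Im E). simpl in E1, E2.
  assert (q = 0%R) by nra. subst q. nra.
Qed.

(** Each 1/(1 - q zeta^k) is the geometric sum of (q zeta^k)^l over l < n, divided by 1 - q^n;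
    summed over k, orthogonality keeps only l = 0. *)
Lemma unity_inverse_sum n (Hn : (0 < n)%nat) q : RtoC 1 - q ^ n <> RtoC 0 ->
  csum (fun k => / (RtoC 1 - q * unity n ^ k)) n = RtoC (INR n) / (RtoC 1 - q ^ n).
Proof.
  intros Hqn.
  assert (Hg : forall k, (RtoC 1 - q * unity n ^ k) * csum (fun l => (q * unity n ^ k) ^ l) n
    = RtoC 1 - q ^ n).
  { intros k. rewrite csum_geom, Cpow_mult_l, <- (Cpow_mult_r _ k n), (Nat.mul_comm k n), Cpow_mult_r.
    rewrite unity_pow_m, Cpow_1_l by exact Hn. ring. }
  rewrite (csum_ext _ (fun k => / (RtoC 1 - q ^ n) *
    csum (fun l => q ^ l * (unity n ^ l / unity n ^ 0) ^ k) n)).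
  - rewrite csum_scal, csum_swap, (csum_single _ n 0%nat Hn).
    + rewrite csum_scal. simpl Cpow at 1. rewrite (csum_ext _ (fun _ => RtoC 1)).
      * rewrite csum_const. field. exact Hqn.
      * intros k _. simpl. replace (RtoC 1 / RtoC 1) with (RtoC 1) by field. apply Cpow_1_l.
    + intros l Hl Hl0. rewrite csum_scal, unity_orthogonality by auto. ring.
  - intros k _. specialize (Hg k).
    rewrite (csum_ext _ (fun l => (q * unity n ^ k) ^ l)).
    + rewrite <- Hg in Hqn |- *. field.
      split; intros E; apply Hqn; rewrite E; ring.
    + intros l _. rewrite Cpow_mult_l, <- (Cpow_mult_r _ k l), (Nat.mul_comm k l), Cpow_mult_r.
      simpl. replace (unity n ^ l / RtoC 1) with (unity n ^ l) by field. reflexivity.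
Qed.

(* Pairing the k-th and the (n-k)-th summand of the preceding identity, n = 2m+1. *)
Lemma coth_finite_expansion m q : Cmod q < 1 ->
  let n := S (m + m) in
  RtoC (INR n) / (RtoC 1 - q ^ n) = / (RtoC 1 - q) + RtoC (INR m) +
    csum (fun k => (RtoC 1 - q * q) / ((RtoC 1 - q) * (RtoC 1 - q)
      + RtoC 4 * q * RtoC (sin (PI * INR (S k) / INR n) ^ 2))) m.
Proof.
  intros Hq n. assert (Hqn : RtoC 1 - q ^ n <> RtoC 0).
  { apply one_minus_neq_0. rewrite Cmod_pow. unfold n. simpl. assert (H0 := Cmod_ge_0 q).
    assert (Cmod q ^ (m + m) <= 1) by (rewrite <- (pow1 (m + m)); apply pow_incr; lra). nra. }
  rewrite <- unity_inverse_sum by (exact Hqn || (unfold n; lia)).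
  assert (Hn0 : 0 < INR n) by (apply lt_0_INR; unfold n; lia).
  unfold n at 2. rewrite csum_S_l, csum_add.
  simpl Cpow at 1. rewrite Cmult_1_r, <- Cplus_assoc. f_equal.
  rewrite <- (csum_rev (fun k => / (RtoC 1 - q * unity n ^ S (m + k)))).
  rewrite <- csum_plus.
  transitivity (csum (fun k => RtoC 1 + (RtoC 1 - q * q) / ((RtoC 1 - q) * (RtoC 1 - q)
      + RtoC 4 * q * RtoC (sin (PI * INR (S k) / INR n) ^ 2))) m).
  2:{ rewrite csum_plus, csum_const. ring. }
  apply csum_ext. intros k Hk.
  replace (S (m + (m - 1 - k)))%nat with (n - S k)%nat by (unfold n; lia).
  set (th := (PI * INR (S k) / INR n)%R).
  assert (Hz : unity n ^ S k = Cexp (Ci * RtoC (2 * th))).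
  { rewrite unity_pow. do 3 f_equal. unfold th. field. lra. }
  assert (Hz' : unity n ^ (n - S k) = Cexp (Ci * RtoC (- (2 * th)))).
  { replace (Ci * RtoC (- (2 * th))) with (- (Ci * RtoC (2 * th))) by (rewrite RtoC_opp; ring).
    rewrite Cexp_opp, <- Hz. assert (H0 := Cpow_nz _ (S k) (unity_neq_0 n)).
    replace (unity n ^ (n - S k)) with (unity n ^ (n - S k) * unity n ^ S k / unity n ^ S k)
      by (field; exact H0).
    rewrite <- Cpow_add_r. replace (n - S k + S k)%nat with n by (unfold n; lia).
    rewrite unity_pow_m by (unfold n; lia). field. exact H0. }
  assert (Hne := one_minus_neq_0).
  assert (H1 : RtoC 1 - q * unity n ^ S k <> RtoC 0).
  { apply Hne. rewrite Cmod_mult, Cmod_unity_pow. lra. }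
  assert (H2 : RtoC 1 - q * unity n ^ (n - S k) <> RtoC 0).
  { apply Hne. rewrite Cmod_mult, Cmod_unity_pow. lra. }
  assert (Hs : (RtoC 1 - q) * (RtoC 1 - q) + RtoC 4 * q * RtoC (sin th ^ 2) =
    (RtoC 1 - q * unity n ^ S k) * (RtoC 1 - q * unity n ^ (n - S k))).
  { rewrite Hz, Hz', !Cexp_Ci, sin_neg, cos_neg, cos_2a_sin.
    assert (E : (sin (2 * th) * sin (2 * th) = 1 - (1 - 2 * sin th * sin th) * (1 - 2 * sin th * sin th))%R).
    { assert (E1 := sin2_cos2 (2 * th)). unfold Rsqr in E1. rewrite cos_2a_sin in E1. lra. }
    set (S := sin (2 * th)) in *. set (c := (1 - 2 * sin th * sin th)%R) in *.
    replace ((RtoC 1 - q * (c, S)) * (RtoC 1 - q * (c, (- S)%R))) with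
      (RtoC 1 - q * (RtoC 2 * RtoC c) + q * q * (RtoC (c * c + S * S))).
    - rewrite E. replace (c * c + (1 - c * c))%R with 1%R by ring. unfold c.
      replace (1 - 2 * sin th * sin th)%R with (1 - 2 * sin th ^ 2)%R by ring.
      rewrite !RtoC_minus, !RtoC_mult. ring.
    - apply C_ext; simpl; ring. }
  rewrite Hs.
  assert (Hp : unity n ^ S k * unity n ^ (n - S k) = RtoC 1).
  { rewrite <- Cpow_add_r. replace (S k + (n - S k))%nat with n by (unfold n; lia).
    apply unity_pow_m. unfold n; lia. }
  set (z1 := unity n ^ S k) in *. set (z2 := unity n ^ (n - S k)) in *.
  replace (q * q) with (q * q * (z1 * z2)) by (rewrite Hp; ring).
  field. split; assumption.
Qed.

Lemma is_lim_seq_inv_odd : is_lim_seq (fun m => / INR (S (m + m)))%R 0.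
Proof.
  apply (is_lim_seq_le_le (fun _ => 0%R) _ (fun m => / INR (S m))%R).
  - intros m. split.
    + left. apply Rinv_0_lt_compat, lt_0_INR. lia.
    + apply Rinv_le_contravar; [apply lt_0_INR; lia|apply le_INR; lia].
  - apply is_lim_seq_const.
  - apply (is_lim_seq_incr_1 (fun m => / INR m)%R).
    replace (Finite 0) with (Rbar_inv p_infty) by reflexivity.
    apply is_lim_seq_inv; [apply is_lim_seq_INR|discriminate].
Qed.

Lemma is_lim_seq_scal0 c (u : nat -> R) : is_lim_seq u 0 -> is_lim_seq (fun n => c * u n)%R 0.
Proof.
  intros H. replace (Finite 0) with (Rbar_mult c 0) by (simpl; f_equal; ring).
  now apply is_lim_seq_scal_l.
Qed.

Lemma Cinv_zero : / RtoC 0 = RtoC 0.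
Proof. apply C_ext; simpl; unfold Rdiv; ring. Qed.

(** The finite expansion with n = 2m + 1 and q = e^(-w/n), divided by n: as m grows, n (1 - q) tends
    to w, n sin(pi k / n) tends to pi k and m / n tends to 1/2. Tannery's theorem passes to the
    limit in the sum. *)
Lemma mittag_leffler_coth (w : C) : 0 < Re w ->
  Csums (fun k => RtoC 2 * w / (w * w + RtoC (2 * PI * INR (S k)) * RtoC (2 * PI * INR (S k))))
    (/ (RtoC 1 - Cexp (- w)) - / w - / RtoC 2).
Proof.
  intros Hw. assert (Hpi := PI_RGT_0).
  assert (Hw0 : w <> RtoC 0) by (intros E; rewrite E in Hw; simpl in Hw; lra).
  set (n := fun m => INR (S (m + m))).
  assert (Hn : forall m, 1 <= n m) by (intros; apply INR_S_ge_1).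
  assert (Hn2 : forall m, n m = (2 * INR m + 1)%R).
  { intros m. unfold n. rewrite S_INR, plus_INR. ring. }
  assert (Hh := is_lim_seq_inv_odd : is_lim_seq (fun m => / n m)%R 0).
  set (q := fun m => Cexp (- (w / RtoC (n m)))).
  set (u := fun m => RtoC (n m) * (RtoC 1 - q m)).
  assert (Hnz : forall m, RtoC (n m) <> RtoC 0) by (intros m; apply RtoC_neq_0; specialize (Hn m); lra).
  assert (Hinv : forall m, 0 < / n m <= 1).
  { intros m. specialize (Hn m). split; [apply Rinv_0_lt_compat; lra|].
    rewrite <- Rinv_1. apply Rinv_le_contravar; lra. }
  assert (Hz : forall m, Cmod (- (w / RtoC (n m))) = (Cmod w * / n m)%R).
  { intros m. rewrite Cmod_opp, Cmod_div, Cmod_R, Rabs_pos_eq by (auto; specialize (Hn m); lra).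
    reflexivity. }
  assert (Hz1 : forall m, exp (Cmod (- (w / RtoC (n m)))) <= exp (Cmod w)).
  { intros m. apply exp_le_exp. rewrite Hz. assert (H := Cmod_ge_0 w). specialize (Hinv m). nra. }
  assert (Lq : Clim q (RtoC 1)).
  { apply (Clim_le _ _ (fun m => exp (Cmod w) * Cmod w * / n m)%R).
    - intros m. eapply Rle_trans; [apply Cexp_bound1|].
      rewrite Rmult_assoc, <- Hz. apply Rmult_le_compat_r; [apply Cmod_ge_0|apply Hz1].
    - now apply is_lim_seq_scal0. }
  assert (Lu : Clim u w).
  { apply (Clim_le _ _ (fun m => exp (Cmod w) * Cmod w ^ 2 * / n m)%R).
    - intros m. set (z := - (w / RtoC (n m))).
      replace (u m - w) with (- (RtoC (n m) * (Cexp z - RtoC 1 - z))).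
      + rewrite Cmod_opp, Cmod_mult, Cmod_R, Rabs_pos_eq by (specialize (Hn m); lra).
        eapply Rle_trans; [apply Rmult_le_compat_l; [specialize (Hn m); lra|apply Cexp_bound2]|].
        replace (exp (Cmod w) * Cmod w ^ 2 * / n m)%R with
          (n m * (exp (Cmod w) * Cmod z ^ 2))%R.
        * apply Rmult_le_compat_l; [specialize (Hn m); lra|].
          apply Rmult_le_compat_r; [apply pow_le, Cmod_ge_0|apply Hz1].
        * unfold z. rewrite Hz. specialize (Hn m). field. lra.
      + unfold u, q, z. field. apply Hnz.
    - now apply is_lim_seq_scal0. }
  set (s := fun m k => (n m * sin (PI * INR (S k) / n m))%R).
  assert (Ls : forall k, is_lim_seq (fun m => s m k) (PI * INR (S k))%R).
  { intros k. set (x := (PI * INR (S k))%R).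
    assert (Hx : 0 < x) by (apply Rmult_lt_0_compat; [lra|apply lt_0_INR; lia]).
    apply (is_lim_seq_le_le (fun m => x - x ^ 3 / 6 * / n m)%R _ (fun _ => x)).
    - intros m. assert (H0 : 0 <= x / n m) by (apply Rdiv_le_0_compat; [lra|specialize (Hn m); lra]).
      assert (H1 := sin_le_x _ H0). assert (H2 := sin_ge _ H0).
      specialize (Hn m). unfold s. fold x. split.
      + apply (Rmult_le_compat_l (n m)) in H2; [|lra]. eapply Rle_trans; [|exact H2].
        replace (n m * (x / n m - (x / n m) ^ 3 / 6))%R with (x - x ^ 3 / 6 * / n m * / n m)%R
          by (field; lra).
        assert (H3 : 0 <= x ^ 3 / 6 * / n m).
        { apply Rmult_le_pos; [|specialize (Hinv m); lra].
          apply Rdiv_le_0_compat; [apply pow_le; lra|lra]. }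
        specialize (Hinv m). nra.
      + apply (Rmult_le_compat_l (n m)) in H1; [|lra].
        replace (n m * (x / n m))%R with x in H1 by (field; lra). exact H1.
    - replace (Finite x) with (Finite (x - 0)) by (f_equal; ring).
      apply is_lim_seq_minus'; [apply is_lim_seq_const|now apply is_lim_seq_scal0].
    - apply is_lim_seq_const. }
  (* The summand divided by n, with numerator and denominator multiplied by n^2 so that both
     converge, and zero beyond the m summands that are present. *)
  set (t := fun m k => if Nat.ltb k m then
    u m * (RtoC 1 + q m) / (u m * u m + RtoC 4 * q m * RtoC (s m k ^ 2)) else RtoC 0).
  destruct (Clim_bounded _ _ Lu) as [U [HU0 HU]].
  assert (Hq1 : forall m, Cmod (q m) < 1).
  { intros m. unfold q. rewrite Cmod_Cexp, <- exp_0. apply exp_increasing.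
    replace (- (w / RtoC (n m))) with (RtoC (- / n m) * w).
    - simpl. specialize (Hinv m). destruct w; simpl in *. nra.
    - rewrite RtoC_opp, RtoC_inv by (specialize (Hn m); lra). field. apply Hnz. }
  destruct (proj1 (Clim_eps _ _) Lq (/ 2)%R ltac:(lra)) as [n0 Hn0].
  (* From [k0] on, k + 1 is at least the bound [U] of |u m|, so u^2 cannot cancel 4 q s^2, whose
     modulus is at least 2 (k + 1)^2 once |q| >= 1/2. *)
  set (k0 := Z.to_nat (up U)).
  assert (Hk0 : forall k, (k0 <= k)%nat -> U <= INR (S k)).
  { intros k Hk. apply Rle_trans with (IZR (up U)).
    - left. apply archimed.
    - rewrite <- (Z2Nat.id (up U)).
      + rewrite <- INR_IZR_INZ. apply le_INR. fold k0. lia.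
      + apply le_IZR. assert (H := archimed U). lra. }
  destruct (tannery_eventually t
    (fun k => RtoC 2 * w / (w * w + RtoC (2 * PI * INR (S k)) * RtoC (2 * PI * INR (S k))))
    (fun m => csum (t m) m) (fun k => 2 * U * / INR (S k) ^ 2)%R n0 k0) as [B [HB1 HB2]].
  - intros m k Hm Hk. unfold t. destruct (Nat.ltb_spec k m) as [Hkm|Hkm].
    2:{ rewrite Cmod_0. apply Rmult_le_pos; [lra|]. left. apply Rinv_0_lt_compat, pow_lt, lt_0_INR. lia. }
    specialize (Hn m). specialize (Hn0 m Hm). specialize (Hq1 m). specialize (HU m).
    specialize (Hk0 k Hk).
    assert (Hqh : / 2 <= Cmod (q m)).
    { assert (H := Cmod_rev_triangle (RtoC 1) (q m - RtoC 1)).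
      replace (RtoC 1 + (q m - RtoC 1)) with (q m) in H by ring. rewrite Cmod_1 in H. lra. }
    assert (HS : INR (S k) <= s m k).
    { unfold s. assert (Hx : 0 <= PI * INR (S k) / n m <= PI / 2).
      { split; [apply Rdiv_le_0_compat; [apply Rmult_le_pos; [lra|apply pos_INR]|lra]|].
        apply Rle_div_l; [lra|]. rewrite Hn2.
        assert (INR (S k) <= INR m) by (apply le_INR; lia). nra. }
      assert (H := sin_ge_third _ Hx).
      apply (Rmult_le_compat_l (n m)) in H; [|lra].
      replace (n m * (PI * INR (S k) / n m / 3))%R with (INR (S k) * (PI / 3))%R in H by (field; lra).
      assert (H3 := PI2_3_2). assert (H4 := pos_INR (S k)). nra. }
    assert (Hp := INR_S_ge_1 k). set (x := INR (S k)) in *.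
    assert (Hden : x ^ 2 <= Cmod (u m * u m + RtoC 4 * q m * RtoC (s m k ^ 2))).
    { assert (H := Cmod_rev_triangle (RtoC 4 * q m * RtoC (s m k ^ 2)) (u m * u m)).
      rewrite Cplus_comm, !Cmod_mult, !Cmod_R, (Rabs_pos_eq 4), Rabs_pos_eq in H;
        [|apply pow2_ge_0|lra].
      rewrite Cplus_comm.
      assert (H1 : x ^ 2 <= s m k ^ 2) by (apply pow_incr; lra).
      assert (H2 : Cmod (u m) * Cmod (u m) <= x ^ 2).
      { assert (H3 := Cmod_ge_0 (u m)). simpl. nra. }
      assert (H4 : 0 <= x ^ 2) by apply pow2_ge_0.
      replace (u m * u m + RtoC 4 * q m * RtoC (s m k ^ 2)) with
        (RtoC 4 * q m * RtoC (s m k ^ 2) + u m * u m) in H by ring. 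
      rewrite (Cplus_comm (RtoC 4 * q m * RtoC (s m k ^ 2))) in *. nra. }
    assert (Hx2 : 0 < x ^ 2) by (apply pow_lt; lra).
    assert (Hd0 : u m * u m + RtoC 4 * q m * RtoC (s m k ^ 2) <> RtoC 0) by (apply Cmod_gt_0; lra).
    rewrite Cmod_div, Cmod_mult by exact Hd0. unfold Rdiv.
    apply Rmult_le_compat.
    + apply Rmult_le_pos; apply Cmod_ge_0.
    + left. apply Rinv_0_lt_compat. lra.
    + rewrite (Rmult_comm 2). apply Rmult_le_compat; try apply Cmod_ge_0; [exact HU|].
      eapply Rle_trans; [apply Cmod_triangle|]. rewrite Cmod_1. lra.
    + now apply Rinv_le_contravar.
  - apply ex_series_mult_l, ex_series_inv_sq.
  - intros k.
    apply (Clim_ext_loc (fun m => u m * (RtoC 1 + q m) / (u m * u m + RtoC 4 * q m * RtoC (s m k ^ 2)))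
      _ _ (S k)).
    { intros m Hm. unfold t. destruct (Nat.ltb_spec k m); [reflexivity|lia]. }
    set (y := (PI * INR (S k))%R).
    replace (RtoC 2 * w / (w * w + RtoC (2 * PI * INR (S k)) * RtoC (2 * PI * INR (S k)))) with
      (w * (RtoC 1 + RtoC 1) * / (w * w + RtoC 4 * RtoC 1 * RtoC (y ^ 2))).
    + apply Clim_mult.
      * apply Clim_mult; [exact Lu|]. apply Clim_plus; [apply Clim_const|exact Lq].
      * apply Clim_inv.
        -- replace (RtoC 4 * RtoC 1 * RtoC (y ^ 2)) with (RtoC (2 * y) * RtoC (2 * y)).
           ++ now apply sq_plus_sq_neq_0.
           ++ rewrite <- !RtoC_mult. f_equal. ring.
        -- apply Clim_plus; [now apply Clim_mult|]. apply Clim_mult.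
           ++ now apply Clim_scal.
           ++ apply Clim_RtoC. simpl. apply is_lim_seq_mult'; [apply Ls|].
              apply is_lim_seq_mult'; [apply Ls|apply is_lim_seq_const].
    + unfold Cdiv. f_equal; [rewrite <- RtoC_plus; replace (1 + 1)%R with 2%R by ring; ring|].
      do 2 f_equal. rewrite <- !RtoC_mult. f_equal. unfold y. ring.
  - intros m. apply Csums_finite. intros k Hk. unfold t. destruct (Nat.ltb_spec k m); [lia|reflexivity].
  - replace (/ (RtoC 1 - Cexp (- w)) - / w - / RtoC 2) with B; [exact HB1|].
    apply (Clim_unique _ _ _ HB2).
    apply (Clim_ext (fun m => / (RtoC 1 - Cexp (- w)) - / u m - RtoC (INR m * / n m))).
    + intros m. assert (E := coth_finite_expansion m (q m) (Hq1 m)). cbv zeta in E.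
      fold (n m) in E.
      assert (Eq : q m ^ S (m + m) = Cexp (- w)).
      { unfold q. rewrite <- Cexp_nat. f_equal. fold (n m). field. apply Hnz. }
      rewrite Eq in E.
      assert (H1 : RtoC 1 - q m <> RtoC 0) by now apply one_minus_neq_0.
      assert (H2 : RtoC 1 - Cexp (- w) <> RtoC 0).
      { apply one_minus_neq_0. rewrite Cmod_Cexp, <- exp_0. apply exp_increasing. change (Re (- w)) with (- Re w)%R. lra. }
      rewrite (csum_ext (t m) (fun k => / RtoC (n m) * ((RtoC 1 - q m * q m) /
        ((RtoC 1 - q m) * (RtoC 1 - q m) + RtoC 4 * q m * RtoC (sin (PI * INR (S k) / n m) ^ 2))))).
      * rewrite csum_scal.
        set (sum := csum _ m) in *.
        replace sum with (RtoC (n m) / (RtoC 1 - Cexp (- w)) - / (RtoC 1 - q m) - RtoC (INR m))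
          by (rewrite E; ring).
        unfold u. rewrite RtoC_mult, RtoC_inv by (specialize (Hn m); lra). field. auto.
      * intros k Hk. unfold t. destruct (Nat.ltb_spec k m); [|lia]. unfold s, u.
        replace ((n m * sin (PI * INR (S k) / n m)) ^ 2)%R with
          (n m * n m * sin (PI * INR (S k) / n m) ^ 2)%R by ring.
        rewrite !RtoC_mult. set (sn := RtoC (sin (PI * INR (S k) / n m) ^ 2)).
        replace (RtoC (n m) * (RtoC 1 - q m) * (RtoC (n m) * (RtoC 1 - q m)) +
          RtoC 4 * q m * (RtoC (n m) * RtoC (n m) * sn)) with
          (RtoC (n m) * RtoC (n m) * ((RtoC 1 - q m) * (RtoC 1 - q m) + RtoC 4 * q m * sn)) by ring.
        set (d := (RtoC 1 - q m) * (RtoC 1 - q m) + RtoC 4 * q m * sn).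
        (* If the denominator vanishes, both sides are still equal, since the inverse of 0 is 0. *)
        destruct (Ceq_dec d (RtoC 0)) as [Ed|Ed].
        -- rewrite Ed. replace (RtoC (n m) * RtoC (n m) * RtoC 0) with (RtoC 0) by ring.
           unfold Cdiv. rewrite Cinv_zero. ring.
        -- field. split; [exact Ed|apply Hnz].
    + apply Clim_minus; [apply Clim_minus; [apply Clim_const|now apply Clim_inv]|].
      rewrite <- RtoC_inv by lra. apply Clim_RtoC.
      apply (is_lim_seq_ext (fun m => / 2 - / 2 * / n m)%R).
      * intros m. specialize (Hn m). rewrite Hn2 in *. field. lra.
      * replace (Finite (/ 2)) with (Finite (/ 2 - 0)) by (f_equal; ring).
        apply is_lim_seq_minus'; [apply is_lim_seq_const|now apply is_lim_seq_scal0].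
Qed.

Lemma Cexp_neq_1 w : 0 < Re w -> Cexp w - RtoC 1 <> RtoC 0.
Proof.
  intros Hw E. assert (Cmod (Cexp w) = 1%R).
  { replace (Cexp w) with (Cexp w - RtoC 1 + RtoC 1) by ring. rewrite E, Cplus_0_l. apply Cmod_1. }
  rewrite Cmod_Cexp in H. assert (H1 := exp_ineq1 (Re w)). lra.
Qed.

Lemma RtoC_PI_neq_0 : RtoC PI <> RtoC 0.
Proof. apply RtoC_neq_0. assert (H := PI_RGT_0). lra. Qed.

(** Rescaling by w = 2 pi a. In this form it serves both directions of the double sum: with [a] the
    pole parameter of d when summing over x, and with [a] a multiple of x^(1/N) when summing over
    d. *)
Lemma mittag_leffler (a : C) : 0 < Re a ->
  Csums (fun k => a * a / (a * a + RtoC (INR (S k)) * RtoC (INR (S k))))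
    (RtoC PI * a * (/ (Cexp (RtoC (2 * PI) * a) - RtoC 1) + / RtoC 2) - / RtoC 2).
Proof.
  intros Ha. assert (Hpi := PI_RGT_0). set (w := RtoC (2 * PI) * a).
  assert (Ew : w = RtoC 2 * RtoC PI * a) by (unfold w; rewrite RtoC_mult; ring).
  assert (Hw : 0 < Re w) by (unfold w; destruct a; simpl in *; nra).
  assert (Hp := RtoC_PI_neq_0).
  assert (Ha0 : a <> RtoC 0) by (intros E; rewrite E in Ha; simpl in Ha; lra).
  assert (He := Cexp_neq_1 w Hw). assert (Hz := Cexp_neq_0 w).
  assert (H := Csums_scal (w / RtoC 2) _ _ (mittag_leffler_coth w Hw)).
  eapply Csums_ext; [|replace (RtoC PI * a * (/ (Cexp w - RtoC 1) + / RtoC 2) - / RtoC 2) with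
    (w / RtoC 2 * (/ (RtoC 1 - Cexp (- w)) - / w - / RtoC 2)); [exact H|]].
  - intros k. cbv beta. assert (Hd := sq_plus_sq_neq_0 a (INR (S k)) Ha).
    rewrite !RtoC_mult, Ew. set (x := RtoC (INR (S k))) in *.
    replace (RtoC 2 * RtoC PI * a * (RtoC 2 * RtoC PI * a) +
      RtoC 2 * RtoC PI * x * (RtoC 2 * RtoC PI * x)) with
      (RtoC 4 * (RtoC PI * RtoC PI) * (a * a + x * x)) by ring.
    field. auto.
  - rewrite Cexp_opp. rewrite Ew at 1 3.
    assert (He' : RtoC 1 - / Cexp w <> RtoC 0).
    { intros E. apply He. replace (Cexp w - RtoC 1) with (Cexp w * (RtoC 1 - / Cexp w)) by (field; exact Hz).
      rewrite E. ring. }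
    replace (/ (RtoC 1 - / Cexp w)) with (RtoC 1 + / (Cexp w - RtoC 1)) by (field; auto).
    field. auto.
Qed.

(** * Bernoulli numbers and their recursion *)

Definition zeta_nat (k : nat) : R := Series (fun d => / INR (S d) ^ k)%R.

Lemma ex_series_zeta_nat k : (2 <= k)%nat -> ex_series (fun d => / INR (S d) ^ k)%R.
Proof.
  intros Hk. apply (ex_series_le (K := R_AbsRing) (V := R_CompleteNormedModule) _
    (fun d => / INR (S d) ^ 2)%R); [|apply ex_series_inv_sq].
  intros d. change (Rabs (/ INR (S d) ^ k) <= / INR (S d) ^ 2).
  assert (Hx := INR_S_ge_1 d). assert (0 < INR (S d) ^ 2) by (apply pow_lt; lra).
  rewrite Rabs_pos_eq by (left; apply Rinv_0_lt_compat, pow_lt; lra).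
  apply Rinv_le_contravar; [assumption|]. now apply Rle_pow.
Qed.

Lemma Csums_zeta_nat k : (2 <= k)%nat ->
  Csums (fun d => RtoC (/ INR (S d) ^ k)) (RtoC (zeta_nat k)).
Proof.
  intros Hk. apply (Clim_ext (fun n => RtoC (rsum (fun d => / INR (S d) ^ k)%R n))).
  - intros n. symmetry. apply csum_RtoC.
  - apply Clim_RtoC, is_series_rsum, Series_correct. now apply ex_series_zeta_nat.
Qed.

(* B_k / k!, where for k >= 2 Euler's formula for zeta(k) is taken as the definition. *)
Definition beta (k : nat) : C :=
  match k with
  | 0 => RtoC 1
  | 1 => - / RtoC 2
  | _ => - (Ci ^ k + (- Ci) ^ k) / RtoC (2 * PI) ^ k * RtoC (zeta_nat k)
  end.

Lemma zeta_nat_le k : (2 <= k)%nat -> Rabs (zeta_nat k) <= zeta_nat 2.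
Proof.
  intros Hk. assert (Hpos : forall d j, 0 <= / INR (S d) ^ j).
  { intros d j. left. apply Rinv_0_lt_compat, pow_lt, lt_0_INR. lia. }
  rewrite Rabs_pos_eq.
  - apply Series_le; [|apply ex_series_inv_sq]. intros d. split; [apply Hpos|].
    assert (Hx := INR_S_ge_1 d). apply Rinv_le_contravar; [apply pow_lt; lra|]. now apply Rle_pow.
  - apply (rsum_le_Series _ 0); [intros; apply Hpos|now apply ex_series_zeta_nat].
Qed.

Lemma Cmod_2PI_pow k : Cmod (RtoC (2 * PI) ^ k) = ((2 * PI) ^ k)%R.
Proof. assert (Hpi := PI_RGT_0). rewrite Cmod_pow, Cmod_R, Rabs_pos_eq; lra. Qed.

Lemma two_PI_pow_ge_1 k : 1 <= (2 * PI) ^ k.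
Proof. apply pow_R1_Rle. assert (H := PI2_3_2). lra. Qed.

Lemma RtoC_2PI_pow_neq_0 k : RtoC (2 * PI) ^ k <> RtoC 0.
Proof. apply Cpow_nz, RtoC_neq_0. assert (H := PI_RGT_0). lra. Qed.

Lemma Cmod_Ci_pow_sum k : Cmod (Ci ^ k + (- Ci) ^ k) <= 2.
Proof.
  eapply Rle_trans; [apply Cmod_triangle|]. rewrite !Cmod_pow, Cmod_opp, Cmod_Ci, pow1. lra.
Qed.

(** Boundedness makes the generating series converge in the unit disc, where the recursion is
    derived. *)
Lemma Cmod_beta_le k : Cmod (beta k) <= 1 + 2 * zeta_nat 2.
Proof.
  assert (H0 : 0 <= zeta_nat 2).
  { eapply Rle_trans; [apply Rabs_pos|apply (zeta_nat_le 2); lia]. }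
  destruct k as [|[|k]].
  - simpl. rewrite Cmod_1. lra.
  - simpl. rewrite Cmod_opp, <- RtoC_inv, Cmod_R, Rabs_pos_eq by lra. lra.
  - unfold beta. rewrite Cmod_mult, Cmod_div, Cmod_opp, Cmod_R, Cmod_2PI_pow
      by apply RtoC_2PI_pow_neq_0.
    assert (H1 := Cmod_Ci_pow_sum (S (S k))). assert (H2 := two_PI_pow_ge_1 (S (S k))).
    assert (H3 := zeta_nat_le (S (S k)) ltac:(lia)).
    assert (H4 : Cmod (Ci ^ S (S k) + (- Ci) ^ S (S k)) / (2 * PI) ^ S (S k) <= 2).
    { apply Rle_div_l; lra. }
    assert (0 <= Cmod (Ci ^ S (S k) + (- Ci) ^ S (S k)) / (2 * PI) ^ S (S k)).
    { apply Rdiv_le_0_compat; [apply Cmod_ge_0|lra]. }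
    assert (H5 := Rabs_pos (zeta_nat (S (S k)))). nra.
Qed.

(** In the Mittag-Leffler series for a = x/(2 pi), a^2/(a^2 + d^2) is expanded in powers of a/d;
    summing over d first produces zeta(k), hence the coefficients [beta k]. Degrees 0 and 1 are the
    terms outside that series. *)
Lemma Csums_beta (x : R) : 0 < x < 1 ->
  Csums (fun k => beta k * RtoC x ^ k) (RtoC x / (Cexp (RtoC x) - RtoC 1)).
Proof.
  intros Hx. assert (Hpi := PI2_3_2). set (a := (x / (2 * PI))%R).
  assert (Ha : 0 < a < / 2).
  { unfold a. split; [apply Rdiv_lt_0_compat; lra|]. apply Rlt_div_l; lra. }
  assert (Hml := mittag_leffler (RtoC a) ltac:(simpl; lra)).
  assert (Hxa : RtoC (2 * PI) * RtoC a = RtoC x).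
  { rewrite <- RtoC_mult. f_equal. unfold a. field. lra. }
  rewrite Hxa in Hml.
  assert (He := Cexp_neq_1 (RtoC x) ltac:(simpl; lra)).
  set (S0 := RtoC 2 * (RtoC PI * RtoC a * (/ (Cexp (RtoC x) - RtoC 1) + / RtoC 2) - / RtoC 2)).
  assert (E : RtoC x / (Cexp (RtoC x) - RtoC 1) =
    beta 0 * RtoC x ^ 0 + (beta 1 * RtoC x ^ 1 + S0)).
  { unfold S0. simpl. replace (RtoC PI * RtoC a) with (RtoC x / RtoC 2).
    - field. exact He.
    - rewrite <- Hxa, RtoC_mult. field. }
  rewrite E. apply Csums_S, (Csums_S (fun n => beta (S n) * RtoC x ^ S n)).
  (* The term of degree k + 2 in a/d of 2 a^2/(a^2 + d^2), as a sum of two geometric series in i a/d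
     and -i a/d whose odd degrees cancel. The total over d and k is [S0]. *)
  set (b := fun d k => - ((Ci * RtoC (a / INR (S d))) ^ S (S k)
                          + (- Ci * RtoC (a / INR (S d))) ^ S (S k))).
  assert (Had : forall d, 0 < a / INR (S d) < / 2).
  { intros d. assert (H := INR_S_ge_1 d). split; [apply Rdiv_lt_0_compat; lra|].
    apply Rlt_div_l; nra. }
  assert (Hcm : forall d c, Cmod c = 1%R -> Cmod (c * RtoC (a / INR (S d))) = (a / INR (S d))%R).
  { intros d c Hc. specialize (Had d). rewrite Cmod_mult, Hc, Cmod_R, Rabs_pos_eq; lra. }
  assert (Hmi : Cmod (- Ci) = 1%R) by (rewrite Cmod_opp; apply Cmod_Ci).
  apply (Csums_swap b (fun d => RtoC 2 * (RtoC a * RtoC a /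
     (RtoC a * RtoC a + RtoC (INR (S d)) * RtoC (INR (S d))))) _ (fun d => 4 * / INR (S d) ^ 2)%R).
  - intros d k.
    eapply Rle_trans; [apply (Cmod_csum_le _ (fun k => 2 * / INR (S d) ^ 2 * (/ 2) ^ k)%R)|].
    + intros j _. unfold b. rewrite Cmod_opp. eapply Rle_trans; [apply Cmod_triangle|].
      rewrite !Cmod_pow, !Hcm by (assumption || apply Cmod_Ci).
      assert (H := INR_S_ge_1 d). specialize (Had d). set (y := (a / INR (S d))%R) in *.
      assert (H2 : y ^ j <= (/ 2) ^ j) by (apply pow_incr; lra).
      assert (H3 : y * y <= / INR (S d) ^ 2).
      { unfold y. replace (/ INR (S d) ^ 2)%R with (/ INR (S d) * / INR (S d))%R by (field; lra).
        unfold Rdiv. assert (0 < / INR (S d)) by (apply Rinv_0_lt_compat; lra).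
        apply Rmult_le_compat; nra. }
      assert (0 <= y ^ j) by (apply pow_le; lra). assert (0 <= y * y) by nra.
      simpl pow at 1 2. assert (y * y * y ^ j <= / INR (S d) ^ 2 * (/ 2) ^ j)
        by (apply Rmult_le_compat; assumption). lra.
    + rewrite rsum_scal. assert (H : 0 < / INR (S d) ^ 2).
      { apply Rinv_0_lt_compat, pow_lt, lt_0_INR. lia. }
      assert (rsum (fun k => (/ 2) ^ k)%R k <= 2).
      { eapply Rle_trans; [apply rsum_le_Series|].
        - intros j. apply pow_le. lra.
        - apply ex_series_geom. rewrite Rabs_pos_eq; lra.
        - rewrite Series_geom by (rewrite Rabs_pos_eq; lra). lra. }
      set (v := (/ INR (S d) ^ 2)%R) in *. set (rs := rsum _ _) in *. nra.
  - apply ex_series_mult_l, ex_series_inv_sq.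
  - intros d. unfold b. set (y := RtoC (a / INR (S d))).
    assert (Hd := sq_plus_sq_neq_0 (RtoC a) (INR (S d)) ltac:(simpl; lra)).
    assert (Hd0 : RtoC (INR (S d)) <> RtoC 0) by (apply RtoC_neq_0, not_0_INR; lia).
    assert (Hg : forall c, Cmod c = 1%R -> Csums (fun k => (c * y) ^ S (S k))
      ((c * y) * (c * y) * / (RtoC 1 - c * y))).
    { intros c Hc. apply (Csums_ext (fun k => (c * y) * (c * y) * (c * y) ^ k)).
      - intros k. simpl. ring.
      - apply Csums_scal, Csums_geom. unfold y. rewrite Hcm by exact Hc.
        specialize (Had d). lra. }
    assert (H := Csums_scal (- RtoC 1) _ _ (Csums_plus _ _ _ _ (Hg _ Cmod_Ci) (Hg _ Hmi))).
    eapply Csums_ext; [|replace (RtoC 2 * (RtoC a * RtoC a / (RtoC a * RtoC a + RtoC (INR (S d)) *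
      RtoC (INR (S d))))) with (- RtoC 1 * (Ci * y * (Ci * y) * / (RtoC 1 - Ci * y) +
         - Ci * y * (- Ci * y) * / (RtoC 1 - - Ci * y))); [exact H|]].
    + intros k. cbv beta. ring.
    + assert (Hci : Ci * Ci = - RtoC 1) by (apply C_ext; simpl; ring).
      assert (H1 : RtoC 1 - Ci * y <> RtoC 0).
      { apply one_minus_neq_0. unfold y. rewrite Hcm by apply Cmod_Ci. specialize (Had d). lra. }
      assert (H2 : RtoC 1 - - Ci * y <> RtoC 0).
      { apply one_minus_neq_0. unfold y. rewrite Hcm by exact Hmi. specialize (Had d). lra. }
      assert (Hy : y = RtoC a / RtoC (INR (S d))).
      { unfold y, Rdiv. rewrite RtoC_mult, RtoC_inv; [reflexivity|apply not_0_INR; lia]. }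
      replace (Ci * y * (Ci * y)) with (Ci * Ci * (y * y)) by ring.
      replace (- Ci * y * (- Ci * y)) with (Ci * Ci * (y * y)) by ring. rewrite Hci.
      replace (- RtoC 1 * (- RtoC 1 * (y * y) * / (RtoC 1 - Ci * y) +
        - RtoC 1 * (y * y) * / (RtoC 1 - - Ci * y))) with
        (y * y * RtoC 2 / ((RtoC 1 - Ci * y) * (RtoC 1 - - Ci * y))) by (field; auto).
      replace ((RtoC 1 - Ci * y) * (RtoC 1 - - Ci * y)) with (RtoC 1 - Ci * Ci * (y * y)) by ring.
      rewrite Hci, Hy. field. repeat split; auto.
  - intros k. assert (H := Csums_scal (- (Ci ^ S (S k) + (- Ci) ^ S (S k)) * RtoC a ^ S (S k)) _ _
      (Csums_zeta_nat (S (S k)) ltac:(lia))).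
    eapply Csums_ext; [|replace (beta (S (S k)) * RtoC x ^ S (S k)) with
      (- (Ci ^ S (S k) + (- Ci) ^ S (S k)) * RtoC a ^ S (S k) * RtoC (zeta_nat (S (S k)))); [exact H|]].
    + intros d. cbv beta. unfold b, Rdiv. rewrite !Cpow_mult_l, <- !RtoC_pow, <- pow_inv.
      rewrite Rpow_mult_distr, RtoC_mult. ring.
    + unfold beta. rewrite <- Hxa, Cpow_mult_l. field. apply RtoC_2PI_pow_neq_0.
  - unfold S0. now apply Csums_scal.
Qed.

Lemma Csums_expm1_over (x : R) : 0 < x -> Csums (fun k => RtoC x ^ k / RtoC (INR (fact (S k))))
  ((Cexp (RtoC x) - RtoC 1) / RtoC x).
Proof.
  intros Hx. assert (Hx0 : RtoC x <> RtoC 0) by (apply RtoC_neq_0; lra).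
  assert (H := Csums_scal (/ RtoC x) _ _ (Csums_shift _ _ 1 (Csums_Cexp (RtoC x)))).
  assert (E : csum (fun k => RtoC x ^ k / RtoC (INR (fact k))) 1 = RtoC 1) by (simpl; field).
  rewrite E in H.
  replace ((Cexp (RtoC x) - RtoC 1) / RtoC x) with (/ RtoC x * (Cexp (RtoC x) - RtoC 1)) by (field; exact Hx0).
  eapply Csums_ext; [|exact H]. intros k. cbv beta. change (1 + k)%nat with (S k). simpl Cpow.
  field. split; [apply RtoC_neq_0, INR_fact_neq_0|exact Hx0].
Qed.

(** x/(e^x - 1) times (e^x - 1)/x is 1: the Cauchy product of the two power series, minus 1,
    vanishes for 0 < x < 1, so its coefficients [c m] are all zero. *)
Lemma beta_recursion : bernoulli_like beta.
Proof.
  set (e := fun k => / RtoC (INR (fact (S k)))).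
  assert (He : forall k, Cmod (e k) <= 1).
  { intros k. unfold e. rewrite <- RtoC_inv by apply INR_fact_neq_0.
    assert (1 <= INR (fact (S k))).
    { apply (le_INR 1). assert (H := lt_O_fact (S k)). lia. }
    rewrite Cmod_R, Rabs_pos_eq by (left; apply Rinv_0_lt_compat; lra).
    rewrite <- Rinv_1. apply Rinv_le_contravar; lra. }
  set (B := (1 + 2 * zeta_nat 2)%R).
  assert (HB0 : 0 <= B) by (eapply Rle_trans; [apply Cmod_ge_0|apply (Cmod_beta_le 0)]).
  set (c := fun m => csum (fun i => beta i * e (m - i)%nat) (S m)
     - if Nat.eqb m 0 then RtoC 1 else RtoC 0).
  enough (Hc : forall m, c m = RtoC 0).
  { intros m. specialize (Hc m). unfold c in Hc.
    transitivity (csum (fun i => beta i * e (m - i)%nat) (S m)).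
    - apply csum_ext. intros i Hi. replace (S m - i)%nat with (S (m - i)) by lia. reflexivity.
    - set (t := if Nat.eqb m 0 then RtoC 1 else RtoC 0) in *.
      replace (csum (fun i => beta i * e (m - i)%nat) (S m)) with
        (csum (fun i => beta i * e (m - i)%nat) (S m) - t + t) by ring. rewrite Hc. ring. }
  set (h1 := fun z => CSeries (fun k => beta k * z ^ k)).
  set (h2 := fun z => CSeries (fun k => e k * z ^ k)).
  assert (Hgeo : forall D (a : nat -> C) z, (forall k, Cmod (a k) <= D) -> 0 <= D -> Cmod z < 1 ->
    (forall k, Cmod (a k * z ^ k) <= D * Cmod z ^ k) /\ ex_series (fun k => D * Cmod z ^ k)%R).
  { intros D a z Ha HD Hz. assert (Hz0 := Cmod_ge_0 z). split.
    - intros k. rewrite Cmod_mult, Cmod_pow. apply Rmult_le_compat_r; [now apply pow_le|apply Ha].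
    - apply ex_series_geom_dominated. lra. }
  assert (Hsum : forall D (a : nat -> C) z, (forall k, Cmod (a k) <= D) -> 0 <= D -> Cmod z < 1 ->
    Csums (fun k => a k * z ^ k) (CSeries (fun k => a k * z ^ k))).
  { intros D a z Ha HD Hz. destruct (Hgeo D a z Ha HD Hz) as [H1 H2].
    destruct (Csums_dominated _ _ H1 H2) as [l Hl]. now rewrite (CSeries_unique _ _ Hl). }
  apply (power_series_zero c (fun z => h1 z * h2 z - RtoC 1) 1 (RtoC 1) 1); try lra.
  - apply RtoC_neq_0. lra.
  - intros z Hz.
    destruct (Hgeo B beta z Cmod_beta_le HB0 Hz) as [Hb1 Hb2].
    destruct (Hgeo 1%R e z He ltac:(lra) Hz) as [He1 He2].
    assert (Hprod := Csums_cauchy_product _ _ _ _ _ _ Hb1 Hb2 He1 He2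
      (Hsum B beta z Cmod_beta_le HB0 Hz) (Hsum 1%R e z He ltac:(lra) Hz)).
    assert (Hone := Csums_finite (fun k => (if Nat.eqb k 0 then RtoC 1 else RtoC 0) * z ^ k) 1).
    assert (E1 : csum (fun k => (if Nat.eqb k 0 then RtoC 1 else RtoC 0) * z ^ k) 1 = RtoC 1)
      by (simpl; ring).
    rewrite E1 in Hone.
    assert (Hone' : forall k, (1 <= k)%nat ->
      (if Nat.eqb k 0 then RtoC 1 else RtoC 0) * z ^ k = RtoC 0).
    { intros k Hk. destruct k; [lia|]. simpl. ring. }
    refine (Csums_ext _ _ _ _ (Csums_minus _ _ _ _ Hprod (Hone Hone'))).
    intros m. cbv beta. unfold c. set (t := if Nat.eqb m 0 then RtoC 1 else RtoC 0).
    transitivity (z ^ m * csum (fun i => beta i * e (m - i)%nat) (S m) - t * z ^ m); [|ring].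
    rewrite <- csum_scal. unfold Cminus. f_equal. apply csum_ext. intros i Hi.
    replace (z ^ m) with (z ^ i * z ^ (m - i)) by (rewrite <- Cpow_add_r; f_equal; lia). ring.
  - intros t Ht. replace (RtoC t * RtoC 1) with (RtoC t) by ring.
    unfold h1, h2. rewrite (CSeries_unique _ _ (Csums_beta t Ht)).
    assert (H2 := Csums_expm1_over t ltac:(lra)).
    rewrite (CSeries_unique (fun k => e k * RtoC t ^ k) ((Cexp (RtoC t) - RtoC 1) / RtoC t)).
    + assert (Hne := Cexp_neq_1 (RtoC t) ltac:(simpl; lra)). field.
      split; [apply RtoC_neq_0; lra|exact Hne].
    + eapply Csums_ext; [|exact H2]. intros k. unfold e, Cdiv. ring.
Qed.

(** Read off from the recursion rather than from the definition, where it would amount to the value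
    of zeta(2). *)
Lemma beta_2 : beta 2 = / RtoC 12.
Proof.
  assert (H := beta_recursion 2%nat). cbn [csum Nat.eqb] in H.
  change (fact (3 - 0)) with 6%nat in H. change (fact (3 - 1)) with 2%nat in H.
  change (fact (3 - 2)) with 1%nat in H.
  change (beta 0) with (RtoC 1) in H. change (beta 1) with (- / RtoC 2) in H.
  replace (INR 6) with 6%R in H by (simpl; ring). replace (INR 2) with 2%R in H by (simpl; ring).
  replace (INR 1) with 1%R in H by (simpl; ring). set (b2 := beta 2) in *.
  replace b2 with (RtoC 0 + RtoC 1 / RtoC 6 + - / RtoC 2 / RtoC 2 + b2 / RtoC 1 + / RtoC 12)
    by field.
  rewrite H. ring.
Qed.

(** * Analytic continuation of zeta by Euler-Maclaurin summation *)

(** The power of a positive real base without the case distinction in [Carg], ready to be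
    differentiated in [x] and expanded in [e]. *)
Definition rpow (x : R) (e : C) : C := Cexp (e * RtoC (ln x)).

Lemma Cpower_pos x e : 0 < x -> Cpower (RtoC x) e = rpow x e.
Proof.
  intros Hx. unfold Cpower, rpow. do 2 f_equal. unfold Clog, Carg.
  rewrite Cmod_R, Rabs_pos_eq by lra.
  assert (E : (Re (RtoC x) / x)%R = 1%R) by (simpl; field; lra).
  assert (E0 : Im (RtoC x) = 0%R) by reflexivity.
  rewrite E, E0, acos_1. destruct (Rle_dec 0 0); [reflexivity|lra].
Qed.

Lemma rpow_plus x a b : rpow x (a + b) = rpow x a * rpow x b.
Proof. unfold rpow. rewrite <- Cexp_plus. f_equal. ring. Qed.

Lemma rpow_1_l e : rpow 1 e = RtoC 1.
Proof. unfold rpow. rewrite ln_1, Cmult_0_r. apply Cexp_0. Qed.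

Lemma rpow_1_r x : 0 < x -> rpow x (RtoC 1) = RtoC x.
Proof. intros Hx. unfold rpow. rewrite Cmult_1_l, Cexp_R, exp_ln; auto. Qed.

Lemma rpow_nat x n : 0 < x -> rpow x (RtoC (INR n)) = RtoC x ^ n.
Proof.
  intros Hx. unfold rpow. rewrite Cexp_nat, Cexp_R, exp_ln by exact Hx. reflexivity.
Qed.

Lemma Cmod_rpow x e : Cmod (rpow x e) = exp (Re e * ln x).
Proof. unfold rpow. rewrite Cmod_Cexp. f_equal. destruct e; simpl. ring. Qed.

Lemma cderiv_rpow e x : 0 < x -> cderiv (fun t => rpow t e) x (e * rpow x (e - RtoC 1)).
Proof.
  intros Hx. unfold rpow.
  replace (e * Cexp ((e - RtoC 1) * RtoC (ln x))) with (e * RtoC (/ x) * Cexp (e * RtoC (ln x))).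
  - apply (cderiv_Cexp (fun t => e * RtoC (ln t))). apply cderiv_scal, cderiv_RtoC.
    auto_derive; [exact Hx|]. field. lra.
  - replace ((e - RtoC 1) * RtoC (ln x)) with (e * RtoC (ln x) + - RtoC (ln x)) by ring.
    rewrite Cexp_plus, Cexp_opp, Cexp_R, exp_ln, RtoC_inv by lra. ring.
Qed.

Lemma ln_INR_S_lim : is_lim_seq (fun n => ln (INR (S n))) p_infty.
Proof.
  apply (is_lim_seq_incr_1 (fun n => ln (INR n))).
  apply (is_lim_comp_seq ln INR p_infty p_infty).
  - apply is_lim_ln_p.
  - now exists 0%nat.
  - apply is_lim_seq_INR.
Qed.

Lemma rpow_lim_0 e : Re e < 0 -> Clim (fun n => rpow (INR (S n)) e) (RtoC 0).
Proof.
  intros He. apply (Clim_le _ _ (fun n => exp (Re e * ln (INR (S n))))).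
  - intros n. replace (rpow (INR (S n)) e - RtoC 0) with (rpow (INR (S n)) e) by ring.
    rewrite Cmod_rpow. lra.
  - apply (is_lim_comp_seq exp (fun n => Re e * ln (INR (S n)))%R m_infty 0).
    + apply is_lim_exp_m.
    + now exists 0%nat.
    + assert (H := is_lim_seq_scal_l _ (Re e) _ ln_INR_S_lim).
      replace (Rbar_mult (Re e) p_infty) with m_infty in H; [exact H|].
      simpl. destruct (Rle_dec 0 (Re e)); [exfalso; clear -He r; lra|reflexivity].
Qed.

Fixpoint falling (a : C) (j : nat) : C :=
  match j with 0 => RtoC 1 | S j => falling a j * (a - RtoC (INR j)) end.

(* The (k-1)-st derivative of x^(-s), an antiderivative for k = 0. *)
Definition Dpow (s : C) (k : nat) (x : R) : C :=
  match k with
  | 0 => rpow x (RtoC 1 - s) / (RtoC 1 - s)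
  | S j => falling (- s) j * rpow x (- s - RtoC (INR j))
  end.

Lemma Dpow_1 s x : Dpow s 1 x = rpow x (- s).
Proof.
  change (RtoC 1 * rpow x (- s - RtoC 0) = rpow x (- s)).
  replace (- s - RtoC 0) with (- s) by ring. ring.
Qed.

Lemma one_minus_s_neq_0 s : s <> RtoC 1 -> RtoC 1 - s <> RtoC 0.
Proof. intros H E. apply H. replace s with (RtoC 1 - (RtoC 1 - s)) by ring. rewrite E. ring. Qed.

Lemma cderiv_Dpow s k x : s <> RtoC 1 -> 0 < x -> cderiv (Dpow s k) x (Dpow s (S k) x).
Proof.
  intros Hs Hx. assert (H1 := one_minus_s_neq_0 s Hs). destruct k; simpl.
  - replace (RtoC 1 * rpow x (- s - RtoC 0)) with
      (/ (RtoC 1 - s) * ((RtoC 1 - s) * rpow x (RtoC 1 - s - RtoC 1))).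
    + apply (cderiv_ext (fun t => / (RtoC 1 - s) * rpow t (RtoC 1 - s))); [intros; unfold Dpow, Cdiv; ring|].
      apply cderiv_scal, cderiv_rpow, Hx.
    + replace (RtoC 1 - s - RtoC 1) with (- s - RtoC 0) by ring. field. exact H1.
  - change (match k with 0%nat => 1%R | S _ => (INR k + 1)%R end) with (INR (S k)).
    replace (- s - RtoC (INR (S k))) with (- s - RtoC (INR k) - RtoC 1)
      by (rewrite S_INR, RtoC_plus; ring).
    replace (falling (- s) k * (- s - RtoC (INR k)) * rpow x (- s - RtoC (INR k) - RtoC 1)) with
      (falling (- s) k * ((- s - RtoC (INR k)) * rpow x (- s - RtoC (INR k) - RtoC 1))) by ring.
    apply cderiv_scal, cderiv_rpow, Hx.
Qed.

Definition zeta_corr (K : nat) (s : C) (x : R) : C := csum (fun i => beta i * Dpow s i x) (S K).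

(** The Euler-Maclaurin defect of x^(-s) on the interval from n + 1 to n + 2, with boundary terms up
    to index K. *)
Definition kappa (K : nat) (s : C) (n : nat) : C :=
  rpow (INR (S n)) (- s) - (zeta_corr K s (INR (S (S n))) - zeta_corr K s (INR (S n))).

(** The sum of n^(-s) with its boundary terms at infinity discarded. It is meaningful for Re s >= 1
    - K, where the defects are summable, so each further K moves the half-plane by one. *)
Definition zetaK (K : nat) (s : C) : C := CSeries (kappa K s) - zeta_corr K s 1.

(** The defect is governed by the (K+1)-st derivative of x^(-s), of size x^(-Re s - K - 1), and Re s
    >= 1 - K makes the exponent at most -2. *)
Lemma kappa_bound K s n : s <> RtoC 1 -> 1 - INR K <= Re s ->
  Cmod (kappa K s n) <=
    Cmod (falling (- s) (S K)) * / INR (S n) ^ 2 * rsum (fun i => Cmod (beta i)) (S K).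
Proof.
  intros Hs HK. assert (Hx := INR_S_ge_1 n).
  assert (E := euler_maclaurin_step beta beta_recursion (Dpow s)
    (Cmod (falling (- s) (S K)) * / INR (S n) ^ 2) (INR (S n)) K).
  replace (kappa K s n) with (Dpow s 1 (INR (S n)) -
    csum (fun i => beta i * (Dpow s i (INR (S n) + 1)%R - Dpow s i (INR (S n)))) (S K)).
  - apply E.
    + intros k t _ Ht. apply cderiv_Dpow; [exact Hs|lra].
    + intros t Ht. change (Dpow s (S (S K)) t) with
        (falling (- s) (S K) * rpow t (- s - RtoC (INR (S K)))).
      rewrite Cmod_mult. apply Rmult_le_compat_l; [apply Cmod_ge_0|].
      rewrite Cmod_rpow.
      assert (Hln : 0 <= ln (INR (S n))) by (rewrite <- ln_1; apply ln_le; lra).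
      assert (Hln2 : ln (INR (S n)) <= ln t) by (apply ln_le; lra).
      assert (He : Re (- s - RtoC (INR (S K))) <= -2).
      { change (- Re s + - INR (S K) <= -2). rewrite S_INR. lra. }
      replace (/ INR (S n) ^ 2)%R with (exp (-2 * ln (INR (S n)))).
      * apply exp_le_exp. nra.
      * replace (-2 * ln (INR (S n)))%R with (- (ln (INR (S n)) + ln (INR (S n))))%R by ring.
        rewrite exp_Ropp, exp_plus, exp_ln by lra. simpl. f_equal. ring.
  - unfold kappa, zeta_corr. rewrite (S_INR (S n)), <- csum_minus.
    rewrite Dpow_1. f_equal.
    apply csum_ext. intros i _. ring.
Qed.

Lemma Csums_kappa K s : s <> RtoC 1 -> 1 - INR K <= Re s ->
  Csums (kappa K s) (CSeries (kappa K s)).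
Proof.
  intros Hs HK. destruct (Csums_dominated (kappa K s) (fun n =>
    Cmod (falling (- s) (S K)) * / INR (S n) ^ 2 * rsum (fun i => Cmod (beta i)) (S K))%R) as [l Hl].
  - intros n. now apply kappa_bound.
  - apply ex_series_mult_r, ex_series_mult_l, ex_series_inv_sq.
  - now rewrite (CSeries_unique _ _ Hl).
Qed.

Lemma zetaK_lim K s : s <> RtoC 1 -> 1 - INR K <= Re s ->
  Clim (fun n => csum (fun k => rpow (INR (S k)) (- s)) n - zeta_corr K s (INR (S n))) (zetaK K s).
Proof.
  intros Hs HK. assert (H := Csums_kappa K s Hs HK).
  apply (Clim_ext (fun n => csum (kappa K s) n - zeta_corr K s 1)).
  - intros n. unfold kappa. rewrite csum_minus, (csum_telescope (fun n => zeta_corr K s (INR (S n)))).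
    replace (INR 1) with 1%R by reflexivity. ring.
  - apply Clim_minus; [exact H|apply Clim_const].
Qed.

Lemma Dpow_lim_0 s j : Re (- s - RtoC (INR j)) < 0 ->
  Clim (fun n => Dpow s (S j) (INR (S n))) (RtoC 0).
Proof.
  intros H. simpl. replace (RtoC 0) with (falling (- s) j * RtoC 0) by ring.
  apply Clim_scal. now apply (rpow_lim_0 (- s - RtoC (INR j))).
Qed.

(** The additional boundary term is a multiple of x^(-s-K), which tends to 0 in the half-plane
    belonging to K; hence the continuations for different K are compatible. *)
Lemma zetaK_S K s : s <> RtoC 1 -> 1 - INR K <= Re s -> zetaK (S K) s = zetaK K s.
Proof.
  intros Hs HK. assert (HK' : 1 - INR (S K) <= Re s) by (rewrite S_INR; lra).
  apply (Clim_unique _ _ _ (zetaK_lim (S K) s Hs HK')).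
  apply (Clim_ext (fun n => csum (fun k => rpow (INR (S k)) (- s)) n - zeta_corr K s (INR (S n))
     - beta (S K) * Dpow s (S K) (INR (S n)))).
  - intros n. unfold zeta_corr. cbn [csum]. ring.
  - replace (zetaK K s) with (zetaK K s - beta (S K) * RtoC 0) by ring.
    apply Clim_minus; [now apply zetaK_lim|]. apply Clim_scal, Dpow_lim_0.
    change (- Re s + - INR K < 0). lra.
Qed.

Lemma zetaK_add K j s : s <> RtoC 1 -> 1 - INR K <= Re s -> zetaK (j + K) s = zetaK K s.
Proof.
  intros Hs HK. induction j; [reflexivity|]. simpl. rewrite zetaK_S; auto.
  rewrite plus_INR. assert (H := pos_INR j). lra.
Qed.

Lemma exists_nat_ge (x : R) : exists n : nat, x <= INR n.
Proof.
  exists (Z.to_nat (up x)). destruct (archimed x) as [H _].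
  destruct (Z_le_gt_dec 0 (up x)) as [Hz|Hz].
  - rewrite INR_IZR_INZ, Z2Nat.id by exact Hz. lra.
  - assert (IZR (up x) < 0) by (apply IZR_lt; lia). assert (H1 := pos_INR (Z.to_nat (up x))). lra.
Qed.

(** K is selected from Re s; the compatibility of the [zetaK] makes the value independent of the
    selection off s = 1. *)
Definition zeta_cont (s : C) : C :=
  zetaK (proj1_sig (constructive_indefinite_description _ (exists_nat_ge (1 - Re s)))) s.

Lemma zeta_cont_eq K s : s <> RtoC 1 -> 1 - INR K <= Re s -> zeta_cont s = zetaK K s.
Proof.
  intros Hs HK. unfold zeta_cont. destruct constructive_indefinite_description as [K' HK']. simpl.
  assert (HK'' : 1 - INR K' <= Re s) by lra.
  rewrite <- (zetaK_add K' K s Hs HK''), Nat.add_comm. now apply zetaK_add.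
Qed.

(** With K = 0 the only boundary term is x^(1-s)/(1-s), which tends to 0 when Re s > 1. *)
Lemma zeta_cont_series s : 1 < Re s -> Csums (fun n => rpow (INR (S n)) (- s)) (zeta_cont s).
Proof.
  intros Hs. assert (Hs1 : s <> RtoC 1) by (intros E; rewrite E in Hs; simpl in Hs; lra).
  assert (H0 : 1 - INR 0 <= Re s) by (simpl; lra).
  rewrite (zeta_cont_eq 0 s Hs1 H0).
  apply (Clim_ext (fun n => (csum (fun k => rpow (INR (S k)) (- s)) n - zeta_corr 0 s (INR (S n)))
     + beta 0 * (/ (RtoC 1 - s) * rpow (INR (S n)) (RtoC 1 - s)))).
  - intros n. unfold zeta_corr. cbn [csum]. change (Dpow s 0 (INR (S n))) with
      (rpow (INR (S n)) (RtoC 1 - s) / (RtoC 1 - s)). unfold Cdiv. ring.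
  - replace (zetaK 0 s) with (zetaK 0 s + beta 0 * (/ (RtoC 1 - s) * RtoC 0)) by ring.
    apply Clim_plus; [now apply zetaK_lim|]. do 2 apply Clim_scal. apply rpow_lim_0.
    change (1 + - Re s < 0). lra.
Qed.

Lemma power_series_on_falling j s0 r : power_series_on (fun s => falling (- s) j) s0 r.
Proof.
  induction j; simpl; [apply power_series_on_const|].
  apply power_series_on_mult; [exact IHj|].
  apply (power_series_on_ext (fun s => (- RtoC 1) * s - RtoC (INR j))); [intros; ring|].
  apply power_series_on_minus; [apply power_series_on_scal, power_series_on_id|apply power_series_on_const].
Qed.

Lemma power_series_on_rpow x c s0 r : power_series_on (fun s => rpow x (c - s)) s0 r.
Proof.
  apply (power_series_on_ext (fun s => rpow x c * Cexp ((- RtoC (ln x)) * s))).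
  - intros z _. unfold rpow. rewrite <- Cexp_plus. f_equal. ring.
  - apply power_series_on_scal, power_series_on_Cexp.
Qed.

Lemma power_series_on_Dpow k x s0 r : s0 <> RtoC 1 -> r <= Cmod (s0 - RtoC 1) ->
  power_series_on (fun s => Dpow s k x) s0 r.
Proof.
  intros Hs Hr. destruct k; simpl.
  - apply power_series_on_mult; [apply power_series_on_rpow|].
    destruct (power_series_on_inv (RtoC 1) s0 Hs) as [a Ha].
    apply (power_series_on_ext (fun s => (- RtoC 1) * / (s - RtoC 1))).
    + intros z Hz. assert (H : s0 + z - RtoC 1 <> RtoC 0).
      { intros E. replace z with (- (s0 - RtoC 1)) in Hz.
        - rewrite Cmod_opp in Hz. lra.
        - replace z with (s0 + z - RtoC 1 - (s0 - RtoC 1)) by ring. rewrite E. ring. }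
      field. split; [|exact H].
      intros E. apply H. replace (s0 + z - RtoC 1) with (- (RtoC 1 - (s0 + z))) by ring.
      rewrite E. ring.
    + apply power_series_on_scal. exists a. intros z Hz. apply Ha. lra.
  - apply power_series_on_mult; [apply power_series_on_falling|].
    apply (power_series_on_ext (fun s => rpow x (- RtoC (INR k) - s))).
    + intros z _. f_equal. ring.
    + apply power_series_on_rpow.
Qed.

Lemma power_series_on_zeta_corr K x s0 r : s0 <> RtoC 1 -> r <= Cmod (s0 - RtoC 1) ->
  power_series_on (fun s => zeta_corr K s x) s0 r.
Proof.
  intros Hs Hr. apply (power_series_on_csum (fun i s => beta i * Dpow s i x)). intros i _.
  apply power_series_on_scal. now apply power_series_on_Dpow.
Qed.

Lemma Cmod_falling_le a j A : Cmod a + INR j <= A -> Cmod (falling a j) <= A ^ j.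
Proof.
  induction j; intros H; [simpl; rewrite Cmod_1; lra|].
  rewrite S_INR in H. simpl. rewrite Cmod_mult, Rmult_comm.
  assert (H0 := pos_INR j). assert (H1 := Cmod_ge_0 a).
  apply Rmult_le_compat; try apply Cmod_ge_0.
  - unfold Cminus. eapply Rle_trans; [apply Cmod_triangle|].
    rewrite Cmod_opp, Cmod_R, Rabs_pos_eq; lra.
  - apply IHj. lra.
Qed.

(** Weierstrass' theorem for the series of the [kappa], whose bound is uniform on a disc that avoids
    the pole and lies in the half-plane of a single K. *)
Lemma Canalytic_zeta_cont s0 : s0 <> RtoC 1 -> Canalytic_at zeta_cont s0.
Proof.
  intros Hs0. apply Canalytic_power_series.
  assert (Hd : 0 < Cmod (s0 - RtoC 1)).
  { apply Cmod_gt_0. intros E. apply Hs0. replace s0 with (s0 - RtoC 1 + RtoC 1) by ring.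
    rewrite E. ring. }
  set (r := Rmin 1 (Cmod (s0 - RtoC 1))).
  assert (Hr0 : 0 < r) by (apply Rmin_pos; lra).
  assert (Hr1 : r <= 1) by apply Rmin_l. assert (Hr2 : r <= Cmod (s0 - RtoC 1)) by apply Rmin_r.
  (* As the radius is at most 1, the real part on the disc is at least Re s0 - 1 >= 1 - K. *)
  destruct (exists_nat_ge (2 - Re s0)) as [K HK].
  assert (Hball : forall z, Cmod z < r -> s0 + z <> RtoC 1 /\ 1 - INR K <= Re (s0 + z)).
  { intros z Hz. split.
    - intros E. replace z with (- (s0 - RtoC 1)) in Hz; [rewrite Cmod_opp in Hz; lra|].
      rewrite <- E. ring.
    - assert (H := re_le_Cmod z). assert (H1 := Rle_abs (- Re z)). rewrite Rabs_Ropp in H1.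
      change (1 - INR K <= Re s0 + Re z). lra. }
  exists r. split; [exact Hr0|].
  apply (power_series_on_ext (zetaK K)).
  { intros z Hz. destruct (Hball z Hz). symmetry. now apply zeta_cont_eq. }
  unfold zetaK. apply power_series_on_minus; [|now apply power_series_on_zeta_corr].
  set (A := (Cmod s0 + 1 + INR (S K))%R).
  apply (power_series_on_series (fun n s => kappa K s n)
    (fun n => A ^ S K * / INR (S n) ^ 2 * rsum (fun i => Cmod (beta i)) (S K))%R); auto.
  - intros n. unfold kappa. apply power_series_on_minus.
    + apply (power_series_on_ext (fun s => rpow (INR (S n)) (RtoC 0 - s))).
      * intros z _. f_equal. ring.
      * apply power_series_on_rpow.
    + apply power_series_on_minus; now apply power_series_on_zeta_corr.
  - intros n z Hz. destruct (Hball z Hz) as [Hz1 Hz2].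
    eapply Rle_trans; [now apply kappa_bound|].
    apply Rmult_le_compat_r; [apply rsum_ge_0; intros; apply Cmod_ge_0|].
    apply Rmult_le_compat_r; [left; apply Rinv_0_lt_compat, pow_lt, lt_0_INR; lia|].
    apply Cmod_falling_le. unfold A. rewrite Cmod_opp. assert (H := Cmod_triangle s0 z). lra.
  - apply ex_series_mult_r, ex_series_mult_l, ex_series_inv_sq.
  - intros z Hz. destruct (Hball z Hz) as [Hz1 Hz2]. now apply Csums_kappa.
Qed.

(** * Uniqueness of the continuation at real points *)

Lemma is_zeta_zeta_cont : is_zeta zeta_cont.
Proof.
  split.
  - intros s Hs. apply Cis_series_Csums.
    apply (Csums_ext (fun n => rpow (INR (S n)) (- s))).
    + intros n. symmetry. apply Cpower_pos, lt_0_INR. lia.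
    + now apply zeta_cont_series.
  - apply Canalytic_zeta_cont.
Qed.

Lemma is_zeta_unique f g (q : R) : is_zeta f -> is_zeta g -> q <> 1%R -> f (RtoC q) = g (RtoC q).
Proof.
  intros [Hf1 Hf2] [Hg1 Hg2] Hq.
  (* On the segment from 2 + i to the real point [q] the imaginary part is 1 - t, so the real axis
     is met only at [q] and the pole is avoided. Near the start Re s > 1, where both functions are
     the same series. *)
  set (p := RtoC 2 + Ci).
  enough (E : (fun s => f s - g s) (RtoC q) = RtoC 0).
  { cbv beta in E. replace (f (RtoC q)) with (f (RtoC q) - g (RtoC q) + g (RtoC q)) by ring.
    rewrite E. ring. }
  assert (HIm : forall t : R, Im (p + RtoC t * (RtoC q - p)) = (1 - t)%R) by (intros; simpl; ring).
  assert (HRe : forall t : R, Re (p + RtoC t * (RtoC q - p)) = (2 + t * (q - 2))%R)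
    by (intros; simpl; ring).
  apply (identity_theorem_segment (fun s => f s - g s) p (RtoC q) (/ (1 + Rabs (q - 2)))).
  - intros E. apply (f_equal Im) in E. simpl in E. lra.
  - apply Rinv_0_lt_compat. assert (H := Rabs_pos (q - 2)). lra.
  - intros t Ht. assert (Hne : p + RtoC t * (RtoC q - p) <> RtoC 1).
    { intros E. assert (E1 := f_equal Im E). assert (E2 := f_equal Re E).
      rewrite HIm in E1. rewrite HRe in E2. simpl in E1, E2.
      replace t with 1%R in E2 by lra. lra. }
    apply Canalytic_minus; auto.
  - intros t Ht. assert (Hr : 1 < Re (p + RtoC t * (RtoC q - p))).
    { rewrite HRe. assert (H0 := Rabs_pos (q - 2)). assert (H1 := Rle_abs (- (q - 2))).
      rewrite Rabs_Ropp in H1.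
      assert (t * (1 + Rabs (q - 2)) < 1) by (apply Rlt_div_r; [lra|]; unfold Rdiv; lra). nra. }
    specialize (Hf1 _ Hr). specialize (Hg1 _ Hr).
    apply Cis_series_Csums in Hf1. apply Cis_series_Csums in Hg1.
    rewrite (Csums_unique _ _ _ Hf1 Hg1). ring.
Qed.

(** [zeta] is given by [epsilon], so it satisfies [is_zeta] only once a witness exists; [zeta_cont]
    is that witness, and uniqueness transfers its values. *)
Lemma zeta_eq_zetaK K (q : R) : q <> 1%R -> 1 - INR K <= q -> zeta (RtoC q) = zetaK K (RtoC q).
Proof.
  intros Hq HK.
  assert (Hz : is_zeta zeta).
  { unfold zeta. apply epsilon_spec. exists zeta_cont. apply is_zeta_zeta_cont. }
  rewrite (is_zeta_unique _ _ q Hz is_zeta_zeta_cont Hq). apply zeta_cont_eq; [|exact HK].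
  intros E. apply Hq. now injection E.
Qed.

(** * The values of zeta at negative integers *)

Lemma falling_nat N j : (j <= N)%nat ->
  falling (RtoC (INR N)) j = RtoC (INR (fact N)) / RtoC (INR (fact (N - j))).
Proof.
  induction j; intros Hj.
  - rewrite Nat.sub_0_r. simpl. field. apply RtoC_neq_0, INR_fact_neq_0.
  - simpl. rewrite IHj by lia. replace (N - j)%nat with (S (N - S j)) by lia.
    rewrite fact_simpl, mult_INR, RtoC_mult.
    replace (INR (S (N - S j))) with (INR N - INR j)%R
      by (rewrite <- minus_INR by lia; f_equal; lia).
    rewrite RtoC_minus. field. split.
    + apply RtoC_neq_0, INR_fact_neq_0.
    + rewrite <- RtoC_minus, <- minus_INR by lia. apply RtoC_neq_0, not_0_INR. lia.
Qed.

Lemma falling_nat_S N : falling (RtoC (INR N)) (S N) = RtoC 0.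
Proof. simpl. ring. Qed.

(** At s = -N the summand x^N is a polynomial, so with K = N + 1 Euler-Maclaurin is exact and every
    [kappa] vanishes. The boundary term at 1 collapses through the Bernoulli recursion to its last
    summand. *)
Lemma zeta_neg_nat N : (1 <= N)%nat ->
  zeta (RtoC (- INR N)) = - (RtoC (INR (fact N)) * beta (S N)).
Proof.
  intros HN. assert (Hp := pos_INR N).
  assert (HK : 1 - INR (S N) <= - INR N) by (rewrite S_INR; lra).
  assert (H1 : (- INR N)%R <> 1%R) by lra.
  rewrite (zeta_eq_zetaK (S N) _ H1 HK).
  assert (H1' : RtoC (- INR N) <> RtoC 1) by (intros E; apply H1; now injection E).
  assert (Es : - RtoC (- INR N) = RtoC (INR N)) by (rewrite RtoC_opp; ring).
  unfold zetaK. rewrite (CSeries_unique _ (RtoC 0)).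
  - replace (zeta_corr (S N) (RtoC (- INR N)) 1) with (RtoC (INR (fact N)) * beta (S N)); [ring|].
    unfold zeta_corr.
    rewrite (csum_ext _ (fun i => RtoC (INR (fact N)) * (beta i / RtoC (INR (fact (S N - i)))))).
    + rewrite csum_scal. f_equal. assert (E := beta_recursion N).
      destruct N; [lia|]. simpl Nat.eqb in E. cbv iota in E.
      cbn [csum] in E |- *. rewrite E. replace (S (S N) - S (S N))%nat with 0%nat by lia.
      change (INR (fact 0)) with 1%R. field.
    + intros i Hi. destruct i.
      * unfold Dpow. rewrite rpow_1_l. rewrite Nat.sub_0_r, fact_simpl, mult_INR, RtoC_mult.
        assert (HN1 : RtoC (INR (S N)) <> RtoC 0) by (apply RtoC_neq_0, not_0_INR; lia).
        replace (RtoC 1 - RtoC (- INR N)) with (RtoC (INR (S N)))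
          by (rewrite S_INR, RtoC_plus, RtoC_opp; ring).
        field. split; [|exact HN1]. apply RtoC_neq_0, INR_fact_neq_0.
      * unfold Dpow. rewrite rpow_1_l, Es, falling_nat by lia.
        replace (S N - S i)%nat with (N - i)%nat by lia. field.
        apply RtoC_neq_0, INR_fact_neq_0.
  - apply (Csums_ext (fun _ => RtoC 0)); [|apply Csums_zero].
    intros n. symmetry. apply Cmod_eq_0.
    assert (H := kappa_bound (S N) (RtoC (- INR N)) n H1' HK).
    rewrite Es in H. change (falling (RtoC (INR N)) (S (S N))) with
      (falling (RtoC (INR N)) (S N) * (RtoC (INR N) - RtoC (INR (S N)))) in H.
    rewrite falling_nat_S, Cmult_0_l, Cmod_0, !Rmult_0_l in H.
    assert (H2 := Cmod_ge_0 (kappa (S N) (RtoC (- INR N)) n)). lra.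
Qed.

(** * Euler-Maclaurin summation of x^2 / (x^2 + z^2) *)

Lemma cderiv_eq f x l l' : cderiv f x l -> l = l' -> cderiv f x l'.
Proof. intros H <-. exact H. Qed.

Lemma cderiv_var x : cderiv (fun t => RtoC t) x (RtoC 1).
Proof. apply cderiv_RtoC. auto_derive; auto. Qed.

Definition recip_sq (z : C) (x : R) : C := / (RtoC x * RtoC x + z * z).

(* A primitive of 2 z / (x^2 + z^2) = 1 / (z + i x) + 1 / (z - i x). *)
Definition two_arctan (z : C) (x : R) : C :=
  ((atan ((x + Im z) / Re z) + atan ((x - Im z) / Re z))%R,
   ((ln (Re z ^ 2 + (x - Im z) ^ 2) - ln (Re z ^ 2 + (x + Im z) ^ 2)) / 2)%R).

(* [Qder z 1 x] is x^2 / (x^2 + z^2), [Qder z 0] a primitive of it, and [Qder z 2], [Qder z 3],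
   [Qder z 4] are its derivatives. *)
Definition Qder (z : C) (k : nat) (x : R) : C :=
  let p := recip_sq z x in
  match k with
  | 0 => RtoC x - z / RtoC 2 * two_arctan z x
  | 1 => RtoC x * RtoC x * p
  | 2 => RtoC 2 * (RtoC x * (z * z) * (p * p))
  | 3 => z * z * (RtoC 2 * (p * p) - RtoC 8 * (RtoC x * RtoC x * (p * p * p)))
  | 4 => z * z * (RtoC 48 * (RtoC x * RtoC x * RtoC x * (p * p * p * p))
                  - RtoC 24 * (RtoC x * (p * p * p)))
  | _ => RtoC 0
  end.

Lemma sq_sum_neq_0 z x : 0 < Re z -> RtoC x * RtoC x + z * z <> RtoC 0.
Proof. intros Hz. rewrite Cplus_comm. now apply sq_plus_sq_neq_0. Qed.

Lemma cderiv_recip_sq z x : 0 < Re z ->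
  cderiv (recip_sq z) x (- (RtoC 2 * (RtoC x * (recip_sq z x * recip_sq z x)))).
Proof.
  intros Hz. assert (Hn := sq_sum_neq_0 z x Hz).
  eapply cderiv_eq.
  - apply (cderiv_inv (fun t => RtoC t * RtoC t + z * z)); [exact Hn|].
    apply cderiv_plus; [apply cderiv_mult; apply cderiv_var|apply cderiv_const].
  - unfold recip_sq. field. exact Hn.
Qed.

Lemma cderiv_two_arctan z x : 0 < Re z ->
  cderiv (two_arctan z) x (RtoC 2 * z * recip_sq z x).
Proof.
  intros Hz. destruct z as [a b]. simpl in Hz.
  assert (Hn := sq_sum_neq_0 (a, b) x Hz).
  set (z := (a, b) : C) in *.
  assert (Ha2 : 0 < a ^ 2) by (apply pow_lt; lra).
  assert (H1 : 0 < a ^ 2 + (x + b) ^ 2) by (assert (H := pow2_ge_0 (x + b)); lra).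
  assert (H2 : 0 < a ^ 2 + (x - b) ^ 2) by (assert (H := pow2_ge_0 (x - b)); lra).
  assert (E : RtoC 2 * z * recip_sq z x = / (a, (x + b)%R) + / (a, (b - x)%R)).
  { assert (Hp : z + Ci * RtoC x = (a, (x + b)%R)) by (apply C_ext; simpl; ring).
    assert (Hm : z - Ci * RtoC x = (a, (b - x)%R)) by (apply C_ext; simpl; ring).
    rewrite <- Hp, <- Hm.
    assert (Hf : RtoC x * RtoC x + z * z = (z + Ci * RtoC x) * (z - Ci * RtoC x))
      by (apply C_ext; simpl; ring).
    rewrite Hf in Hn. unfold recip_sq. rewrite Hf. field.
    split; intros E; apply Hn; rewrite E; ring. }
  rewrite E. split.
  - apply (is_derive_ext (fun t => (atan ((t + b) / a) + atan ((t - b) / a))%R)); [reflexivity|].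
    auto_derive; [auto|]. simpl. unfold Rsqr. field. repeat split; lra || nra.
  - apply (is_derive_ext (fun t => ((ln (a ^ 2 + (t - b) ^ 2) - ln (a ^ 2 + (t + b) ^ 2)) / 2)%R));
      [reflexivity|].
    auto_derive; [repeat split; nra|]. simpl. field. repeat split; nra.
Qed.

Lemma cderiv_Qder z k x : 0 < Re z -> (k <= 3)%nat -> cderiv (Qder z k) x (Qder z (S k) x).
Proof.
  intros Hz Hk. assert (Hn := sq_sum_neq_0 z x Hz).
  assert (Hp := cderiv_recip_sq z x Hz). assert (Hx := cderiv_var x).
  assert (Hx2 := cderiv_mult _ _ _ _ _ Hx Hx).
  assert (Hp2 := cderiv_mult _ _ _ _ _ Hp Hp).
  assert (Hp3 := cderiv_mult _ _ _ _ _ Hp2 Hp).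
  assert (Ex : recip_sq z x * (RtoC x * RtoC x + z * z) = RtoC 1) by (unfold recip_sq; field; exact Hn).
  destruct k as [|[|[|[|k]]]]; try lia; unfold Qder.
  - eapply cderiv_eq.
    + apply cderiv_minus; [exact Hx|]. apply cderiv_scal. now apply cderiv_two_arctan.
    + unfold recip_sq. field. exact Hn.
  - eapply cderiv_eq; [apply cderiv_mult; [exact Hx2|exact Hp]|].
    unfold recip_sq. field. exact Hn.
  - eapply cderiv_eq.
    + apply cderiv_scal. apply cderiv_mult; [|exact Hp2].
      apply cderiv_mult; [exact Hx|apply cderiv_const].
    + cbv beta. unfold recip_sq. field. exact Hn.
  - eapply cderiv_eq.
    + apply cderiv_scal. apply cderiv_minus; apply cderiv_scal; [exact Hp2|].
      apply cderiv_mult; [exact Hx2|exact Hp3].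
    + cbv beta. unfold recip_sq. field. exact Hn.
Qed.

(** x^2 + z^2 = (x + i z)(x - i z) with z = kap r, and because Re kap > 0 each factor is bounded
    below by a multiple of sqrt(x^2 + r^2). A constant valid for all r makes the later estimates
    uniform in d. *)
Lemma sector_bound (kap : C) : 0 < Re kap -> exists m, 1 <= m /\ forall r x : R,
  x ^ 2 + r ^ 2 <= m * Cmod (RtoC x * RtoC x + kap * RtoC r * (kap * RtoC r)).
Proof.
  intros Hk. destruct kap as [p q]. simpl in Hk.
  (* Each factor has real part x + e q r and imaginary part of modulus p |r|, with e = 1 or -1. The
     constant combines x^2 <= 2 (x + e q r)^2 + 2 q^2 r^2 with r^2 = (p r)^2 / p^2. *)
  set (m := (2 + (2 * q ^ 2 + 1) / p ^ 2)%R).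
  assert (Hp2 : 0 < p ^ 2) by (apply pow_lt; lra).
  assert (Hq : (((2 * q ^ 2 + 1) / p ^ 2) * p ^ 2 = 2 * q ^ 2 + 1)%R) by (field; lra).
  assert (Hm0 : 0 <= (2 * q ^ 2 + 1) / p ^ 2).
  { apply Rdiv_le_0_compat; [|lra]. assert (H := pow2_ge_0 q). lra. }
  assert (Hb : forall x r e : R, (e ^ 2 = 1)%R ->
    x ^ 2 + r ^ 2 <= m * (Cmod ((x + e * q * r)%R, (- (e * p * r))%R)) ^ 2).
  { intros x r e He. rewrite Cmod2_alt. cbn [Re Im fst snd].
    replace ((- (e * p * r)) ^ 2)%R with (e ^ 2 * (p ^ 2 * r ^ 2))%R by ring. rewrite He.
    unfold m. set (w := ((2 * q ^ 2 + 1) / p ^ 2)%R) in *.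
    assert (E1 : (w * (1 * (p ^ 2 * r ^ 2)) = (2 * q ^ 2 + 1) * r ^ 2)%R) by (rewrite <- Hq; ring).
    assert (E2 : x ^ 2 <= 2 * (x + e * q * r) ^ 2 + 2 * q ^ 2 * r ^ 2).
    { replace (q ^ 2)%R with (e ^ 2 * q ^ 2)%R by (rewrite He; ring).
      assert (H := pow2_ge_0 (x + 2 * (e * q * r))). nra. }
    assert (H3 := pow2_ge_0 (x + e * q * r)). assert (H4 : 0 <= p ^ 2 * r ^ 2).
    { apply Rmult_le_pos; apply pow2_ge_0. }
    nra. }
  exists m. split; [unfold m; lra|]. intros r x.
  assert (E : RtoC x * RtoC x + (p, q) * RtoC r * ((p, q) * RtoC r) =
    ((x + 1 * q * r)%R, (- (1 * p * r))%R) * ((x + -1 * q * r)%R, (- (-1 * p * r))%R)).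
  { apply C_ext; simpl; ring. }
  rewrite E, !Cmod_mult.
  assert (H1 := Hb x r 1%R ltac:(ring)). assert (H2 := Hb x r (-1)%R ltac:(ring)).
  set (A := Cmod ((x + 1 * q * r)%R, _)) in *. set (B := Cmod ((x + -1 * q * r)%R, _)) in *.
  assert (HA : 0 <= A) by apply Cmod_ge_0. assert (HB : 0 <= B) by apply Cmod_ge_0.
  set (s := (x ^ 2 + r ^ 2)%R) in *.
  assert (Hs : 0 <= s) by (unfold s; assert (H3 := pow2_ge_0 x); assert (H4 := pow2_ge_0 r); lra).
  assert (Hm : 0 < m) by (unfold m; lra).
  destruct (Rle_or_lt s (m * (A * B))) as [H|H]; [exact H|exfalso].
  assert (s * s <= (m * A ^ 2) * (m * B ^ 2)) by (apply Rmult_le_compat; assumption).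
  assert (0 <= m * (A * B)) by (apply Rmult_le_pos; [lra|now apply Rmult_le_pos]).
  assert (m * (A * B) * (m * (A * B)) < s * s) by (apply Rmult_le_0_lt_compat; nra). nra.
Qed.

Lemma Cmod_recip_sq_le kap m r x : 0 < Re kap -> 0 < r ->
  (forall r x : R, x ^ 2 + r ^ 2 <= m * Cmod (RtoC x * RtoC x + kap * RtoC r * (kap * RtoC r))) ->
  Cmod (recip_sq (kap * RtoC r) x) <= m * / (x ^ 2 + r ^ 2).
Proof.
  intros Hk Hr Hm. specialize (Hm r x).
  assert (Hz : 0 < Re (kap * RtoC r)) by (destruct kap; simpl in *; nra).
  assert (Hn := sq_sum_neq_0 (kap * RtoC r) x Hz).
  assert (H0 : 0 < Cmod (RtoC x * RtoC x + kap * RtoC r * (kap * RtoC r))) by now apply Cmod_gt_0.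
  assert (Hs : 0 < x ^ 2 + r ^ 2).
  { assert (H1 := pow2_ge_0 x). assert (0 < r ^ 2) by (apply pow_lt; lra). lra. }
  unfold recip_sq. rewrite Cmod_inv by exact Hn.
  set (M := Cmod _) in *. apply (Rmult_le_reg_r M); [exact H0|]. rewrite Rinv_l by lra.
  apply (Rmult_le_reg_r (x ^ 2 + r ^ 2)); [exact Hs|].
  replace (m * / (x ^ 2 + r ^ 2) * M * (x ^ 2 + r ^ 2))%R with (m * M)%R by (field; lra). lra.
Qed.

(** Every z^2 contributes |kap|^2 r^2, which one factor 1/(x^2 + r^2) absorbs; the same holds for
    x^2. [B] is the sum of the four constants that arise. *)
Lemma Qder_bounds (kap : C) : 0 < Re kap -> exists B, 0 <= B /\ forall r x : R, 0 < r -> 0 < x ->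
  let z := kap * RtoC r in
  Cmod (Qder z 1 x) <= B * (x ^ 2 * / (x ^ 2 + r ^ 2)) /\
  Cmod (Qder z 2 x) <= B * (x * / (x ^ 2 + r ^ 2)) /\
  Cmod (Qder z 3 x) <= B * / (x ^ 2 + r ^ 2) /\
  Cmod (Qder z 4 x) <= B * (x * (/ (x ^ 2 + r ^ 2)) ^ 2).
Proof.
  intros Hk. destruct (sector_bound kap Hk) as [m [Hm1 Hm]].
  set (k := Cmod kap). assert (Hk0 : 0 <= k) by apply Cmod_ge_0.
  exists (m + 2 * k ^ 2 * m ^ 2 + (2 * m ^ 2 + 8 * m ^ 3) * k ^ 2
     + (48 * m ^ 4 + 24 * m ^ 3) * k ^ 2)%R.
  assert (B1 : 0 <= 2 * k ^ 2 * m ^ 2) by (assert (0 <= k ^ 2 * m ^ 2) by (apply Rmult_le_pos; apply pow_le; lra); lra).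
  assert (B2 : 0 <= (2 * m ^ 2 + 8 * m ^ 3) * k ^ 2).
  { apply Rmult_le_pos; [|apply pow_le; lra].
    assert (0 <= m ^ 2) by (apply pow_le; lra). assert (0 <= m ^ 3) by (apply pow_le; lra). lra. }
  assert (B3 : 0 <= (48 * m ^ 4 + 24 * m ^ 3) * k ^ 2).
  { apply Rmult_le_pos; [|apply pow_le; lra].
    assert (0 <= m ^ 4) by (apply pow_le; lra). assert (0 <= m ^ 3) by (apply pow_le; lra). lra. }
  split; [lra|]. intros r x Hr Hx z.
  assert (Hp := Cmod_recip_sq_le kap m r x Hk Hr Hm). fold z in Hp.
  assert (Hx2 : 0 < x ^ 2) by (apply pow_lt; lra). assert (Hr2 : 0 < r ^ 2) by (apply pow_lt; lra).
  set (v := (/ (x ^ 2 + r ^ 2))%R) in *.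
  assert (Hv : 0 < v) by (apply Rinv_0_lt_compat; lra).
  assert (Ev : (x ^ 2 * v + r ^ 2 * v = 1)%R) by (unfold v; field; lra).
  assert (Hxv : 0 <= x ^ 2 * v) by nra. assert (Hrv : 0 <= r ^ 2 * v) by nra.
  set (X := (x ^ 2 * v)%R) in *. set (Rv := (r ^ 2 * v)%R) in *.
  assert (HX1 : X <= 1) by lra. assert (HR1 : Rv <= 1) by lra.
  set (p := recip_sq z x) in *. set (a := Cmod p) in *.
  assert (Ha : 0 <= a) by apply Cmod_ge_0.
  assert (Hz : Cmod z = (k * r)%R) by (unfold z; rewrite Cmod_mult, Cmod_R, Rabs_pos_eq; [reflexivity|lra]).
  assert (Hpow : forall n, a ^ n <= m ^ n * v ^ n).
  { intros n. rewrite <- Rpow_mult_distr. apply pow_incr. lra. }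
  assert (Hxm : Cmod (RtoC x) = x) by (rewrite Cmod_R, Rabs_pos_eq; lra).
  assert (Hn : forall n : R, 0 <= n -> Cmod (RtoC n) = n) by (intros; rewrite Cmod_R, Rabs_pos_eq; lra).
  assert (Hk2 : 0 <= k ^ 2) by (apply pow_le; lra).
  assert (Hmn : forall n, 0 <= m ^ n) by (intros; apply pow_le; lra).
  repeat split; unfold Qder; fold p; cbv zeta.
  - rewrite !Cmod_mult, Hxm. fold a.
    replace (x * x * a)%R with (x ^ 2 * a)%R by ring.
    assert (x ^ 2 * a <= x ^ 2 * (m * v)) by nra.
    replace (x ^ 2 * (m * v))%R with (m * X)%R in H by (unfold X; ring). fold X. nra.
  - rewrite !Cmod_mult, Hxm, Hz, Hn by lra. fold a.
    replace (2 * (x * (k * r * (k * r)) * (a * a)))%R with (2 * k ^ 2 * x * r ^ 2 * a ^ 2)%R by ring.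
    assert (H2 := Hpow 2%nat).
    assert (H3 : 2 * k ^ 2 * x * r ^ 2 * a ^ 2 <= 2 * k ^ 2 * x * r ^ 2 * (m ^ 2 * v ^ 2)).
    { apply Rmult_le_compat_l; [|exact H2]. repeat apply Rmult_le_pos; lra. }
    replace (2 * k ^ 2 * x * r ^ 2 * (m ^ 2 * v ^ 2))%R with (2 * k ^ 2 * m ^ 2 * (x * v) * Rv)%R in H3
      by (unfold Rv; ring).
    assert (Hxv' : 0 <= x * v) by nra. fold v.
    assert (H5 : 2 * k ^ 2 * m ^ 2 * (x * v) * Rv <= 2 * k ^ 2 * m ^ 2 * (x * v)).
    { assert (0 <= 2 * k ^ 2 * m ^ 2 * (x * v)) by (apply Rmult_le_pos; lra). nra. }
    nra.
  - rewrite !Cmod_mult, Hz.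
    assert (Ht : Cmod (RtoC 2 * (p * p) - RtoC 8 * (RtoC x * RtoC x * (p * p * p))) <=
      2 * a ^ 2 + 8 * (x ^ 2 * a ^ 3)).
    { unfold Cminus. eapply Rle_trans; [apply Cmod_triangle|].
      rewrite Cmod_opp, !Cmod_mult, Hxm, !Hn by lra. fold a. apply Req_le. ring. }
    assert (H2 := Hpow 2%nat). assert (H3 := Hpow 3%nat).
    assert (H4 : x ^ 2 * a ^ 3 <= m ^ 3 * v ^ 2 * X).
    { replace (m ^ 3 * v ^ 2 * X)%R with (x ^ 2 * (m ^ 3 * v ^ 3))%R by (unfold X; ring). nra. }
    assert (Hv2 : 0 <= v ^ 2) by (apply pow_le; lra).
    assert (H5 : m ^ 3 * v ^ 2 * X <= m ^ 3 * v ^ 2).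
    { assert (0 <= m ^ 3 * v ^ 2) by now apply Rmult_le_pos. nra. }
    assert (H6 : Cmod (RtoC 2 * (p * p) - RtoC 8 * (RtoC x * RtoC x * (p * p * p))) <=
       (2 * m ^ 2 + 8 * m ^ 3) * v ^ 2) by lra.
    assert (H7 : k * r * (k * r) * Cmod (RtoC 2 * (p * p) - RtoC 8 * (RtoC x * RtoC x * (p * p * p)))
      <= k * r * (k * r) * ((2 * m ^ 2 + 8 * m ^ 3) * v ^ 2)).
    { apply Rmult_le_compat_l; [nra|exact H6]. }
    replace (k * r * (k * r) * ((2 * m ^ 2 + 8 * m ^ 3) * v ^ 2))%R with
      ((2 * m ^ 2 + 8 * m ^ 3) * k ^ 2 * v * Rv)%R in H7 by (unfold Rv; ring).
    assert (H8 : (2 * m ^ 2 + 8 * m ^ 3) * k ^ 2 * v * Rv <= (2 * m ^ 2 + 8 * m ^ 3) * k ^ 2 * v).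
    { assert (0 <= (2 * m ^ 2 + 8 * m ^ 3) * k ^ 2 * v) by (apply Rmult_le_pos; lra). nra. }
    nra.
  - rewrite !Cmod_mult, Hz.
    set (T := RtoC 48 * (RtoC x * RtoC x * RtoC x * (p * p * p * p)) - RtoC 24 * (RtoC x * (p * p * p))).
    assert (Ht : Cmod T <= 48 * (x ^ 3 * a ^ 4) + 24 * (x * a ^ 3)).
    { unfold T, Cminus. eapply Rle_trans; [apply Cmod_triangle|].
      rewrite Cmod_opp, !Cmod_mult, Hxm, !Hn by lra. fold a. apply Req_le. ring. }
    assert (H2 := Hpow 4%nat). assert (H3 := Hpow 3%nat).
    assert (Hx3 : 0 < x ^ 3) by (apply pow_lt; lra).
    assert (H4 : x ^ 3 * a ^ 4 <= m ^ 4 * (x * v ^ 3) * X).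
    { replace (m ^ 4 * (x * v ^ 3) * X)%R with (x ^ 3 * (m ^ 4 * v ^ 4))%R by (unfold X; ring). nra. }
    assert (Hv3 : 0 <= x * v ^ 3) by (apply Rmult_le_pos; [lra|apply pow_le; lra]).
    assert (H5 : m ^ 4 * (x * v ^ 3) * X <= m ^ 4 * (x * v ^ 3)).
    { assert (0 <= m ^ 4 * (x * v ^ 3)) by now apply Rmult_le_pos. nra. }
    assert (H6 : Cmod T <= (48 * m ^ 4 + 24 * m ^ 3) * (x * v ^ 3)) by nra.
    assert (H7 : k * r * (k * r) * Cmod T <= k * r * (k * r) * ((48 * m ^ 4 + 24 * m ^ 3) * (x * v ^ 3))).
    { apply Rmult_le_compat_l; [nra|exact H6]. }
    replace (k * r * (k * r) * ((48 * m ^ 4 + 24 * m ^ 3) * (x * v ^ 3)))%R with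
      ((48 * m ^ 4 + 24 * m ^ 3) * k ^ 2 * (x * v ^ 2) * Rv)%R in H7 by (unfold Rv; ring).
    assert (Hv2 : 0 <= x * v ^ 2) by (apply Rmult_le_pos; [lra|apply pow_le; lra]).
    assert (H8 : (48 * m ^ 4 + 24 * m ^ 3) * k ^ 2 * (x * v ^ 2) * Rv <=
      (48 * m ^ 4 + 24 * m ^ 3) * k ^ 2 * (x * v ^ 2)).
    { assert (0 <= (48 * m ^ 4 + 24 * m ^ 3) * k ^ 2 * (x * v ^ 2)) by (apply Rmult_le_pos; lra). nra. }
    nra.
Qed.

(** With a = sqrt x and b = sqrt r this follows from a b^3 <= a^4 + b^4. The product form separates
    the variables, so that the sums over x and over d can be bounded independently. *)
Lemma three_halves_bound x r : 0 < x -> 0 < r ->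
  x * (/ (x ^ 2 + r ^ 2)) ^ 2 <= / (x * sqrt x) * / (r * sqrt r).
Proof.
  intros Hx Hr.
  assert (Ha := sqrt_lt_R0 x Hx). assert (Hb := sqrt_lt_R0 r Hr).
  assert (Ea : (sqrt x * sqrt x = x)%R) by (apply sqrt_sqrt; lra).
  assert (Eb : (sqrt r * sqrt r = r)%R) by (apply sqrt_sqrt; lra).
  set (a := sqrt x) in *. set (b := sqrt r) in *. rewrite <- Ea, <- Eb.
  replace ((a * a) ^ 2 + (b * b) ^ 2)%R with (a ^ 4 + b ^ 4)%R by ring.
  assert (H4a : 0 < a ^ 4) by (apply pow_lt; lra). assert (H4b : 0 < b ^ 4) by (apply pow_lt; lra).
  assert (H1 : a * b ^ 3 <= a ^ 4 + b ^ 4).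
  { replace (a ^ 4)%R with (a ^ 2 * a ^ 2)%R by ring. replace (b ^ 4)%R with (b ^ 2 * b ^ 2)%R by ring.
    replace (a * b ^ 3)%R with (a * b * b ^ 2)%R by ring.
    assert (a * b <= (a ^ 2 + b ^ 2) / 2) by (assert (H := pow2_ge_0 (a - b)); nra).
    assert (0 < a ^ 2) by (apply pow_lt; lra). assert (0 < b ^ 2) by (apply pow_lt; lra).
    assert (H5 := pow2_ge_0 (a ^ 2 - b ^ 2)). nra. }
  apply (Rmult_le_reg_r ((a ^ 4 + b ^ 4) ^ 2 * (a ^ 3 * b ^ 3))).
  - apply Rmult_lt_0_compat; [apply pow_lt; lra|apply Rmult_lt_0_compat; apply pow_lt; lra].
  - replace (a * a * (/ (a ^ 4 + b ^ 4)) ^ 2 * ((a ^ 4 + b ^ 4) ^ 2 * (a ^ 3 * b ^ 3)))%R with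
      (a ^ 4 * (a * b ^ 3))%R by (field; lra).
    replace (/ (a * a * a) * / (b * b * b) * ((a ^ 4 + b ^ 4) ^ 2 * (a ^ 3 * b ^ 3)))%R with
      ((a ^ 4 + b ^ 4) * (a ^ 4 + b ^ 4))%R by (field; lra).
    apply Rmult_le_compat; try lra. apply Rmult_le_pos; [lra|apply pow_le; lra].
Qed.

(** * The Euler-Maclaurin defect in x and its limit *)

Lemma is_lim_seq_inv_INR_S : is_lim_seq (fun n => / INR (S n))%R 0.
Proof.
  apply (is_lim_seq_incr_1 (fun m => / INR m)%R).
  replace (Finite 0) with (Rbar_inv p_infty) by reflexivity.
  apply is_lim_seq_inv; [apply is_lim_seq_INR|discriminate].
Qed.

Lemma atan_affine_lim a b : 0 < a -> is_lim_seq (fun n => atan ((INR (S n) + b) / a)) (PI / 2)%R.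
Proof.
  intros Ha.
  set (v := fun n => ((INR (S n) + b) / a)%R).
  assert (Hinv : is_lim_seq (fun n => / v n)%R 0).
  { apply (is_lim_seq_ext (fun n => a * / INR (S n) * / (1 + b * / INR (S n)))%R).
    - intros n. assert (Hn := INR_S_ge_1 n). unfold v.
      destruct (Req_dec (INR (S n) + b) 0) as [E|E].
      + replace (1 + b * / INR (S n))%R with ((INR (S n) + b) * / INR (S n))%R by (field; lra).
        rewrite E. unfold Rdiv. rewrite !Rmult_0_l, Rinv_0. ring.
      + field. repeat split; lra.
    - replace (Finite 0) with (Finite (a * 0 * / (1 + b * 0))) by (f_equal; field).
      apply is_lim_seq_mult'; [apply is_lim_seq_mult'; [apply is_lim_seq_const|apply is_lim_seq_inv_INR_S]|].
      apply (is_lim_seq_inv _ (Finite (1 + b * 0))).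
      + apply is_lim_seq_plus'; [apply is_lim_seq_const|].
        apply is_lim_seq_mult'; [apply is_lim_seq_const|apply is_lim_seq_inv_INR_S].
      + intros E. injection E. lra. }
  apply (is_lim_seq_ext_loc (fun n => PI / 2 - atan (/ v n))%R).
  - destruct (exists_nat_ge (Rabs b)) as [n0 Hn0]. exists n0. intros n Hn.
    assert (Hp : 0 < v n).
    { unfold v. apply Rdiv_lt_0_compat; [|exact Ha]. rewrite S_INR. apply le_INR in Hn.
      assert (H := Rle_abs (- b)). rewrite Rabs_Ropp in H. lra. }
    rewrite atan_inv by exact Hp. fold (v n). ring.
  - replace (Finite (PI / 2)) with (Finite (PI / 2 - atan 0)) by (f_equal; rewrite atan_0; ring).
    apply is_lim_seq_minus'; [apply is_lim_seq_const|].
    apply (is_lim_seq_continuous atan); [|exact Hinv].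
    apply derivable_continuous_pt, derivable_pt_atan.
Qed.

Lemma ln_ratio_lim a b : 0 < a ->
  is_lim_seq (fun n => ln (a ^ 2 + (INR (S n) + b) ^ 2) - ln (INR (S n) ^ 2))%R 0.
Proof.
  intros Ha.
  assert (Ha2 : 0 < a ^ 2) by (apply pow_lt; lra).
  apply (is_lim_seq_ext (fun n => ln (a ^ 2 * (/ INR (S n) * / INR (S n)) +
     (1 + b * / INR (S n)) * (1 + b * / INR (S n))))%R).
  - intros n. assert (Hn := INR_S_ge_1 n).
    assert (Hp : 0 < a ^ 2 + (INR (S n) + b) ^ 2) by (assert (H := pow2_ge_0 (INR (S n) + b)); lra).
    rewrite <- ln_div by (try apply pow_lt; lra).
    f_equal. field. lra.
  - rewrite <- ln_1. 
    replace (Finite (ln 1)) with (Finite (ln (a ^ 2 * (0 * 0) + (1 + b * 0) * (1 + b * 0))))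
      by (do 2 f_equal; ring).
    apply (is_lim_seq_continuous ln).
    + apply derivable_continuous_pt. exists (/ (a ^ 2 * (0 * 0) + (1 + b * 0) * (1 + b * 0)))%R.
      apply derivable_pt_lim_ln. lra.
    + assert (H1 : is_lim_seq (fun n => 1 + b * / INR (S n))%R (1 + b * 0)%R).
      { apply is_lim_seq_plus'; [apply is_lim_seq_const|].
        apply is_lim_seq_mult'; [apply is_lim_seq_const|apply is_lim_seq_inv_INR_S]. }
      apply is_lim_seq_plus'; apply is_lim_seq_mult'; try assumption; [apply is_lim_seq_const|].
      apply is_lim_seq_mult'; apply is_lim_seq_inv_INR_S.
Qed.

(** Both arctangents tend to pi/2, and the quotient inside the logarithm tends to 1. The resulting
    pi z / 2 cancels a term of the Mittag-Leffler sum in the limit of [em_error]. *)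
Lemma two_arctan_lim z : 0 < Re z -> Clim (fun n => two_arctan z (INR (S n))) (RtoC PI).
Proof.
  intros Hz. apply Clim_Re_Im; cbn [Re Im fst snd RtoC two_arctan].
  - replace (Finite PI) with (Finite (PI / 2 + PI / 2)) by (f_equal; field).
    apply is_lim_seq_plus'; [now apply atan_affine_lim|].
    apply (is_lim_seq_ext (fun n => atan ((INR (S n) + - Im z) / Re z))); [reflexivity|].
    now apply atan_affine_lim.
  - assert (H1 := ln_ratio_lim (Re z) (- Im z) Hz). assert (H2 := ln_ratio_lim (Re z) (Im z) Hz).
    assert (H3 := is_lim_seq_minus' _ _ _ _ H1 H2).
    assert (H4 := is_lim_seq_mult' _ _ _ _ H3 (is_lim_seq_const (/ 2))).
    replace ((0 - 0) * / 2)%R with 0%R in H4 by ring.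
    eapply is_lim_seq_ext; [|exact H4]. intros n. cbv beta. unfold Rminus at 5, Rdiv. ring.
Qed.

Lemma Csums_of_ex f g : (forall n, Cmod (f n) <= g n) -> ex_series g -> Csums f (CSeries f).
Proof.
  intros H Hg. destruct (Csums_dominated f g H Hg) as [l Hl]. now rewrite (CSeries_unique _ _ Hl).
Qed.

Definition Qcorr (z : C) (x : R) : C := csum (fun i => beta i * Qder z i x) 3.

Lemma Qcorr_eq z x : Qcorr z x = Qder z 0 x - / RtoC 2 * Qder z 1 x + / RtoC 12 * Qder z 2 x.
Proof.
  unfold Qcorr. cbn [csum]. rewrite beta_2. change (beta 0) with (RtoC 1).
  change (beta 1) with (- / RtoC 2). ring.
Qed.

(** At the pole parameter of d this is, up to the factor 2/y, the Lambert summand d^N/(e^{d^N y} -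
    1); at [root N l * gam * RtoC u] it is a multiple of a right-hand summand. *)
Definition planck (z : C) : C := RtoC PI * z / (Cexp (RtoC (2 * PI) * z) - RtoC 1).

(** The sum minus its Euler-Maclaurin main terms has the limit -[planck z]; adding [planck z] makes
    this a defect that tends to 0. *)
Definition em_error (z : C) (n : nat) : C :=
  csum (fun k => Qder z 1 (INR (S k))) n - Qcorr z (INR (S n)) + planck z.

Lemma Qder_1_eq z x : 0 < Re z ->
  Qder z 1 x = RtoC 1 - z * z / (z * z + RtoC x * RtoC x).
Proof.
  intros Hz. assert (H := sq_sum_neq_0 z x Hz). simpl. unfold recip_sq.
  assert (H' : z * z + RtoC x * RtoC x <> RtoC 0) by (rewrite Cplus_comm; exact H).
  field. auto.
Qed.

Lemma Clim_0_le (u : nat -> C) (e : nat -> R) :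
  (forall n, Cmod (u n) <= e n) -> is_lim_seq e 0 -> Clim u (RtoC 0).
Proof.
  intros H He. apply (Clim_le _ _ e); [|exact He].
  intros n. replace (u n - RtoC 0) with (u n) by ring. apply H.
Qed.

(** Since the summand is 1 - z^2/(z^2 + x^2), the sum is n minus a partial sum of the Mittag-Leffler
    series. The growth n cancels against the primitive at n + 1, while the summand and its
    derivative tend to 1 and 0. *)
Lemma em_error_lim z : 0 < Re z -> Clim (em_error z) (RtoC 0).
Proof.
  intros Hz.
  destruct (Qder_bounds z Hz) as [B [HB0 HB]].
  assert (Hb : forall n, let x := INR (S n) in
    Cmod (RtoC 1 - Qder z 1 x) <= Cmod (z * z) * B * / x /\ Cmod (Qder z 2 x) <= B * / x).
  { intros n x. assert (Hx : 1 <= x) by apply INR_S_ge_1.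
    destruct (HB 1%R x ltac:(lra) ltac:(lra)) as [H1 [H2 _]].
    replace (z * RtoC 1) with z in H1, H2 by ring.
    assert (Hx2 : 0 < x ^ 2) by (apply pow_lt; lra).
    assert (Hi : / (x ^ 2 + 1 ^ 2) <= / x * / x).
    { rewrite <- Rinv_mult. apply Rinv_le_contravar; nra. }
    assert (Hx0 : 0 < / x) by (apply Rinv_0_lt_compat; lra).
    assert (Hx1 : / x <= 1) by (rewrite <- Rinv_1; apply Rinv_le_contravar; lra).
    assert (Hxx : (x * / x = 1)%R) by (field; lra).
    split.
    - assert (E : RtoC 1 - Qder z 1 x = z * z * (RtoC (/ x * / x) * Qder z 1 x)).
      { rewrite Qder_1_eq by exact Hz.
        assert (Hn : z * z + RtoC x * RtoC x <> RtoC 0) by now apply sq_plus_sq_neq_0.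
        rewrite RtoC_mult, RtoC_inv by lra. field. split; [exact Hn|apply RtoC_neq_0; lra]. }
      rewrite E, Cmod_mult, (Cmod_mult (RtoC _)), Cmod_R, Rabs_pos_eq by nra.
      assert (H3 : Cmod (Qder z 1 x) <= B).
      { eapply Rle_trans; [exact H1|].
        assert (x ^ 2 * / (x ^ 2 + 1 ^ 2) <= 1).
        { apply (Rmult_le_reg_r (x ^ 2 + 1 ^ 2)); [lra|]. field_simplify; lra. }
        nra. }
      rewrite (Rmult_assoc (Cmod (z * z)) B). apply Rmult_le_compat_l; [apply Cmod_ge_0|].
      assert (H4 := Cmod_ge_0 (Qder z 1 x)).
      assert (/ x * / x * Cmod (Qder z 1 x) <= / x * B); [|lra].
      apply Rmult_le_compat; nra.
    - eapply Rle_trans; [exact H2|]. apply Rmult_le_compat_l; [exact HB0|].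
      assert (x * / (x ^ 2 + 1 ^ 2) <= x * (/ x * / x)) by nra.
      replace (x * (/ x * / x))%R with (/ x)%R in H by (field; lra). lra. }
  assert (L1 : Clim (fun n => RtoC 1 - Qder z 1 (INR (S n))) (RtoC 0)).
  { apply (Clim_0_le _ (fun n => Cmod (z * z) * B * / INR (S n))%R).
    - intros n. apply Hb.
    - apply is_lim_seq_scal0, is_lim_seq_inv_INR_S. }
  assert (L2 : Clim (fun n => Qder z 2 (INR (S n))) (RtoC 0)).
  { apply (Clim_0_le _ (fun n => B * / INR (S n))%R).
    - intros n. apply Hb.
    - apply is_lim_seq_scal0, is_lim_seq_inv_INR_S. }
  assert (L3 := two_arctan_lim z Hz).
  assert (L4 := mittag_leffler z Hz).
  set (ml := RtoC PI * z * (/ (Cexp (RtoC (2 * PI) * z) - RtoC 1) + / RtoC 2) - / RtoC 2) in L4.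
  apply (Clim_ext (fun n => - / RtoC 2 - csum (fun k => z * z / (z * z + RtoC (INR (S k)) * RtoC (INR (S k)))) n
    + z / RtoC 2 * two_arctan z (INR (S n)) - / RtoC 2 * (RtoC 1 - Qder z 1 (INR (S n)))
    - / RtoC 12 * Qder z 2 (INR (S n)) + planck z)).
  - intros n. unfold em_error. rewrite Qcorr_eq.
    rewrite (csum_ext (fun k => Qder z 1 (INR (S k))) (fun k => RtoC 1 -
       z * z / (z * z + RtoC (INR (S k)) * RtoC (INR (S k)))))
      by (intros; now apply Qder_1_eq).
    rewrite csum_minus, csum_const. change (Qder z 0 (INR (S n))) with
      (RtoC (INR (S n)) - z / RtoC 2 * two_arctan z (INR (S n))).
    rewrite (S_INR n), RtoC_plus. field.
  - replace (RtoC 0) with (- / RtoC 2 - ml + z / RtoC 2 * RtoC PI - / RtoC 2 * RtoC 0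
      - / RtoC 12 * RtoC 0 + planck z).
    + apply Clim_plus; [|apply Clim_const]. apply Clim_minus; [|now apply Clim_scal].
      apply Clim_minus; [|now apply Clim_scal]. apply Clim_plus; [|now apply Clim_scal].
      apply Clim_minus; [apply Clim_const|exact L4].
    + unfold ml, planck. assert (He : Cexp (RtoC (2 * PI) * z) - RtoC 1 <> RtoC 0).
      { apply Cexp_neq_1. assert (H := PI_RGT_0). destruct z; simpl in *; nra. }
      field. exact He.
Qed.

(** Each increment in n is an Euler-Maclaurin step bounded through [Qder z 4]. Because the defect
    tends to 0, it is minus the sum of all later increments, and this sum is bounded uniformly in n
    by a multiple of r^(-3/2). *)
Lemma em_error_bound kap : 0 < Re kap -> exists C0, 0 <= C0 /\ forall r n, 1 <= r ->
  Cmod (em_error (kap * RtoC r) n) <= C0 * / (r * sqrt r).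
Proof.
  intros Hk. destruct (Qder_bounds kap Hk) as [B [HB0 HB]].
  set (b := rsum (fun i => Cmod (beta i)) 3).
  assert (Hb : 0 <= b) by (apply rsum_ge_0; intros; apply Cmod_ge_0).
  set (h := fun k => (/ (INR (S k) * sqrt (INR (S k))))%R).
  assert (Hh0 : forall k, 0 <= h k).
  { intros k. left. apply Rinv_0_lt_compat. assert (H := INR_S_ge_1 k).
    apply Rmult_lt_0_compat; [lra|apply sqrt_lt_R0; lra]. }
  set (SS := Series h).
  exists (B * b * SS)%R. split.
  { apply Rmult_le_pos; [now apply Rmult_le_pos|].
    apply (rsum_le_Series h 0 Hh0 ex_series_inv_three_halves). }
  intros r n Hr. set (z := kap * RtoC r).
  assert (Hz : 0 < Re z) by (unfold z; destruct kap; simpl in *; nra).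
  assert (Hstep : forall k, Cmod (em_error z (S k) - em_error z k) <= B * / (r * sqrt r) * b * h k).
  { intros k. assert (Hx := INR_S_ge_1 k).
    assert (E := euler_maclaurin_step beta beta_recursion (Qder z)
      (B * (h k * / (r * sqrt r))) (INR (S k)) 2).
    replace (em_error z (S k) - em_error z k) with (Qder z 1 (INR (S k)) -
      csum (fun i => beta i * (Qder z i (INR (S k) + 1)%R - Qder z i (INR (S k)))) 3).
    - eapply Rle_trans; [apply E|].
      + intros j t Hj Ht. now apply cderiv_Qder.
      + intros t Ht. assert (Ht0 : 0 < t) by lra. assert (Hr0 : 0 < r) by lra.
        destruct (HB r t Hr0 Ht0) as [_ [_ [_ H4]]]. fold z in H4.
        eapply Rle_trans; [exact H4|]. apply Rmult_le_compat_l; [exact HB0|].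
        eapply Rle_trans; [now apply three_halves_bound|].
        apply Rmult_le_compat_r.
        * left. apply Rinv_0_lt_compat, Rmult_lt_0_compat; [lra|apply sqrt_lt_R0; lra].
        * unfold h. apply Rinv_le_contravar.
          -- apply Rmult_lt_0_compat; [lra|apply sqrt_lt_R0; lra].
          -- apply Rmult_le_compat; [lra|apply sqrt_pos|lra|apply sqrt_le_1; lra].
      + unfold b. apply Req_le. ring.
    - unfold em_error, Qcorr. cbn [csum]. rewrite (S_INR (S k)). ring. }
  assert (Hdiff : forall m, Cmod (em_error z (n + m) - em_error z n) <= B * / (r * sqrt r) * b * SS).
  { intros m.
    assert (Et : em_error z (n + m) - em_error z n =
      csum (fun k => em_error z (S (n + k)) - em_error z (n + k)%nat) m).
    { rewrite (csum_ext _ (fun k => em_error z (n + S k)%nat - em_error z (n + k)%nat))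
        by (intros; now rewrite Nat.add_succ_r).
      rewrite (csum_telescope (fun k => em_error z (n + k)%nat)), Nat.add_0_r. reflexivity. }
    rewrite Et.
    eapply Rle_trans; [apply (Cmod_csum_le _ (fun k => B * / (r * sqrt r) * b * h (n + k)%nat)%R)|].
    - intros k _. apply Hstep.
    - rewrite rsum_scal. apply Rmult_le_compat_l.
      + apply Rmult_le_pos; [|exact Hb]. apply Rmult_le_pos; [exact HB0|].
        left. apply Rinv_0_lt_compat, Rmult_lt_0_compat; [lra|apply sqrt_lt_R0; lra].
      + eapply Rle_trans; [|apply (rsum_le_Series h (n + m) Hh0 ex_series_inv_three_halves)].
        assert (Hs : forall j, rsum h (n + j) = (rsum h n + rsum (fun k => h (n + k)%nat) j)%R).
        { induction j; [rewrite Nat.add_0_r; simpl; ring|].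
          rewrite Nat.add_succ_r. simpl. rewrite IHj. ring. }
        rewrite Hs. assert (H := rsum_ge_0 h n Hh0). lra. }
  assert (L : Clim (fun m => em_error z (m + n) - em_error z n) (RtoC 0 - em_error z n)).
  { apply Clim_minus; [apply Clim_incr_n; now apply em_error_lim|apply Clim_const]. }
  apply (Clim_Cmod_le _ _ (B * / (r * sqrt r) * b * SS)) in L.
  - replace (RtoC 0 - em_error z n) with (- em_error z n) in L by ring.
    rewrite Cmod_opp in L. lra.
  - intros m. rewrite Nat.add_comm. apply Hdiff.
Qed.

(** * Second-order increments *)

(* Unlike differentiability, this quadratic bound passes to sums of series term by term. *)
Definition quad_approx (F F' : R -> C) (a c : R) : Prop :=
  exists K, forall s t : R, a <= s -> s <= t -> t <= c ->
    Cmod (F t - F s - RtoC (t - s) * F' s) <= K * (t - s) ^ 2.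

(** Dividing the interval into n equal steps bounds the total increment by K (c - a)^2 / n for every
    n. *)
Lemma quad_const (F : R -> C) a c : a <= c ->
  quad_approx F (fun _ => RtoC 0) a c -> F c = F a.
Proof.
  intros Hac [K HK].
  assert (HK' : forall s t, a <= s -> s <= t -> t <= c -> Cmod (F t - F s) <= K * (t - s) ^ 2).
  { intros s t H1 H2 H3. specialize (HK s t H1 H2 H3).
    replace (F t - F s - RtoC (t - s) * RtoC 0) with (F t - F s) in HK by ring. exact HK. }
  assert (Hn : forall n, Cmod (F c - F a) <= K * (c - a) ^ 2 * / INR (S n)).
  { intros n. assert (Hx := INR_S_ge_1 n). set (h := ((c - a) / INR (S n))%R).
    assert (Hh : 0 <= h) by (apply Rdiv_le_0_compat; lra).
    assert (Hk : forall k, (k <= S n)%nat -> a + INR k * h <= c /\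
        Cmod (F (a + INR k * h)%R - F a) <= INR k * (K * h ^ 2)).
    { assert (Hend : (a + INR (S n) * h = c)%R) by (unfold h; field; lra).
      induction k; intros Hk.
      - simpl INR. rewrite !Rmult_0_l, Rplus_0_r. split; [exact Hac|].
        replace (F a - F a) with (RtoC 0) by ring. rewrite Cmod_0. lra.
      - destruct IHk as [IH1 IH2]; [lia|].
        assert (HkS : INR (S k) <= INR (S n)) by now apply le_INR.
        assert (Hle : a + INR (S k) * h <= c) by (rewrite <- Hend; nra).
        split; [exact Hle|]. rewrite S_INR in Hle |- *.
        assert (H0 := pos_INR k).
        eapply Rle_trans; [apply (Cmod_triangle3 _ (F (a + INR k * h)%R))|].
        assert (H := HK' (a + INR k * h)%R (a + (INR k + 1) * h)%R ltac:(nra) ltac:(nra) Hle).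
        replace (a + (INR k + 1) * h - (a + INR k * h))%R with h in H by ring. lra. }
    destruct (Hk (S n) (le_n _)) as [_ H].
    replace (a + INR (S n) * h)%R with c in H by (unfold h; field; lra).
    replace (INR (S n) * (K * h ^ 2))%R with (K * (c - a) ^ 2 * / INR (S n))%R in H
      by (unfold h; field; lra). exact H. }
  assert (L : Clim (fun _ => F c - F a) (RtoC 0)).
  { apply (Clim_0_le _ (fun n => K * (c - a) ^ 2 * / INR (S n))%R); [exact Hn|].
    apply is_lim_seq_scal0, is_lim_seq_inv_INR_S. }
  assert (E := Clim_unique _ _ _ L (Clim_const _)).
  replace (F c) with (F c - F a + F a) by ring. rewrite <- E. ring.
Qed.

Lemma quad_minus F F' G G' a c : quad_approx F F' a c -> quad_approx G G' a c ->
  quad_approx (fun t => F t - G t) (fun t => F' t - G' t) a c.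
Proof.
  intros [K HK] [L HL]. exists (K + L)%R. intros s t H1 H2 H3.
  specialize (HK s t H1 H2 H3). specialize (HL s t H1 H2 H3).
  replace (F t - G t - (F s - G s) - RtoC (t - s) * (F' s - G' s)) with
    ((F t - F s - RtoC (t - s) * F' s) + - (G t - G s - RtoC (t - s) * G' s)) by ring.
  eapply Rle_trans; [apply Cmod_triangle|]. rewrite Cmod_opp. lra.
Qed.

Lemma quad_scal x F F' a c : quad_approx F F' a c ->
  quad_approx (fun t => x * F t) (fun t => x * F' t) a c.
Proof.
  intros [K HK]. exists (Cmod x * K)%R. intros s t H1 H2 H3.
  specialize (HK s t H1 H2 H3).
  replace (x * F t - x * F s - RtoC (t - s) * (x * F' s)) with
    (x * (F t - F s - RtoC (t - s) * F' s)) by ring.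
  rewrite Cmod_mult. assert (H := Cmod_ge_0 x). nra.
Qed.

Lemma quad_csum (F F' : nat -> R -> C) a c n :
  (forall k, (k < n)%nat -> quad_approx (F k) (F' k) a c) ->
  quad_approx (fun t => csum (fun k => F k t) n) (fun t => csum (fun k => F' k t) n) a c.
Proof.
  induction n; intros H; simpl.
  - exists 0%R. intros s t _ _ _. replace (RtoC 0 - RtoC 0 - RtoC (t - s) * RtoC 0) with (RtoC 0) by ring.
    rewrite Cmod_0. lra.
  - destruct IHn as [K HK]; [auto with arith|]. destruct (H n (Nat.lt_succ_diag_r n)) as [L HL].
    exists (K + L)%R. intros s t H1 H2 H3.
    specialize (HK s t H1 H2 H3). specialize (HL s t H1 H2 H3).
    replace (csum (fun k => F k t) n + F n t - (csum (fun k => F k s) n + F n s)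
       - RtoC (t - s) * (csum (fun k => F' k s) n + F' n s)) with
      ((csum (fun k => F k t) n - csum (fun k => F k s) n - RtoC (t - s) * csum (fun k => F' k s) n)
        + (F n t - F n s - RtoC (t - s) * F' n s)) by ring.
    eapply Rle_trans; [apply Cmod_triangle|]. lra.
Qed.

Lemma quad_ext F G F' G' a c :
  (forall t, a <= t <= c -> F t = G t) -> (forall t, a <= t <= c -> F' t = G' t) ->
  quad_approx F F' a c -> quad_approx G G' a c.
Proof.
  intros H1 H2 [K HK]. exists K. intros s t Hs Hst Ht.
  rewrite <- !H1, <- H2 by lra. now apply HK.
Qed.

Lemma quad_bound (f f' f'' : R -> C) B a c :
  (forall t, a <= t <= c -> cderiv f t (f' t)) ->
  (forall t, a <= t <= c -> cderiv f' t (f'' t)) ->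
  (forall t, a <= t <= c -> Cmod (f'' t) <= B) ->
  forall s t : R, a <= s -> s <= t -> t <= c ->
    Cmod (f t - f s - RtoC (t - s) * f' s) <= B * (t - s) ^ 2.
Proof.
  intros H1 H2 HB s t Hs Hst Ht.
  assert (H := taylor_bound (fun k => match k with 0 => f | 1 => f' | _ => f'' end) B s 2 t Hst).
  replace (f t - f s - RtoC (t - s) * f' s) with
    (f t - csum (fun k => RtoC ((t - s) ^ k / INR (fact k)) *
       (match k with 0 => f | 1 => f' | _ => f'' end) s) 2).
  - eapply Rle_trans; [apply H|].
    + intros [|[|k]] r Hk Hr; try lia; [apply H1|apply H2]; lra.
    + intros r Hr. apply HB. lra.
    + assert (0 <= B) by (eapply Rle_trans; [apply Cmod_ge_0|apply (HB s); lra]).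
      apply Rmult_le_compat_l; [assumption|]. assert (Hsq := pow2_ge_0 (t - s)).
      simpl (INR (fact 2)). lra.
  - cbn [csum]. replace ((t - s) ^ 0 / INR (fact 0))%R with 1%R by (simpl; field).
    replace ((t - s) ^ 1 / INR (fact 1))%R with (t - s)%R by (simpl; field). ring.
Qed.

(** The second-order Taylor bounds of the terms are added for fixed s and t, so the constants [g d]
    simply sum up and no derivative of the sum has to be shown to exist. *)
Lemma quad_series (f f' f'' : nat -> R -> C) (F F' : R -> C) (g : nat -> R) a c :
  (forall d t, a <= t <= c -> cderiv (f d) t (f' d t)) ->
  (forall d t, a <= t <= c -> cderiv (f' d) t (f'' d t)) ->
  (forall d t, a <= t <= c -> Cmod (f'' d t) <= g d) -> ex_series g ->
  (forall t, a <= t <= c -> Csums (fun d => f d t) (F t)) ->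
  (forall t, a <= t <= c -> Csums (fun d => f' d t) (F' t)) ->
  quad_approx F F' a c.
Proof.
  intros H1 H2 Hg Hs HF HF'. exists (Series g). intros s t Has Hst Htc.
  assert (E : Csums (fun d => f d t - f d s - RtoC (t - s) * f' d s) (F t - F s - RtoC (t - s) * F' s)).
  { apply Csums_minus; [apply Csums_minus; apply HF; lra|]. apply Csums_scal, HF'. lra. }
  replace (Series g * (t - s) ^ 2)%R with (Series (fun d => g d * (t - s) ^ 2)%R)
    by (apply Series_scal_r).
  apply (Csums_bound _ _ _ (fun d => quad_bound (f d) (f' d) (f'' d) (g d) a c (H1 d) (H2 d) (Hg d)
    s t Has Hst Htc)); [now apply ex_series_mult_r|exact E].
Qed.

Lemma quad_pow n a c : 0 <= a -> quad_approx (fun t => RtoC (t ^ n))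
  (fun t => RtoC (INR n * t ^ pred n)) a c.
Proof.
  intros Ha. set (C0 := (Rabs c + 1)%R). assert (HC : 1 <= C0) by (unfold C0; assert (H := Rabs_pos c); lra).
  exists (INR n * (INR (pred n) * C0 ^ pred (pred n)))%R.
  apply (quad_bound _ _ (fun t => RtoC (INR n * (INR (pred n) * t ^ pred (pred n))))).
  - intros t _. apply cderiv_RtoC. evar_last.
    + apply (is_derive_pow (fun t => t) n t 1%R). auto_derive; auto.
    + ring.
  - intros t _. apply cderiv_RtoC. apply is_derive_scal. evar_last.
    + apply (is_derive_pow (fun t => t) (pred n) t 1%R). auto_derive; auto.
    + ring.
  - intros t Ht. rewrite Cmod_R, Rabs_pos_eq.
    + apply Rmult_le_compat_l; [apply pos_INR|]. apply Rmult_le_compat_l; [apply pos_INR|].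
      apply pow_incr. unfold C0. assert (H := Rle_abs c). lra.
    + apply Rmult_le_pos; [apply pos_INR|]. apply Rmult_le_pos; [apply pos_INR|apply pow_le; lra].
Qed.

(** * Exponential bounds and the incomplete gamma function *)

Lemma exp_minus_1_ge x n : 0 <= x -> x ^ S n / INR (fact (S n)) <= exp x - 1.
Proof.
  revert x. induction n; intros x Hx.
  - simpl. assert (H := exp_ineq1_le x). lra.
  - enough (exp 0 - (0 - 0) ^ S (S n) / INR (fact (S (S n))) <=
      exp x - (x - 0) ^ S (S n) / INR (fact (S (S n))))%R as H.
    { rewrite exp_0 in H. replace (0 - 0)%R with 0%R in H by ring. rewrite pow_i in H by lia.
      replace (x - 0)%R with x in H by ring. unfold Rdiv in H at 1. lra. }
    apply (nondecreasing_of_derive (fun t => exp t - (t - 0) ^ S (S n) / INR (fact (S (S n))))%R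
      (fun t => exp t - (t - 0) ^ S n / INR (fact (S n)))%R); [exact Hx| |].
    + intros t _. apply (is_derive_minus (V := R_NormedModule)).
      * apply is_derive_exp.
      * apply is_derive_taylor_term.
    + intros t Ht. replace (t - 0)%R with t by ring. specialize (IHn t (proj1 Ht)). lra.
Qed.

Lemma exp_ge_pow_fact x n : 0 <= x -> x ^ n / INR (fact n) <= exp x.
Proof.
  intros Hx. destruct n.
  - simpl. assert (H := exp_ineq1_le x). lra.
  - assert (H := exp_minus_1_ge x n Hx). lra.
Qed.

(* The incomplete gamma function Gamma(n+1, tau) / n!. *)
Definition inc_gamma (n : nat) (tau : C) : C :=
  csum (fun j => tau ^ j / RtoC (INR (fact j))) (S n) * Cexp (- tau).

Lemma cderiv_exp_line b u : cderiv (fun t => Cexp (- (b * RtoC t))) u (- b * Cexp (- (b * RtoC u))).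
Proof.
  apply (cderiv_Cexp (fun t => - (b * RtoC t))). apply cderiv_opp.
  eapply cderiv_eq; [apply cderiv_scal, cderiv_var|ring].
Qed.

Lemma cderiv_pow_line b u n :
  cderiv (fun t => (b * RtoC t) ^ n) u (RtoC (INR n) * b * (b * RtoC u) ^ pred n).
Proof.
  induction n.
  - simpl. eapply cderiv_eq; [apply cderiv_const|ring].
  - simpl pred. eapply cderiv_eq.
    + apply (cderiv_mult (fun t => b * RtoC t) (fun t => (b * RtoC t) ^ n)); [|exact IHn].
      apply cderiv_scal, cderiv_var.
    + rewrite S_INR, RtoC_plus. destruct n; simpl; ring.
Qed.

Lemma cderiv_inc_gamma n b u :
  cderiv (fun t => inc_gamma n (b * RtoC t)) u
    (- (b * ((b * RtoC u) ^ n / RtoC (INR (fact n))) * Cexp (- (b * RtoC u)))).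
Proof.
  induction n.
  - apply (cderiv_ext (fun t => Cexp (- (b * RtoC t)))).
    + intros t. unfold inc_gamma. simpl. field.
    + eapply cderiv_eq; [apply cderiv_exp_line|]. simpl. field.
  - apply (cderiv_ext (fun t => inc_gamma n (b * RtoC t) +
      / RtoC (INR (fact (S n))) * ((b * RtoC t) ^ S n * Cexp (- (b * RtoC t))))).
    + intros t. unfold inc_gamma. cbn [csum]. unfold Cdiv. ring.
    + eapply cderiv_eq.
      * apply cderiv_plus; [exact IHn|]. apply cderiv_scal.
        apply cderiv_mult; [apply cderiv_pow_line|apply cderiv_exp_line].
      * change (pred (S n)) with n. rewrite fact_simpl, mult_INR, RtoC_mult. cbn [Cpow].
        field. split; [apply RtoC_neq_0, INR_fact_neq_0|apply RtoC_neq_0, not_0_INR; lia].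
Qed.

(** A consequence of y^(j+i)/(j+i)! <= e^y for y = u Re b. The ratio |b|/Re b accounts for the angle
    of b, and the i additional powers of u yield decay at infinity. *)
Lemma inc_gamma_term_bound b u j i : 0 < Re b -> 0 <= u ->
  Cmod ((b * RtoC u) ^ j / RtoC (INR (fact j)) * Cexp (- (b * RtoC u))) * (u * Re b) ^ i
    <= (Cmod b / Re b) ^ j * (INR (fact (j + i)) / INR (fact j)).
Proof.
  intros Hb Hu. set (y := (u * Re b)%R). assert (Hy : 0 <= y) by (apply Rmult_le_pos; lra).
  rewrite Cmod_mult, Cmod_div, Cmod_pow, Cmod_mult, Cmod_Cexp, !Cmod_R by apply RtoC_neq_0, INR_fact_neq_0.
  rewrite (Rabs_pos_eq u), (Rabs_pos_eq (INR _)) by (lra || apply pos_INR).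
  replace (Re (- (b * RtoC u))) with (- y)%R by (unfold y; destruct b; simpl; ring).
  rewrite exp_Ropp. assert (He := exp_pos y). assert (H := exp_ge_pow_fact y (j + i) Hy).
  assert (Hf := INR_fact_lt_0 j). assert (Hf2 := INR_fact_lt_0 (j + i)).
  set (rho := (Cmod b / Re b)%R).
  assert (Hrho : 0 <= rho) by (apply Rdiv_le_0_compat; [apply Cmod_ge_0|exact Hb]).
  replace (Cmod b * u)%R with (rho * y)%R by (unfold rho, y; field; lra).
  rewrite Rpow_mult_distr.
  replace (rho ^ j * y ^ j / INR (fact j) * / exp y * y ^ i)%R with
    (rho ^ j * (y ^ (j + i) / INR (fact (j + i)) * / exp y * (INR (fact (j + i)) / INR (fact j))))%R
    by (rewrite pow_add; field; repeat split; lra).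
  apply Rmult_le_compat_l; [now apply pow_le|].
  replace (INR (fact (j + i)) / INR (fact j))%R with (1 * (INR (fact (j + i)) / INR (fact j)))%R at 2 by ring.
  apply Rmult_le_compat_r; [apply Rdiv_le_0_compat; lra|].
  apply (Rmult_le_reg_r (exp y)); [exact He|]. rewrite Rmult_assoc, Rinv_l by lra. lra.
Qed.

Lemma inc_gamma_bound n b : 0 < Re b -> exists B, 0 <= B /\ forall k u : R, 0 < k -> 0 <= u ->
  Cmod (inc_gamma n (RtoC k * b * RtoC u)) <= B /\
  Cmod (inc_gamma n (RtoC k * b * RtoC u)) * (k * u) <= B /\
  Cmod (inc_gamma n (RtoC k * b * RtoC u) - RtoC 1) <= B * (k * u).
Proof.
  intros Hb. set (rho := (Cmod b / Re b)%R).
  assert (Hrho : 0 <= rho) by (apply Rdiv_le_0_compat; [apply Cmod_ge_0|exact Hb]).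
  set (B1 := rsum (fun j => rho ^ j)%R (S n)).
  set (B2 := (/ Re b * rsum (fun j => rho ^ j * INR (S j)) (S n))%R).
  assert (HB1 : 0 <= B1) by (apply rsum_ge_0; intros; now apply pow_le).
  assert (HB2 : 0 <= B2).
  { apply Rmult_le_pos; [left; now apply Rinv_0_lt_compat|]. apply rsum_ge_0.
    intros j. apply Rmult_le_pos; [now apply pow_le|apply pos_INR]. }
  assert (Hmb := Cmod_ge_0 b). assert (Hrn : 0 <= rho ^ n) by now apply pow_le.
  assert (HB3 : 0 <= Cmod b * rho ^ n) by now apply Rmult_le_pos.
  exists (B1 + B2 + Cmod b * rho ^ n)%R. split; [lra|]. intros k u Hk Hu.
  assert (Hkb : 0 < Re (RtoC k * b)) by (destruct b; simpl in *; nra).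
  assert (Hr : (Cmod (RtoC k * b) / Re (RtoC k * b))%R = rho).
  { rewrite Cmod_mult, Cmod_R, Rabs_pos_eq by lra. unfold rho.
    replace (Re (RtoC k * b)) with (k * Re b)%R by (destruct b; simpl; ring). field. lra. }
  assert (Hexp : inc_gamma n (RtoC k * b * RtoC u) =
    csum (fun j => (RtoC k * b * RtoC u) ^ j / RtoC (INR (fact j)) * Cexp (- (RtoC k * b * RtoC u))) (S n)).
  { unfold inc_gamma. rewrite Cmult_comm, <- csum_scal. apply csum_ext. intros; ring. }
  assert (Hterm0 : forall v j, 0 <= v -> Cmod ((RtoC k * b * RtoC v) ^ j / RtoC (INR (fact j)) *
      Cexp (- (RtoC k * b * RtoC v))) <= rho ^ j).
  { intros v j Hv. assert (H := inc_gamma_term_bound (RtoC k * b) v j 0 Hkb Hv).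
    rewrite Hr, Nat.add_0_r, Rmult_1_r in H.
    replace (INR (fact j) / INR (fact j))%R with 1%R in H by (field; apply INR_fact_neq_0). lra. }
  repeat split.
  - apply Rle_trans with B1; [|lra]. rewrite Hexp. apply Cmod_csum_le. intros j _. now apply Hterm0.
  - apply Rle_trans with B2; [|lra]. rewrite Hexp.
    assert (Hku : 0 <= k * u) by (apply Rmult_le_pos; lra).
    eapply Rle_trans; [apply Rmult_le_compat_r; [exact Hku|apply Cmod_csum]|].
    rewrite Rmult_comm, <- rsum_scal. unfold B2. rewrite <- rsum_scal. apply rsum_le.
    intros j _. assert (H := inc_gamma_term_bound (RtoC k * b) u j 1 Hkb Hu).
    rewrite Hr, Nat.add_1_r, pow_1, fact_simpl, mult_INR in H.
    replace (INR (S j) * INR (fact j) / INR (fact j))%R with (INR (S j)) in H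
      by (field; apply INR_fact_neq_0).
    replace (Re (RtoC k * b)) with (k * Re b)%R in H by (destruct b; simpl; ring).
    set (T := Cmod ((RtoC k * b * RtoC u) ^ j / _ * _)) in *.
    apply (Rmult_le_reg_l (Re b)); [exact Hb|].
    replace (Re b * (/ Re b * (rho ^ j * INR (S j))))%R with (rho ^ j * INR (S j))%R by (field; lra).
    replace (Re b * (k * u * T))%R with (T * (u * (k * Re b)))%R by ring. exact H.
  - apply Rle_trans with (Cmod b * rho ^ n * (k * u))%R.
    2:{ assert (Hku : 0 <= k * u) by (apply Rmult_le_pos; lra). apply Rmult_le_compat_r; lra. }
    assert (H1 : inc_gamma n (RtoC k * b * RtoC 0) = RtoC 1).
    { unfold inc_gamma. rewrite csum_S_l, csum_zero.
      - replace (- (RtoC k * b * RtoC 0)) with (RtoC 0) by ring. rewrite Cexp_0. simpl. field.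
      - intros j _. simpl. unfold Cdiv. ring. }
    rewrite <- H1.
    replace (Cmod b * rho ^ n * (k * u))%R with (k * Cmod b * rho ^ n * (u - 0))%R by ring.
    apply (Cmod_diff_le_const (fun t => inc_gamma n (RtoC k * b * RtoC t)) (fun t =>
      (- (RtoC k * b * ((RtoC k * b * RtoC t) ^ n / RtoC (INR (fact n))) * Cexp (- (RtoC k * b * RtoC t)))))).
    + exact Hu.
    + intros t _. apply cderiv_inc_gamma.
    + intros t Ht. rewrite Cmod_opp, <- Cmult_assoc, Cmod_mult, Cmod_mult, Cmod_R, Rabs_pos_eq by lra.
      apply Rmult_le_compat_l; [apply Rmult_le_pos; lra|]. apply Hterm0. lra.
Qed.

(** * Partial fractions over the 2N-th roots of unity *)

(** The number e^{i pi (2j+b)/(2N)} with 2j + b = 2l - (N - 1), so that l = 0, ..., N - 1 covers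
    both parities of N at once. The arguments lie symmetrically between -pi/2 and pi/2. *)
Definition root (N l : nat) : C :=
  Cexp (Ci * RtoC (PI * (2 * INR l - (INR N - 1)) / (2 * INR N))).

(** As l varies, the squares run through the N-th roots of unity up to one common factor, which is
    what makes [unity_inverse_sum] applicable. *)
Lemma root_sq N l : (1 <= N)%nat ->
  root N l * root N l = - (unity N ^ l * Cexp (Ci * RtoC (PI / INR N))).
Proof.
  intros HN. assert (HN0 : INR N <> 0%R) by (apply not_0_INR; lia).
  unfold root. rewrite unity_pow, <- !Cexp_plus.
  replace (- Cexp (Ci * RtoC (2 * PI * INR l / INR N) + Ci * RtoC (PI / INR N))) with
    (Cexp (Ci * RtoC (- PI)) * Cexp (Ci * RtoC (2 * PI * INR l / INR N) + Ci * RtoC (PI / INR N))).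
  - rewrite <- Cexp_plus, <- !Cmult_plus_distr_l, <- !RtoC_plus. do 3 f_equal. field. exact HN0.
  - rewrite Cexp_Ci, cos_neg, sin_neg, cos_PI, sin_PI. 
    replace (((-1)%R, (- 0)%R) : C) with (- RtoC 1) by (apply C_ext; simpl; ring). ring.
Qed.

Lemma Cexp_PI_over_pow N : (1 <= N)%nat -> Cexp (Ci * RtoC (PI / INR N)) ^ N = - RtoC 1.
Proof.
  intros HN. assert (HN0 : INR N <> 0%R) by (apply not_0_INR; lia).
  rewrite <- Cexp_nat. replace (RtoC (INR N) * (Ci * RtoC (PI / INR N))) with (Ci * RtoC PI).
  - rewrite Cexp_Ci, cos_PI, sin_PI. apply C_ext; simpl; ring.
  - replace PI with (INR N * (PI / INR N))%R at 1 by (field; exact HN0). rewrite RtoC_mult. ring.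
Qed.

(* kap d^N is the pole parameter of the d-th summand; in the variable u with x = u^N the function
   x^2 / (x^2 + (kap d^N)^2) splits over the N-th roots. *)
Lemma partial_fractions N (kap gam : C) (u d : R) : (1 <= N)%nat -> 0 < Re kap ->
  kap * gam ^ N = RtoC 1 -> (forall l, (l < N)%nat -> 0 < Re (root N l * gam)) ->
  0 < u -> 0 < d ->
  csum (fun l => let a := root N l * gam * RtoC u in a * a / (a * a + RtoC d * RtoC d)) N
    = RtoC (INR N) * Qder (kap * RtoC (d ^ N)) 1 (u ^ N).
Proof.
  intros HN Hk Hkg Hroot Hu Hd.
  assert (Hd0 : RtoC d <> RtoC 0) by (apply RtoC_neq_0; lra).
  (* [q] is chosen so that q zeta^l = -a^2/d^2 for the l-th [a], and q^N = -x^2/z^2. The l-th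
     fraction is then 1 - 1/(1 - q zeta^l). *)
  set (Y := gam * RtoC u / RtoC d). set (q := Y * Y * Cexp (Ci * RtoC (PI / INR N))).
  assert (Hkap0 : kap <> RtoC 0) by (intros E; rewrite E in Hk; simpl in Hk; lra).
  assert (HdN : 0 < d ^ N) by now apply pow_lt. assert (HuN : 0 < u ^ N) by now apply pow_lt.
  assert (HdNC : RtoC (d ^ N) <> RtoC 0) by (apply RtoC_neq_0; lra).
  set (z := kap * RtoC (d ^ N)). set (x := RtoC (u ^ N)).
  assert (Hz : 0 < Re z) by (unfold z; destruct kap; simpl in *; nra).
  assert (Hz0 : z <> RtoC 0) by now apply Cmult_neq_0.
  assert (Hsum := sq_sum_neq_0 z (u ^ N) Hz). fold x in Hsum.
  assert (HY : Y ^ N = x / z).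
  { unfold Y, Cdiv, x, z. rewrite !Cpow_mult_l, Cpow_inv, !RtoC_pow by exact Hd0.
    rewrite RtoC_pow in HdNC.
    replace (gam ^ N) with (/ kap * (kap * gam ^ N)) by (field; exact Hkap0). rewrite Hkg.
    field. auto. }
  assert (Hq : q ^ N = - (x * x / (z * z))).
  { unfold q. rewrite !Cpow_mult_l, Cexp_PI_over_pow, HY by exact HN. field. exact Hz0. }
  assert (Hq1 : RtoC 1 - q ^ N = (x * x + z * z) / (z * z)) by (rewrite Hq; field; exact Hz0).
  assert (Hqn : RtoC 1 - q ^ N <> RtoC 0).
  { rewrite Hq1. intros E. apply Hsum.
    replace (x * x + z * z) with ((x * x + z * z) / (z * z) * (z * z)) by (field; exact Hz0).
    rewrite E. ring. }
  rewrite (csum_ext _ (fun l => RtoC 1 - / (RtoC 1 - q * unity N ^ l))).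
  - rewrite csum_minus, csum_const, unity_inverse_sum by (assumption || lia).
    rewrite Hq1. simpl Qder. fold x. unfold recip_sq. fold x. field. auto.
  - intros l Hl. cbv zeta. set (a := root N l * gam * RtoC u).
    assert (Ha : 0 < Re a).
    { specialize (Hroot l Hl). unfold a. destruct (root N l * gam). simpl in *. nra. }
    assert (Hn := sq_plus_sq_neq_0 a d Ha).
    assert (E : q * unity N ^ l = - (a * a / (RtoC d * RtoC d))).
    { unfold q, Y, a. replace (root N l * gam * RtoC u * (root N l * gam * RtoC u)) with
        (root N l * root N l * (gam * RtoC u * (gam * RtoC u))) by ring.
      rewrite root_sq by exact HN. field. exact Hd0. }
    rewrite E. field. repeat split; auto.
    replace (RtoC d * RtoC d - - (a * a)) with (a * a + RtoC d * RtoC d) by ring. exact Hn.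
Qed.

(** * The sum over d as a function of u = x^(1/N) *)

Definition b_root (N : nat) (gam : C) (l : nat) : C := RtoC (2 * PI) * (root N l * gam).

(** Coefficient of u in the sum over d. It collects the summands pi a / 2 of the Mittag-Leffler
    formula and will multiply zeta(-1/N). *)
Definition q_lin (N : nat) (gam : C) : C :=
  RtoC (PI / (2 * INR N)) * csum (fun l => root N l * gam) N.

Definition q_exp (N : nat) (gam : C) (u : R) : C :=
  / RtoC (INR N) * csum (fun l => planck (root N l * gam * RtoC u)) N.

Lemma Csums_Q N (kap gam : C) (u : R) : (1 <= N)%nat -> 0 < Re kap ->
  kap * gam ^ N = RtoC 1 -> (forall l, (l < N)%nat -> 0 < Re (root N l * gam)) -> 0 < u ->
  Csums (fun d => Qder (kap * RtoC (INR (S d) ^ N)) 1 (u ^ N))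
    (q_exp N gam u + q_lin N gam * RtoC u - / RtoC 2).
Proof.
  intros HN Hk Hkg Hroot Hu.
  assert (HN0 : RtoC (INR N) <> RtoC 0) by (apply RtoC_neq_0, not_0_INR; lia).
  assert (H := Csums_scal (/ RtoC (INR N)) _ _ (Csums_csum
    (fun l d => let a := root N l * gam * RtoC u in a * a / (a * a + RtoC (INR (S d)) * RtoC (INR (S d))))
    (fun l => let a := root N l * gam * RtoC u in
       RtoC PI * a * (/ (Cexp (RtoC (2 * PI) * a) - RtoC 1) + / RtoC 2) - / RtoC 2) N
    (fun l Hl => mittag_leffler (root N l * gam * RtoC u) ltac:(
       specialize (Hroot l Hl); destruct (root N l * gam); simpl in *; nra)))).
  cbv zeta in H.
  replace (q_exp N gam u + q_lin N gam * RtoC u - / RtoC 2) with (/ RtoC (INR N) *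
    csum (fun l => RtoC PI * (root N l * gam * RtoC u) *
       (/ (Cexp (RtoC (2 * PI) * (root N l * gam * RtoC u)) - RtoC 1) + / RtoC 2) - / RtoC 2) N).
  - eapply Csums_ext; [|exact H]. intros d. cbv beta.
    assert (Hd : 0 < INR (S d)) by (apply lt_0_INR; lia).
    assert (E := partial_fractions N kap gam u (INR (S d)) HN Hk Hkg Hroot Hu Hd).
    cbv zeta in E. rewrite E. field. exact HN0.
  - unfold q_exp, q_lin. rewrite csum_minus, csum_const.
    rewrite (csum_ext _ (fun l => planck (root N l * gam * RtoC u) +
      RtoC PI / RtoC 2 * RtoC u * (root N l * gam))).
    + rewrite csum_plus, csum_scal. unfold Rdiv. rewrite RtoC_mult, RtoC_inv, RtoC_mult.
      * field. exact HN0.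
      * apply Rmult_integral_contrapositive_currified; [lra|apply not_0_INR; lia].
    + intros l Hl. unfold planck, Cdiv. ring.
Qed.

(** Primitive in u of b (b u)^N e^{-(j+1) b u} that vanishes at infinity. Summed over j, it is minus
    the integral of t^N/(e^t - 1) along the ray from b u to infinity. *)
Definition E_term (N : nat) (b : C) (j : nat) (u : R) : C :=
  - (RtoC (INR (fact N)) / RtoC (INR (S j)) ^ S N * inc_gamma N (RtoC (INR (S j)) * b * RtoC u)).

Definition E_sum (N : nat) (b : C) (u : R) : C := CSeries (fun j => E_term N b j u).

Lemma Cmod_E_coef N j : (1 <= N)%nat ->
  Cmod (RtoC (INR (fact N)) / RtoC (INR (S j)) ^ S N) <= INR (fact N) * / INR (S j) ^ 2.
Proof.
  intros HN. assert (Hj := INR_S_ge_1 j).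
  assert (Hj0 : RtoC (INR (S j)) <> RtoC 0) by (apply RtoC_neq_0; lra).
  rewrite Cmod_div, Cmod_pow, !Cmod_R, !Rabs_pos_eq by (apply pos_INR || now apply Cpow_nz).
  apply Rmult_le_compat_l; [apply pos_INR|].
  apply Rinv_le_contravar; [apply pow_lt; lra|]. apply Rle_pow; [exact Hj|lia].
Qed.

Lemma E_term_bound N b : (1 <= N)%nat -> 0 < Re b -> exists B, 0 <= B /\ forall j u, 0 <= u ->
  Cmod (E_term N b j u) <= B * / INR (S j) ^ 2 /\
  Cmod (E_term N b j u) * u <= B /\
  Cmod (E_term N b j u + RtoC (INR (fact N)) / RtoC (INR (S j)) ^ S N) <= B * u.
Proof.
  intros HN Hb. destruct (inc_gamma_bound N b Hb) as [B [HB0 HB]].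
  assert (Hf := pos_INR (fact N)).
  exists (INR (fact N) * B)%R. split; [now apply Rmult_le_pos|]. intros j u Hu.
  assert (Hj := INR_S_ge_1 j). destruct (HB (INR (S j)) u ltac:(lra) Hu) as [H1 [H2 H3]].
  assert (Hc := Cmod_E_coef N j HN). unfold E_term.
  set (c := RtoC (INR (fact N)) / RtoC (INR (S j)) ^ S N) in *.
  set (G := inc_gamma N _) in *.
  assert (Hc0 := Cmod_ge_0 c). assert (HG0 := Cmod_ge_0 G).
  assert (Hi : 0 < / INR (S j) ^ 2) by (apply Rinv_0_lt_compat, pow_lt; lra).
  assert (Hi2 : / INR (S j) ^ 2 * INR (S j) <= 1).
  { replace (/ INR (S j) ^ 2 * INR (S j))%R with (/ INR (S j))%R by (field; lra).
    rewrite <- Rinv_1. apply Rinv_le_contravar; lra. }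
  assert (Hi3 : / INR (S j) ^ 2 <= 1) by nra.
  repeat split.
  - rewrite Cmod_opp, Cmod_mult.
    replace (INR (fact N) * B * / INR (S j) ^ 2)%R with (INR (fact N) * / INR (S j) ^ 2 * B)%R by ring.
    now apply Rmult_le_compat.
  - rewrite Cmod_opp, Cmod_mult. rewrite Rmult_assoc.
    apply Rmult_le_compat; [exact Hc0|now apply Rmult_le_pos| |].
    + eapply Rle_trans; [exact Hc|]. nra.
    + assert (0 <= Cmod G * u) by now apply Rmult_le_pos.
      replace (Cmod G * (INR (S j) * u))%R with (Cmod G * u * INR (S j))%R in H2 by ring. nra.
  - replace (- (c * G) + c) with (- (c * (G - RtoC 1))) by ring. rewrite Cmod_opp, Cmod_mult.
    assert (H4 : Cmod c * Cmod (G - RtoC 1) <= INR (fact N) * / INR (S j) ^ 2 * (B * (INR (S j) * u))).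
    { apply Rmult_le_compat; auto. apply Cmod_ge_0. }
    replace (INR (fact N) * / INR (S j) ^ 2 * (B * (INR (S j) * u)))%R with
      (INR (fact N) * B * u * (/ INR (S j) ^ 2 * INR (S j)))%R in H4 by ring.
    assert (0 <= INR (fact N) * B * u) by (repeat apply Rmult_le_pos; assumption). nra.
Qed.

Lemma Csums_E N b u : (1 <= N)%nat -> 0 < Re b -> 0 <= u ->
  Csums (fun j => E_term N b j u) (E_sum N b u).
Proof.
  intros HN Hb Hu. destruct (E_term_bound N b HN Hb) as [B [HB0 HB]].
  apply (Csums_of_ex _ (fun j => B * / INR (S j) ^ 2)%R).
  - intros j. now apply HB.
  - apply ex_series_mult_l, ex_series_inv_sq.
Qed.

Lemma E_sum_lim N b (u : nat -> R) (e : nat -> C) S0 : (1 <= N)%nat -> 0 < Re b ->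
  (forall n, 0 <= u n) -> (forall j, Clim (fun n => E_term N b j (u n)) (e j)) -> Csums e S0 ->
  Clim (fun n => E_sum N b (u n)) S0.
Proof.
  intros HN Hb Hu Hlim HS. destruct (E_term_bound N b HN Hb) as [B [HB0 HB]].
  apply (tannery_lim (fun n j => E_term N b j (u n)) e _ S0 (fun j => B * / INR (S j) ^ 2)%R).
  - intros n j. now apply HB.
  - apply ex_series_mult_l, ex_series_inv_sq.
  - exact Hlim.
  - intros n. now apply Csums_E.
  - exact HS.
Qed.

(** At u = 0 every incomplete gamma factor is 1, which leaves the sum of -N!/(j+1)^(N+1): this is
    where zeta(N+1) enters. *)
Lemma E_sum_lim_0 N b : (1 <= N)%nat -> 0 < Re b ->
  Clim (fun n => E_sum N b (/ INR (S n))) (- (RtoC (INR (fact N)) * RtoC (zeta_nat (S N)))).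
Proof.
  intros HN Hb. destruct (E_term_bound N b HN Hb) as [B [HB0 HB]].
  assert (Hu : forall n, 0 <= / INR (S n)) by (intros n; left; apply Rinv_0_lt_compat, lt_0_INR; lia).
  apply (E_sum_lim N b _ (fun j => - (RtoC (INR (fact N)) / RtoC (INR (S j)) ^ S N))); auto.
  - intros j. apply (Clim_le _ _ (fun n => B * / INR (S n))%R).
    + intros n. destruct (HB j _ (Hu n)) as [_ [_ H]].
      assert (E : forall p q : C, p - - q = p + q) by (intros; ring). rewrite E. exact H.
    + apply is_lim_seq_scal0, is_lim_seq_inv_INR_S.
  - assert (H := Csums_scal (- RtoC (INR (fact N))) _ _ (Csums_zeta_nat (S N) ltac:(lia))).
    replace (- (RtoC (INR (fact N)) * RtoC (zeta_nat (S N)))) with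
      (- RtoC (INR (fact N)) * RtoC (zeta_nat (S N))) by ring.
    eapply Csums_ext; [|exact H]. intros j. cbv beta.
    rewrite RtoC_inv, RtoC_pow by (apply pow_nonzero, not_0_INR; lia). unfold Cdiv. ring.
Qed.

Lemma E_sum_lim_infty N b (u : nat -> R) : (1 <= N)%nat -> 0 < Re b ->
  (forall n, 0 < u n) -> is_lim_seq (fun n => / u n)%R 0 -> Clim (fun n => E_sum N b (u n)) (RtoC 0).
Proof.
  intros HN Hb Hu Hlim. destruct (E_term_bound N b HN Hb) as [B [HB0 HB]].
  apply (E_sum_lim N b u (fun _ => RtoC 0)); auto.
  - intros n. left. apply Hu.
  - intros j. apply (Clim_0_le _ (fun n => B * / u n)%R); [|now apply is_lim_seq_scal0].
    intros n. specialize (Hu n). destruct (HB j (u n) ltac:(lra)) as [_ [H _]].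
    apply (Rmult_le_reg_r (u n)); [exact Hu|]. rewrite Rmult_assoc, Rinv_l; lra.
  - apply Csums_zero.
Qed.

Definition E_deriv (N : nat) (b : C) (u : R) : C :=
  b * (b * RtoC u) ^ N / (Cexp (b * RtoC u) - RtoC 1).

(** Expanding 1/(e^{bu} - 1) in powers of e^{-bu} identifies the slope; away from u = 0 the second
    derivatives of the terms are summable over j. *)
Lemma E_sum_quad N b a c : (1 <= N)%nat -> 0 < Re b -> 0 < a -> a <= c ->
  quad_approx (E_sum N b) (E_deriv N b) a c.
Proof.
  intros HN Hb Ha Hac.
  set (h := fun j u => Cexp (- (RtoC (INR (S j)) * b * RtoC u))).
  set (Cc := Cmod b). assert (HCc : 0 <= Cc) by apply Cmod_ge_0.
  set (y := (a * Re b)%R). assert (Hy : 0 < y) by now apply Rmult_lt_0_compat.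
  (* The bound e^(-k y) <= 6/(k y)^3 with k = j + 1 outweighs the factor k in the second derivative
     and leaves k^(-2). *)
  set (K := (Cc * (INR N * Cc * (Cc * c) ^ pred N + Cc * (Cc * c) ^ N) * (6 / y ^ 3))%R).
  apply (quad_series (fun j => E_term N b j)
    (fun j u => b * (b * RtoC u) ^ N * h j u)
    (fun j u => b * (RtoC (INR N) * b * (b * RtoC u) ^ pred N * h j u +
        (b * RtoC u) ^ N * (- (RtoC (INR (S j)) * b) * h j u)))
    _ _ (fun j => K * / INR (S j) ^ 2)%R).
  - intros j t Ht. assert (Hj0 : RtoC (INR (S j)) <> RtoC 0) by (apply RtoC_neq_0, not_0_INR; lia).
    eapply cderiv_eq.
    + unfold E_term. apply cderiv_opp, cderiv_scal, cderiv_inc_gamma.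
    + fold (h j t). rewrite (Cmult_comm (RtoC (INR (S j)))), <- !Cmult_assoc.
      rewrite (Cmult_comm (RtoC (INR (S j))) (RtoC t)), !Cmult_assoc, !Cpow_mult_l. cbn [Cpow].
      field. repeat split; auto; [apply RtoC_neq_0, INR_fact_neq_0|now apply Cpow_nz].
  - intros j t Ht. eapply cderiv_eq.
    + apply (cderiv_ext (fun u => b * ((b * RtoC u) ^ N * h j u))); [intros; ring|].
      apply cderiv_scal, cderiv_mult; [apply cderiv_pow_line|]. unfold h. apply cderiv_exp_line.
    + unfold h. ring.
  - intros j t Ht. assert (Hj := INR_S_ge_1 j). set (k := INR (S j)) in *.
    assert (Hh : Cmod (h j t) <= 6 / (k * y) ^ 3).
    { unfold h. rewrite Cmod_Cexp. fold k.
      replace (Re (- (RtoC k * b * RtoC t))) with (- (k * (t * Re b)))%R by (destruct b; simpl; ring).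
      assert (Hky : k * y <= k * (t * Re b)).
      { apply Rmult_le_compat_l; [lra|]. unfold y. apply Rmult_le_compat_r; lra. }
      apply Rle_trans with (exp (- (k * y))); [apply exp_le_exp; lra|].
      assert (Hky0 : 0 < k * y) by (apply Rmult_lt_0_compat; lra).
      assert (H3 := exp_ge_pow_fact (k * y) 3 ltac:(lra)).
      replace (INR (fact 3)) with 6%R in H3 by (simpl; ring).
      assert (Hp3 : 0 < (k * y) ^ 3) by now apply pow_lt.
      rewrite exp_Ropp. replace (6 / (k * y) ^ 3)%R with (/ ((k * y) ^ 3 / 6))%R by (field; lra).
      apply Rinv_le_contravar; [lra|exact H3]. }
    assert (Hbt : Cmod (b * RtoC t) <= Cc * c).
    { rewrite Cmod_mult, Cmod_R, Rabs_pos_eq by lra. apply Rmult_le_compat_l; [exact HCc|lra]. }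
    assert (Hbp : forall n, Cmod ((b * RtoC t) ^ n) <= (Cc * c) ^ n).
    { intros n. rewrite Cmod_pow. apply pow_incr. split; [apply Cmod_ge_0|exact Hbt]. }
    assert (Hcc : 0 <= Cc * c) by (apply Rmult_le_pos; lra).
    assert (HP1 : 0 <= (Cc * c) ^ pred N) by now apply pow_le.
    assert (HP2 : 0 <= (Cc * c) ^ N) by now apply pow_le.
    rewrite Cmod_mult. fold Cc.
    assert (Hsum : Cmod (RtoC (INR N) * b * (b * RtoC t) ^ pred N * h j t +
        (b * RtoC t) ^ N * (- (RtoC k * b) * h j t)) <=
        (INR N * Cc * (Cc * c) ^ pred N + Cc * (Cc * c) ^ N) * (k * (6 / (k * y) ^ 3))).
    { eapply Rle_trans; [apply Cmod_triangle|].
      rewrite !Cmod_mult, Cmod_opp, Cmod_mult, !Cmod_R, !Rabs_pos_eq by (apply pos_INR || lra).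
      fold Cc. assert (Hh0 := Cmod_ge_0 (h j t)).
      assert (HN0 := pos_INR N).
      assert (T1 : INR N * Cc * Cmod ((b * RtoC t) ^ pred N) * Cmod (h j t) <=
        INR N * Cc * (Cc * c) ^ pred N * (6 / (k * y) ^ 3)).
      { apply Rmult_le_compat; auto.
        - apply Rmult_le_pos; [now apply Rmult_le_pos|apply Cmod_ge_0].
        - apply Rmult_le_compat_l; [now apply Rmult_le_pos|apply Hbp]. }
      assert (T2 : Cmod ((b * RtoC t) ^ N) * (k * Cc * Cmod (h j t)) <=
        (Cc * c) ^ N * (k * Cc * (6 / (k * y) ^ 3))).
      { apply Rmult_le_compat; auto; [apply Cmod_ge_0| |].
        - apply Rmult_le_pos; [apply Rmult_le_pos; lra|exact Hh0].
        - apply Rmult_le_compat_l; [apply Rmult_le_pos; lra|exact Hh]. }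
      assert (T3 : 0 <= INR N * Cc * (Cc * c) ^ pred N * (6 / (k * y) ^ 3)).
      { eapply Rle_trans; [|exact T1]. repeat apply Rmult_le_pos; auto. apply Cmod_ge_0. }
      nra. }
    replace (K * / k ^ 2)%R with (Cc * ((INR N * Cc * (Cc * c) ^ pred N + Cc * (Cc * c) ^ N) *
      (k * (6 / (k * y) ^ 3))))%R by (unfold K; field; lra).
    now apply Rmult_le_compat_l.
  - apply ex_series_mult_l, ex_series_inv_sq.
  - intros t Ht. apply Csums_E; auto; lra.
  - intros t Ht. set (w := b * RtoC t).
    assert (Hw : 0 < Re w) by (unfold w; destruct b; simpl in *; nra).
    assert (He := Cexp_neq_1 w Hw). assert (He0 := Cexp_neq_0 w).
    assert (Hq : Cmod (Cexp (- w)) < 1).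
    { rewrite Cmod_Cexp, <- exp_0. apply exp_increasing. change (Re (- w)) with (- Re w)%R. lra. }
    assert (H := Csums_scal (b * w ^ N * Cexp (- w)) _ _ (Csums_geom _ Hq)).
    unfold E_deriv. fold w.
    replace (b * w ^ N / (Cexp w - RtoC 1)) with (b * w ^ N * Cexp (- w) * / (RtoC 1 - Cexp (- w))).
    + eapply Csums_ext; [|exact H]. intros j. cbv beta. unfold h.
      replace (- (RtoC (INR (S j)) * b * RtoC t)) with (RtoC (INR (S j)) * (- w)) by (unfold w; ring).
      rewrite Cexp_nat. cbn [Cpow]. ring.
    + rewrite Cexp_opp. field. repeat split; auto.
Qed.

(** * Integrating the sum over d *)

Lemma two_arctan_0 z : two_arctan z 0 = RtoC 0.
Proof.
  unfold two_arctan. rewrite Rplus_0_l, Rminus_0_l.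
  replace (- Im z / Re z)%R with (- (Im z / Re z))%R by (unfold Rdiv; ring).
  rewrite atan_opp. replace ((- Im z) ^ 2)%R with (Im z ^ 2)%R by ring.
  apply C_ext; simpl; unfold Rdiv; ring.
Qed.

(** For fixed x the decay r^(-2) is summable over d. The primitive vanishes at x = 0, so its bound
    follows from that of the summand by the mean value inequality. *)
Lemma Qder_simple_bounds kap : 0 < Re kap -> exists B, 0 <= B /\ forall r x : R, 0 < r -> 0 <= x ->
  Cmod (Qder (kap * RtoC r) 0 x) <= B * x ^ 3 * / r ^ 2 /\
  Cmod (Qder (kap * RtoC r) 1 x) <= B * x ^ 2 * / r ^ 2 /\
  Cmod (Qder (kap * RtoC r) 2 x) <= B * x * / r ^ 2.
Proof.
  intros Hk. destruct (Qder_bounds kap Hk) as [B [HB0 HB]].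
  exists B. split; [exact HB0|]. intros r x Hr Hx.
  assert (Hr2 : 0 < r ^ 2) by now apply pow_lt.
  assert (Hi : 0 < / r ^ 2) by now apply Rinv_0_lt_compat.
  assert (H12 : forall t, 0 <= t -> Cmod (Qder (kap * RtoC r) 1 t) <= B * t ^ 2 * / r ^ 2 /\
     Cmod (Qder (kap * RtoC r) 2 t) <= B * t * / r ^ 2).
  { intros t Ht. destruct Ht as [Ht| <-].
    - destruct (HB r t Hr Ht) as [H1 [H2 _]].
      assert (Hle : / (t ^ 2 + r ^ 2) <= / r ^ 2).
      { apply Rinv_le_contravar; [exact Hr2|]. assert (H := pow2_ge_0 t). lra. }
      split; (eapply Rle_trans; [eassumption|]); rewrite Rmult_assoc;
        (apply Rmult_le_compat_l; [exact HB0|]); (apply Rmult_le_compat_l; [|exact Hle]).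
      + apply pow2_ge_0.
      + lra.
    - simpl. rewrite !Cmult_0_l, !Cmult_0_r, Cmod_0.
      split; right; ring. }
  split; [|now apply H12].
  assert (H0 : Qder (kap * RtoC r) 0 0 = RtoC 0).
  { simpl. rewrite two_arctan_0. ring. }
  replace (Qder (kap * RtoC r) 0 x) with (Qder (kap * RtoC r) 0 x - Qder (kap * RtoC r) 0 0)
    by (rewrite H0; ring).
  replace (B * x ^ 3 * / r ^ 2)%R with (B * x ^ 2 * / r ^ 2 * (x - 0))%R by ring.
  assert (Hz : 0 < Re (kap * RtoC r)) by (destruct kap; simpl in *; nra).
  apply (Cmod_diff_le_const _ (Qder (kap * RtoC r) 1)); [exact Hx| |].
  - intros t _. apply cderiv_Qder; [exact Hz|lia].
  - intros t Ht. destruct (H12 t ltac:(lra)) as [H1 _]. eapply Rle_trans; [exact H1|].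
    apply Rmult_le_compat_r; [lra|]. apply Rmult_le_compat_l; [exact HB0|]. apply pow_incr. lra.
Qed.

Lemma INR_S_pow_ge N d : (1 <= N)%nat -> INR (S d) <= INR (S d) ^ N.
Proof.
  intros HN. assert (H := INR_S_ge_1 d). rewrite <- (pow_1 (INR (S d))) at 1. now apply Rle_pow.
Qed.

Lemma inv_pow_sq_le N d : (1 <= N)%nat -> / (INR (S d) ^ N) ^ 2 <= / INR (S d) ^ 2.
Proof.
  intros HN. assert (H := INR_S_ge_1 d). assert (H1 := INR_S_pow_ge N d HN).
  apply Rinv_le_contravar; [apply pow_lt; lra|]. apply pow_incr. lra.
Qed.

Definition pole (N : nat) (kap : C) (d : nat) : C := kap * RtoC (INR (S d) ^ N).

Lemma Re_pole N kap d : 0 < Re kap -> 0 < Re (pole N kap d).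
Proof.
  intros Hk. assert (H := pow_lt (INR (S d)) N (lt_0_INR (S d) (Nat.lt_0_succ d))).
  unfold pole. destruct kap; simpl in *. nra.
Qed.

Lemma Csums_Qder N kap k x : (1 <= N)%nat -> 0 < Re kap -> 0 <= x -> (k <= 2)%nat ->
  Csums (fun d => Qder (pole N kap d) k x) (CSeries (fun d => Qder (pole N kap d) k x)).
Proof.
  intros HN Hk Hx Hk2. destruct (Qder_simple_bounds kap Hk) as [B [HB0 HB]].
  assert (Hd : forall A d, 0 <= A -> A * / (INR (S d) ^ N) ^ 2 <= A * / INR (S d) ^ 2).
  { intros A d HA. apply Rmult_le_compat_l; [exact HA|now apply inv_pow_sq_le]. }
  assert (Hr : forall d, 0 < INR (S d) ^ N) by (intros d; apply pow_lt, lt_0_INR; lia).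
  assert (Hx2 : forall n, 0 <= B * x ^ n) by (intros n; apply Rmult_le_pos; [lra|now apply pow_le]).
  destruct k as [|[|[|k]]]; try lia.
  - apply (Csums_of_ex _ (fun d => B * x ^ 3 * / INR (S d) ^ 2)%R);
      [|apply ex_series_mult_l, ex_series_inv_sq].
    intros d. eapply Rle_trans; [apply (HB _ x (Hr d) Hx)|apply Hd, Hx2].
  - apply (Csums_of_ex _ (fun d => B * x ^ 2 * / INR (S d) ^ 2)%R);
      [|apply ex_series_mult_l, ex_series_inv_sq].
    intros d. eapply Rle_trans; [apply (HB _ x (Hr d) Hx)|apply Hd, Hx2].
  - apply (Csums_of_ex _ (fun d => B * x * / INR (S d) ^ 2)%R);
      [|apply ex_series_mult_l, ex_series_inv_sq].
    intros d. eapply Rle_trans; [apply (HB _ x (Hr d) Hx)|apply Hd].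
    specialize (Hx2 1%nat). simpl in Hx2. lra.
Qed.

Definition G_sum (N : nat) (kap : C) (x : R) : C := CSeries (fun d => Qder (pole N kap d) 0 x).

Definition q_val (N : nat) (gam : C) (u : R) : C :=
  q_exp N gam u + q_lin N gam * RtoC u - / RtoC 2.

Lemma cderiv_pow_comp f l n u : cderiv f (u ^ n)%R l ->
  cderiv (fun t => f (t ^ n)%R) u (RtoC (INR n * u ^ pred n) * l).
Proof.
  intros H. apply (cderiv_comp f (fun t => (t ^ n)%R)); [exact H|].
  evar_last; [apply (is_derive_pow (fun t => t) n u 1%R); auto_derive; auto|ring].
Qed.

(** The closed form [q_val] of the sum over d is an elementary function of u with x = u^N, so the
    primitive is followed in u and the chain rule supplies the factor N u^(N-1). *)
Lemma G_sum_quad N kap gam a c : (1 <= N)%nat -> 0 < Re kap ->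
  kap * gam ^ N = RtoC 1 -> (forall l, (l < N)%nat -> 0 < Re (root N l * gam)) ->
  0 < a -> a <= c ->
  quad_approx (fun u => G_sum N kap (u ^ N)%R)
    (fun u => RtoC (INR N * u ^ pred N) * q_val N gam u) a c.
Proof.
  intros HN Hk Hkg Hroot Ha Hac.
  destruct (Qder_simple_bounds kap Hk) as [B [HB0 HB]].
  set (X := ((c + 1) ^ N)%R).
  assert (HX : forall t j, a <= t <= c -> (j <= N)%nat -> 0 <= t ^ j <= X).
  { intros t j Ht Hj. split; [apply pow_le; lra|]. apply Rle_trans with ((c + 1) ^ j)%R.
    - apply pow_incr. lra.
    - apply Rle_pow; [lra|exact Hj]. }
  assert (HX0 : 0 <= X) by (apply pow_le; lra).
  assert (HN0 := pos_INR N). assert (HN1 := pos_INR (pred N)).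
  assert (HNp : INR (pred N) <= INR N) by (apply le_INR; lia).
  apply (quad_series (fun d u => Qder (pole N kap d) 0 (u ^ N)%R)
    (fun d u => RtoC (INR N * u ^ pred N) * Qder (pole N kap d) 1 (u ^ N)%R)
    (fun d u => RtoC (INR N * (INR (pred N) * u ^ pred (pred N))) * Qder (pole N kap d) 1 (u ^ N)%R +
      RtoC (INR N * u ^ pred N) * (RtoC (INR N * u ^ pred N) * Qder (pole N kap d) 2 (u ^ N)%R))
    _ _ (fun d => 2 * (INR N * INR N * B * X ^ 3) * / INR (S d) ^ 2)%R).
  - intros d t Ht. apply (cderiv_pow_comp (Qder (pole N kap d) 0) (Qder (pole N kap d) 1 (t ^ N)%R) N t).
    apply cderiv_Qder; [now apply Re_pole|lia].
  - intros d t Ht. apply (cderiv_mult (fun u => RtoC (INR N * u ^ pred N))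
      (fun u => Qder (pole N kap d) 1 (u ^ N)%R)).
    + apply cderiv_RtoC, is_derive_scal.
      evar_last; [apply (is_derive_pow (fun t => t) (pred N) t 1%R); auto_derive; auto|ring].
    + apply (cderiv_pow_comp (Qder (pole N kap d) 1) (Qder (pole N kap d) 2 (t ^ N)%R) N t).
      apply cderiv_Qder; [now apply Re_pole|lia].
  - intros d t Ht.
    destruct (HX t N Ht ltac:(lia)) as [Hx0 Hx1].
    destruct (HX t (pred N) Ht ltac:(lia)) as [Hp0 Hp1].
    destruct (HX t (pred (pred N)) Ht ltac:(lia)) as [Hpp0 Hpp1].
    set (x := (t ^ N)%R) in *. set (p1 := (t ^ pred N)%R) in *. set (p2 := (t ^ pred (pred N))%R) in *.
    assert (Hr : 0 < INR (S d) ^ N) by (apply pow_lt, lt_0_INR; lia).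
    destruct (HB _ x Hr Hx0) as [_ [H1 H2]]. fold (pole N kap d) in H1, H2.
    assert (Hi := inv_pow_sq_le N d HN). set (v := (/ INR (S d) ^ 2)%R) in *.
    assert (Hv : 0 < / (INR (S d) ^ N) ^ 2) by (apply Rinv_0_lt_compat, pow_lt, Hr).
    assert (H1' : Cmod (Qder (pole N kap d) 1 x) <= B * X ^ 2 * v).
    { eapply Rle_trans; [exact H1|]. apply Rmult_le_compat; try lra.
      - apply Rmult_le_pos; [lra|apply pow_le; lra].
      - apply Rmult_le_compat_l; [lra|apply pow_incr; lra]. }
    assert (H2' : Cmod (Qder (pole N kap d) 2 x) <= B * X * v).
    { eapply Rle_trans; [exact H2|]. apply Rmult_le_compat; try lra.
      - apply Rmult_le_pos; lra.
      - apply Rmult_le_compat_l; lra. }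
    eapply Rle_trans; [apply Cmod_triangle|].
    rewrite !Cmod_mult, !Cmod_R, !Rabs_pos_eq by (repeat apply Rmult_le_pos; lra).
    assert (Hc1 := Cmod_ge_0 (Qder (pole N kap d) 1 x)).
    assert (Hc2 := Cmod_ge_0 (Qder (pole N kap d) 2 x)).
    assert (T1 : INR N * (INR (pred N) * p2) * Cmod (Qder (pole N kap d) 1 x) <=
      INR N * (INR N * X) * (B * X ^ 2 * v)).
    { apply Rmult_le_compat; [repeat apply Rmult_le_pos; lra|exact Hc1| |exact H1'].
      apply Rmult_le_compat_l; [lra|]. apply Rmult_le_compat; lra. }
    assert (T2 : INR N * p1 * (INR N * p1 * Cmod (Qder (pole N kap d) 2 x)) <=
      INR N * X * (INR N * X * (B * X * v))).
    { assert (T3 : INR N * p1 <= INR N * X) by (apply Rmult_le_compat_l; lra).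
      assert (T4 : 0 <= INR N * p1) by (apply Rmult_le_pos; lra).
      apply Rmult_le_compat; [exact T4|now apply Rmult_le_pos|exact T3|].
      now apply Rmult_le_compat. }
    replace (2 * (INR N * INR N * B * X ^ 3) * v)%R with
      (INR N * (INR N * X) * (B * X ^ 2 * v) + INR N * X * (INR N * X * (B * X * v)))%R by ring.
    lra.
  - apply ex_series_mult_l, ex_series_inv_sq.
  - intros t Ht. apply Csums_Qder; [exact HN|exact Hk|apply (HX t N Ht); lia|lia].
  - intros t Ht. apply Csums_scal. apply Csums_Q; auto. lra.
Qed.

(** Primitive of N u^(N-1) [q_exp N gam u] that vanishes at infinity; [E_zero] is its limit as u
    tends to 0. *)
Definition E_hat (N : nat) (gam : C) (u : R) : C :=
  / RtoC 2 * csum (fun l => / b_root N gam l ^ N * E_sum N (b_root N gam l) u) N.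

Definition E_zero (N : nat) (gam : C) : C :=
  / RtoC 2 * csum (fun l => / b_root N gam l ^ N *
     - (RtoC (INR (fact N)) * RtoC (zeta_nat (S N)))) N.

Lemma Re_b_root N gam l : 0 < Re (root N l * gam) -> 0 < Re (b_root N gam l).
Proof.
  intros H. unfold b_root. assert (Hpi := PI_RGT_0). destruct (root N l * gam). simpl in *. nra.
Qed.

Lemma q_exp_E_deriv N gam u : (1 <= N)%nat ->
  (forall l, (l < N)%nat -> 0 < Re (root N l * gam)) -> 0 < u ->
  RtoC (INR N * u ^ pred N) * q_exp N gam u =
  / RtoC 2 * csum (fun l => / b_root N gam l ^ N * E_deriv N (b_root N gam l) u) N.
Proof.
  intros HN Hroot Hu. unfold q_exp. rewrite <- !csum_scal. apply csum_ext. intros l Hl.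
  assert (Hb := Re_b_root N gam l (Hroot l Hl)). unfold E_deriv, planck.
  assert (Eb : RtoC (2 * PI) * (root N l * gam * RtoC u) = b_root N gam l * RtoC u)
    by (unfold b_root; ring).
  rewrite Eb.
  assert (Hb0 : b_root N gam l <> RtoC 0) by (intros E; rewrite E in Hb; simpl in Hb; lra).
  assert (He : Cexp (b_root N gam l * RtoC u) - RtoC 1 <> RtoC 0).
  { apply Cexp_neq_1. destruct (b_root N gam l); simpl in *; nra. }
  assert (Ep : RtoC PI * (root N l * gam * RtoC u) = b_root N gam l * RtoC u / RtoC 2).
  { unfold b_root. rewrite RtoC_mult. field. }
  rewrite Ep. rewrite Cpow_mult_l.
  assert (HN0 : RtoC (INR N) <> RtoC 0) by (apply RtoC_neq_0, not_0_INR; lia).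
  assert (Eu : RtoC u ^ N = RtoC u * RtoC (u ^ pred N)).
  { destruct N; [lia|]. simpl. now rewrite RtoC_pow. }
  rewrite Eu, RtoC_mult. field. repeat split; auto. now apply Cpow_nz.
Qed.

Lemma Clim_pow_inv k : (1 <= k)%nat -> Clim (fun n => RtoC ((/ INR (S n)) ^ k)) (RtoC 0).
Proof.
  intros Hk. apply Clim_RtoC.
  apply (is_lim_seq_le_le (fun _ => 0%R) _ (fun n => / INR (S n))%R);
    [|apply is_lim_seq_const|apply is_lim_seq_inv_INR_S].
  intros n. assert (H := INR_S_ge_1 n).
  assert (H0 : 0 < / INR (S n)) by (apply Rinv_0_lt_compat; lra).
  assert (H1 : / INR (S n) <= 1) by (rewrite <- Rinv_1; apply Rinv_le_contravar; lra).
  set (x := (/ INR (S n))%R) in *.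
  split; [apply pow_le; lra|]. destruct k; [lia|]. simpl.
  assert (x ^ k <= 1) by (rewrite <- (pow1 k); apply pow_incr; lra).
  assert (0 <= x ^ k) by (apply pow_le; lra). nra.
Qed.

Lemma G_sum_lim_0 N kap : (1 <= N)%nat -> 0 < Re kap ->
  Clim (fun n => G_sum N kap ((/ INR (S n)) ^ N)%R) (RtoC 0).
Proof.
  intros HN Hk. destruct (Qder_simple_bounds kap Hk) as [B [HB0 HB]].
  apply (Clim_0_le _ (fun n => B * zeta_nat 2 * (/ INR (S n)) ^ (N * 3))%R).
  - intros n. set (x := ((/ INR (S n)) ^ N)%R).
    assert (Hx : 0 <= x) by (apply pow_le; left; apply Rinv_0_lt_compat, lt_0_INR; lia).
    replace (B * zeta_nat 2 * (/ INR (S n)) ^ (N * 3))%R with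
      (Series (fun d => B * x ^ 3 * / INR (S d) ^ 2)%R).
    + apply (Csums_bound (fun d => Qder (pole N kap d) 0 x)).
      * intros d. assert (Hr : 0 < INR (S d) ^ N) by (apply pow_lt, lt_0_INR; lia).
        eapply Rle_trans; [apply (HB _ x Hr Hx)|].
        apply Rmult_le_compat_l; [|now apply inv_pow_sq_le].
        apply Rmult_le_pos; [lra|now apply pow_le].
      * apply ex_series_mult_l, ex_series_inv_sq.
      * apply Csums_Qder; auto.
    + rewrite Series_scal_l. unfold zeta_nat, x. rewrite <- pow_mult. ring.
  - apply is_lim_seq_scal0.
    assert (H := Clim_Re _ _ (Clim_pow_inv (N * 3) ltac:(lia))). exact H.
Qed.

(** Both sides have slope N u^(N-1) [q_val N gam u] on every interval bounded away from 0, so they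
    differ by a constant. It is determined along u = 1/(n+1), where [G_sum] tends to 0 and [E_hat]
    to [E_zero]. *)
Lemma G_sum_formula N kap gam u : (1 <= N)%nat -> 0 < Re kap ->
  kap * gam ^ N = RtoC 1 -> (forall l, (l < N)%nat -> 0 < Re (root N l * gam)) -> 0 < u ->
  G_sum N kap (u ^ N)%R = q_lin N gam * (RtoC (INR N) / RtoC (INR (S N))) * RtoC (u ^ S N)
    - / RtoC 2 * RtoC (u ^ N) + E_hat N gam u - E_zero N gam.
Proof.
  intros HN Hk Hkg Hroot Hu.
  set (c1 := q_lin N gam * (RtoC (INR N) / RtoC (INR (S N)))).
  set (h := fun u : R => G_sum N kap (u ^ N)%R - (c1 * RtoC (u ^ S N) - / RtoC 2 * RtoC (u ^ N))
     - E_hat N gam u).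
  assert (HSN : RtoC (INR (S N)) <> RtoC 0) by (apply RtoC_neq_0, not_0_INR; lia).
  assert (Hconst : forall a c, 0 < a -> a <= c -> h c = h a).
  { intros a c Ha Hac. apply quad_const; [exact Hac|].
    assert (Q := quad_minus _ _ _ _ _ _ (quad_minus _ _ _ _ _ _
       (G_sum_quad N kap gam a c HN Hk Hkg Hroot Ha Hac)
       (quad_minus _ _ _ _ _ _ (quad_scal c1 _ _ _ _ (quad_pow (S N) a c ltac:(lra)))
          (quad_scal (/ RtoC 2) _ _ _ _ (quad_pow N a c ltac:(lra)))))
       (quad_scal (/ RtoC 2) _ _ _ _ (quad_csum
          (fun l u => / b_root N gam l ^ N * E_sum N (b_root N gam l) u)
          (fun l u => / b_root N gam l ^ N * E_deriv N (b_root N gam l) u) a c N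
          (fun l Hl => quad_scal _ _ _ _ _ (E_sum_quad N (b_root N gam l) a c HN
             (Re_b_root N gam l (Hroot l Hl)) Ha Hac))))).
    eapply quad_ext; [| |exact Q].
    - intros t Ht. reflexivity.
    - intros t Ht. cbv beta. rewrite <- (q_exp_E_deriv N gam t HN Hroot) by lra.
      unfold q_val, c1. change (pred (S N)) with N.
      assert (Et : RtoC (t ^ N) = RtoC t * RtoC (t ^ pred N)).
      { destruct N; [lia|]. simpl. now rewrite RtoC_mult. }
      rewrite !RtoC_mult, Et. field. exact HSN. }
  assert (L : Clim (fun n => h (/ INR (S n))%R) (- E_zero N gam)).
  { replace (- E_zero N gam) with (RtoC 0 - (c1 * RtoC 0 - / RtoC 2 * RtoC 0) - E_zero N gam) by ring.
    unfold h. apply Clim_minus; [apply Clim_minus|].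
    - now apply G_sum_lim_0.
    - apply Clim_minus; apply Clim_scal, Clim_pow_inv; lia.
    - unfold E_hat, E_zero. apply Clim_scal.
      apply (Clim_csum (fun n l => / b_root N gam l ^ N * E_sum N (b_root N gam l) (/ INR (S n)))
        (fun l => / b_root N gam l ^ N * - (RtoC (INR (fact N)) * RtoC (zeta_nat (S N))))).
      intros l Hl. apply Clim_scal, E_sum_lim_0; [exact HN|].
      now apply Re_b_root, Hroot. }
  assert (E : h u = - E_zero N gam).
  { apply (Clim_unique (fun _ => h u)); [apply Clim_const|].
    eapply Clim_ext; [|exact L]. intros n.
    assert (Hn : 0 < / INR (S n)) by (apply Rinv_0_lt_compat, lt_0_INR; lia).
    destruct (Rle_or_lt u (/ INR (S n))) as [H|H]; [now apply Hconst|].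
    symmetry. apply Hconst; lra. }
  unfold h in E.
  replace (G_sum N kap (u ^ N)) with (G_sum N kap (u ^ N) - (c1 * RtoC (u ^ S N) - / RtoC 2 * RtoC (u ^ N))
     - E_hat N gam u + (c1 * RtoC (u ^ S N) - / RtoC 2 * RtoC (u ^ N)) + E_hat N gam u) by ring.
  rewrite E. ring.
Qed.

(** * Interchange of the double sum *)

Definition nth_root (N n : nat) : R := exp (ln (INR (S n)) / INR N).

Lemma nth_root_pos N n : 0 < nth_root N n.
Proof. apply exp_pos. Qed.

Lemma exp_pow_nat x n : (exp x ^ n = exp (INR n * x))%R.
Proof.
  induction n; [simpl; now rewrite Rmult_0_l, exp_0|].
  rewrite S_INR. simpl. rewrite IHn, <- exp_plus. f_equal. ring.
Qed.

Lemma nth_root_pow N n : (1 <= N)%nat -> (nth_root N n ^ N = INR (S n))%R.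
Proof.
  intros HN. assert (H := INR_S_ge_1 n). assert (HN0 : INR N <> 0%R) by (apply not_0_INR; lia).
  unfold nth_root. rewrite exp_pow_nat. rewrite <- (exp_ln (INR (S n))) at 2 by lra. f_equal. field. exact HN0.
Qed.

Lemma rpow_nth_root N n : rpow (INR (S n)) (RtoC (1 / INR N)) = RtoC (nth_root N n).
Proof.
  unfold rpow, nth_root. rewrite <- RtoC_mult, Cexp_R. do 2 f_equal. unfold Rdiv. ring.
Qed.

Lemma nth_root_inv_lim N : (1 <= N)%nat -> is_lim_seq (fun n => / nth_root N n)%R 0.
Proof.
  intros HN. assert (HN0 : 0 < INR N) by (apply lt_0_INR; lia).
  assert (He : Re (RtoC (- (1 / INR N))) < 0).
  { simpl. assert (0 < 1 / INR N) by (apply Rdiv_lt_0_compat; lra). lra. }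
  assert (H := Clim_Cmod _ _ (rpow_lim_0 _ He)). rewrite Cmod_0 in H.
  eapply is_lim_seq_ext; [|exact H]. intros n. cbv beta.
  rewrite Cmod_rpow. unfold nth_root. rewrite <- exp_Ropp. f_equal. simpl. field. lra.
Qed.

(** At n = 0 the defect is [planck] minus [Qcorr] at 1. The defect and the three parts of [Qcorr]
    are summable over d, hence so is [planck]. *)
Lemma planck_summable N kap : (1 <= N)%nat -> 0 < Re kap ->
  Csums (fun d => planck (pole N kap d)) (CSeries (fun d => planck (pole N kap d))) /\
  forall n, Csums (fun d => em_error (pole N kap d) n)
    (CSeries (fun d => em_error (pole N kap d) n)).
Proof.
  intros HN Hk. destruct (em_error_bound kap Hk) as [C0 [HC0 HC]].
  assert (Hem : forall n, Csums (fun d => em_error (pole N kap d) n)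
    (CSeries (fun d => em_error (pole N kap d) n))).
  { intros n. apply (Csums_of_ex _ (fun d => C0 * / (INR (S d) * sqrt (INR (S d))))%R).
    - intros d. assert (H1 := INR_S_ge_1 d). assert (H2 := INR_S_pow_ge N d HN).
      eapply Rle_trans; [apply HC; lra|]. apply Rmult_le_compat_l; [exact HC0|].
      apply Rinv_le_contravar.
      + apply Rmult_lt_0_compat; [lra|apply sqrt_lt_R0; lra].
      + apply Rmult_le_compat; [lra|apply sqrt_pos|lra|apply sqrt_le_1; lra].
    - apply ex_series_mult_l, ex_series_inv_three_halves. }
  split; [|exact Hem].
  assert (H0 := Csums_Qder N kap 0 1 HN Hk ltac:(lra) ltac:(lia)).
  assert (H1 := Csums_Qder N kap 1 1 HN Hk ltac:(lra) ltac:(lia)).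
  assert (H2 := Csums_Qder N kap 2 1 HN Hk ltac:(lra) ltac:(lia)).
  assert (H := Csums_plus _ _ _ _ (Hem 0%nat) (Csums_plus _ _ _ _
    (Csums_minus _ _ _ _ H0 (Csums_scal (/ RtoC 2) _ _ H1)) (Csums_scal (/ RtoC 12) _ _ H2))).
  cbv beta in H. match type of H with Csums _ ?l => rewrite (CSeries_unique _ l); [|] end;
    (eapply Csums_ext; [|exact H]); intros d; unfold em_error; rewrite Qcorr_eq; change (INR 1) with 1%R; cbn [csum]; ring.
Qed.

(** For fixed n each constituent of the defect is summable over d on its own, so the sum may be
    taken constituent by constituent. *)
Lemma Csums_em_error N kap gam n : (1 <= N)%nat -> 0 < Re kap ->
  kap * gam ^ N = RtoC 1 -> (forall l, (l < N)%nat -> 0 < Re (root N l * gam)) ->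
  Csums (fun d => em_error (pole N kap d) n)
    (csum (fun k => q_val N gam (nth_root N k)) n
     - (G_sum N kap (INR (S n)) - / RtoC 2 * q_val N gam (nth_root N n)
        + / RtoC 12 * CSeries (fun d => Qder (pole N kap d) 2 (INR (S n))))
     + CSeries (fun d => planck (pole N kap d))).
Proof.
  intros HN Hk Hkg Hroot. assert (Hx : 0 <= INR (S n)) by apply pos_INR.
  assert (HQ : forall k, Csums (fun d => Qder (pole N kap d) 1 (INR (S k))) (q_val N gam (nth_root N k))).
  { intros k. rewrite <- (nth_root_pow N k HN). apply Csums_Q; auto. apply nth_root_pos. }
  assert (H0 := Csums_Qder N kap 0 _ HN Hk Hx ltac:(lia)).
  assert (H2 := Csums_Qder N kap 2 _ HN Hk Hx ltac:(lia)).
  assert (H := Csums_plus _ _ _ _ (Csums_minus _ _ _ _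
     (Csums_csum (fun k d => Qder (pole N kap d) 1 (INR (S k))) _ n (fun k _ => HQ k))
     (Csums_plus _ _ _ _ (Csums_minus _ _ _ _ H0 (Csums_scal (/ RtoC 2) _ _ (HQ n)))
        (Csums_scal (/ RtoC 12) _ _ H2))) (proj1 (planck_summable N kap HN Hk))).
  eapply Csums_ext; [|exact H]. intros d. unfold em_error. rewrite Qcorr_eq. reflexivity.
Qed.

(** The interchange of the two limits: for each d the defect tends to 0 in n, and a multiple of
    d^(-3/2) is a majorant independent of n. *)
Lemma Csums_em_error_lim N kap : (1 <= N)%nat -> 0 < Re kap ->
  Clim (fun n => CSeries (fun d => em_error (pole N kap d) n)) (RtoC 0).
Proof.
  intros HN Hk. destruct (em_error_bound kap Hk) as [C0 [HC0 HC]].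
  apply (tannery_lim (fun n d => em_error (pole N kap d) n) (fun _ => RtoC 0) _ _
    (fun d => C0 * / (INR (S d) * sqrt (INR (S d))))%R).
  - intros n d. assert (H1 := INR_S_ge_1 d). assert (H2 := INR_S_pow_ge N d HN).
    eapply Rle_trans; [apply HC; lra|]. apply Rmult_le_compat_l; [exact HC0|].
    apply Rinv_le_contravar.
    + apply Rmult_lt_0_compat; [lra|apply sqrt_lt_R0; lra].
    + apply Rmult_le_compat; [lra|apply sqrt_pos|lra|apply sqrt_le_1; lra].
  - apply ex_series_mult_l, ex_series_inv_three_halves.
  - intros d. now apply em_error_lim, Re_pole.
  - intros n. now apply planck_summable.
  - apply Csums_zero.
Qed.

(** Replaces the sum over d of the derivative at n + 1 by an increment of [q_val], for which a
    closed form is available. The difference is bounded through second derivatives by a multiple of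
    1/((n+1)^2 + (d+1)^2). *)
Lemma Qder_2_difference_lim N kap gam : (1 <= N)%nat -> 0 < Re kap ->
  kap * gam ^ N = RtoC 1 -> (forall l, (l < N)%nat -> 0 < Re (root N l * gam)) ->
  Clim (fun n => q_val N gam (nth_root N (S n)) - q_val N gam (nth_root N n)
     - CSeries (fun d => Qder (pole N kap d) 2 (INR (S n)))) (RtoC 0).
Proof.
  intros HN Hk Hkg Hroot. destruct (Qder_bounds kap Hk) as [B [HB0 HB]].
  assert (HQ : forall k, Csums (fun d => Qder (pole N kap d) 1 (INR (S k))) (q_val N gam (nth_root N k))).
  { intros k. rewrite <- (nth_root_pow N k HN). apply Csums_Q; auto. apply nth_root_pos. }
  assert (Hbd : forall n d, Cmod (Qder (pole N kap d) 1 (INR (S (S n))) - Qder (pole N kap d) 1 (INR (S n))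
      - Qder (pole N kap d) 2 (INR (S n))) <= B * / (INR (S n) ^ 2 + INR (S d) ^ 2)).
  { intros n d. assert (Hx := INR_S_ge_1 n). assert (Hd := INR_S_ge_1 d).
    assert (Hd2 := INR_S_pow_ge N d HN).
    assert (Hr : 0 < INR (S d) ^ N) by lra.
    assert (Hz := Re_pole N kap d Hk).
    assert (H := quad_bound (Qder (pole N kap d) 1) (Qder (pole N kap d) 2) (Qder (pole N kap d) 3)
      (B * / (INR (S n) ^ 2 + INR (S d) ^ 2)) (INR (S n)) (INR (S n) + 1)
      ltac:(intros; apply cderiv_Qder; [exact Hz|lia]) ltac:(intros; apply cderiv_Qder; [exact Hz|lia])).
    assert (Hb : forall t, INR (S n) <= t <= INR (S n) + 1 ->
      Cmod (Qder (pole N kap d) 3 t) <= B * / (INR (S n) ^ 2 + INR (S d) ^ 2)).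
    { intros t Ht. destruct (HB _ t Hr ltac:(lra)) as [_ [_ [H3 _]]].
      eapply Rle_trans; [exact H3|]. apply Rmult_le_compat_l; [exact HB0|].
      apply Rinv_le_contravar.
      - assert (0 < INR (S n) ^ 2) by (apply pow_lt; lra). assert (H4 := pow2_ge_0 (INR (S d))). lra.
      - apply Rplus_le_compat; apply pow_incr; lra. }
    specialize (H Hb (INR (S n)) (INR (S n) + 1)%R ltac:(lra) ltac:(lra) ltac:(lra)).
    replace (INR (S n) + 1 - INR (S n))%R with 1%R in H by ring.
    rewrite pow1, Rmult_1_r, Cmult_1_l in H. rewrite (S_INR (S n)). exact H. }
  apply (tannery_lim (fun n d => Qder (pole N kap d) 1 (INR (S (S n))) - Qder (pole N kap d) 1 (INR (S n))
      - Qder (pole N kap d) 2 (INR (S n))) (fun _ => RtoC 0) _ _ (fun d => B * / INR (S d) ^ 2)%R).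
  - intros n d. eapply Rle_trans; [apply Hbd|]. apply Rmult_le_compat_l; [exact HB0|].
    assert (Hd := INR_S_ge_1 d). assert (H := pow2_ge_0 (INR (S n))).
    assert (0 < INR (S d) ^ 2) by (apply pow_lt; lra). apply Rinv_le_contravar; lra.
  - apply ex_series_mult_l, ex_series_inv_sq.
  - intros d. apply (Clim_0_le _ (fun n => B * / INR (S n))%R).
    + intros n. eapply Rle_trans; [apply Hbd|]. apply Rmult_le_compat_l; [exact HB0|].
      assert (Hn := INR_S_ge_1 n). assert (H := pow2_ge_0 (INR (S d))).
      apply Rinv_le_contravar; nra.
    + apply is_lim_seq_scal0, is_lim_seq_inv_INR_S.
  - intros n. apply Csums_minus; [apply Csums_minus; apply HQ|].
    apply Csums_Qder; auto. apply pos_INR.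
  - apply Csums_zero.
Qed.

(** Euler-Maclaurin continuation with K = 2 at s = -1/N. The derivative of x^(1/N) is again replaced
    by an increment, so that the boundary terms match those of the sum over d exactly. *)
Lemma zeta_neg_inverse_lim N : (1 <= N)%nat ->
  Clim (fun n => csum (fun k => RtoC (nth_root N k)) n -
     (RtoC (INR N) / RtoC (INR (S N)) * RtoC (nth_root N n ^ S N) - / RtoC 2 * RtoC (nth_root N n)
      + / RtoC 12 * (RtoC (nth_root N (S n)) - RtoC (nth_root N n))))
    (zeta (RtoC (- (1 / INR N)))).
Proof.
  intros HN. assert (HN0 : 1 <= INR N) by (apply (le_INR 1); lia).
  set (a := (1 / INR N)%R).
  assert (Ha : 0 < a <= 1).
  { unfold a. split; [apply Rdiv_lt_0_compat; lra|]. apply Rle_div_l; lra. }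
  set (s := RtoC (- a)).
  assert (Hs : s <> RtoC 1) by (intros E; injection E; lra).
  assert (Es : - s = RtoC a) by (unfold s; rewrite RtoC_opp; ring).
  assert (HK : 1 - INR 2 <= - a) by (simpl; lra).
  assert (Ez : zeta s = zetaK 2 s) by (apply zeta_eq_zetaK; [lra|exact HK]).
  rewrite Ez. assert (L := zetaK_lim 2 s Hs HK).
  set (dd := fun n => RtoC (nth_root N (S n)) - RtoC (nth_root N n) - Dpow s 2 (INR (S n))).
  assert (Hdd : Clim dd (RtoC 0)).
  { apply (Clim_0_le _ (fun n => Cmod (falling (- s) 2) * / INR (S n))%R);
      [|apply is_lim_seq_scal0, is_lim_seq_inv_INR_S].
    intros n. assert (Hx := INR_S_ge_1 n).
    assert (H := quad_bound (Dpow s 1) (Dpow s 2) (Dpow s 3)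
      (Cmod (falling (- s) 2) * / INR (S n)) (INR (S n)) (INR (S n) + 1)
      ltac:(intros; apply cderiv_Dpow; [exact Hs|lra]) ltac:(intros; apply cderiv_Dpow; [exact Hs|lra])).
    assert (Hb : forall t, INR (S n) <= t <= INR (S n) + 1 ->
      Cmod (Dpow s 3 t) <= Cmod (falling (- s) 2) * / INR (S n)).
    { intros t Ht. change (Dpow s 3 t) with (falling (- s) 2 * rpow t (- s - RtoC (INR 2))).
      rewrite Cmod_mult. apply Rmult_le_compat_l; [apply Cmod_ge_0|].
      rewrite Cmod_rpow, Es.
      assert (Hln : 0 <= ln (INR (S n))) by (rewrite <- ln_1; apply ln_le; lra).
      assert (Hln2 : ln (INR (S n)) <= ln t) by (apply ln_le; lra).
      rewrite <- (exp_ln (/ INR (S n))) by (apply Rinv_0_lt_compat; lra). rewrite ln_Rinv by lra.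
      apply exp_le_exp. change (Re (RtoC a - RtoC (INR 2))) with (a + - INR 2)%R. simpl (INR 2). nra. }
    specialize (H Hb (INR (S n)) (INR (S n) + 1)%R ltac:(lra) ltac:(lra) ltac:(lra)).
    replace (INR (S n) + 1 - INR (S n))%R with 1%R in H by ring.
    rewrite pow1, Rmult_1_r, Cmult_1_l, <- (S_INR (S n)) in H.
    assert (E1 : forall k, Dpow s 1 (INR (S k)) = RtoC (nth_root N k)).
    { intros k. rewrite <- rpow_nth_root. fold a. rewrite <- Es. apply Dpow_1. }
    rewrite !E1 in H. exact H. }
  assert (L2 := Clim_minus _ _ _ _ L (Clim_scal (/ RtoC 12) _ _ Hdd)).
  replace (zetaK 2 s - / RtoC 12 * RtoC 0) with (zetaK 2 s) in L2 by ring.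
  eapply Clim_ext; [|exact L2]. intros n. cbv beta. unfold dd, zeta_corr. cbn [csum].
  rewrite (csum_ext (fun k => rpow (INR (S k)) (- s)) (fun k => RtoC (nth_root N k)))
    by (intros k _; rewrite Es; apply rpow_nth_root).
  rewrite beta_2. change (beta 0) with (RtoC 1). change (beta 1) with (- / RtoC 2).
  assert (Hx : 0 < INR (S n)) by (apply lt_0_INR; lia).
  assert (E0 : Dpow s 0 (INR (S n)) = RtoC (INR N) / RtoC (INR (S N)) * RtoC (nth_root N n ^ S N)).
  { change (Dpow s 0 (INR (S n))) with (rpow (INR (S n)) (RtoC 1 - s) / (RtoC 1 - s)).
    replace (RtoC 1 - s) with (RtoC 1 + - s) by ring.
    rewrite rpow_plus, rpow_1_r, Es by exact Hx. unfold a. rewrite rpow_nth_root.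
    assert (HN1 : RtoC (INR N) <> RtoC 0) by (apply RtoC_neq_0; lra).
    assert (HN2 : RtoC (INR (S N)) <> RtoC 0) by (apply RtoC_neq_0, not_0_INR; lia).
    assert (Ea : RtoC 1 + RtoC (1 / INR N) = RtoC (INR (S N)) / RtoC (INR N)).
    { rewrite S_INR. unfold Rdiv. rewrite Rmult_1_l, RtoC_inv, RtoC_plus by lra. field. exact HN1. }
    rewrite Ea. change (nth_root N n ^ S N)%R with (nth_root N n * nth_root N n ^ N)%R.
    rewrite RtoC_mult, nth_root_pow by exact HN. field. auto. }
  assert (E1 : Dpow s 1 (INR (S n)) = RtoC (nth_root N n)).
  { rewrite <- rpow_nth_root. fold a. rewrite <- Es. apply Dpow_1. }
  rewrite E0, E1. ring.
Qed.

(** In the summed defect, the terms in n^(1/N) form [q_lin] times the expression whose limit is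
    zeta(-1/N). The constant -1/2 of [q_val] contributes -n/2 + (n+1)/2 - 1/4 = 1/4, and the
    exponential parts vanish in the limit except for their sum [S2] and for [E_zero]. *)
Lemma planck_sum_identity N kap gam S2 : (1 <= N)%nat -> 0 < Re kap ->
  kap * gam ^ N = RtoC 1 -> (forall l, (l < N)%nat -> 0 < Re (root N l * gam)) ->
  Csums (fun n => q_exp N gam (nth_root N n)) S2 ->
  CSeries (fun d => planck (pole N kap d)) + S2
    = - / RtoC 4 - q_lin N gam * zeta (RtoC (- (1 / INR N))) - E_zero N gam.
Proof.
  intros HN Hk Hkg Hroot HS2.
  assert (L1 := Csums_em_error_lim N kap HN Hk).
  assert (L2 := Qder_2_difference_lim N kap gam HN Hk Hkg Hroot).
  assert (L3 := zeta_neg_inverse_lim N HN).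
  assert (L4 := Csums_terms _ _ HS2). assert (L5 := Clim_incr _ _ L4).
  assert (L6 : Clim (fun n => E_hat N gam (nth_root N n)) (RtoC 0)).
  { replace (RtoC 0) with (/ RtoC 2 * csum (fun l => / b_root N gam l ^ N * RtoC 0) N)
      by (rewrite csum_zero; [ring|intros; ring]).
    unfold E_hat. apply Clim_scal.
    apply (Clim_csum (fun n l => / b_root N gam l ^ N * E_sum N (b_root N gam l) (nth_root N n))
      (fun l => / b_root N gam l ^ N * RtoC 0)).
    intros l Hl. apply Clim_scal, E_sum_lim_infty; [exact HN|now apply Re_b_root, Hroot| |].
    - intros n. apply nth_root_pos.
    - now apply nth_root_inv_lim. }
  set (S1 := CSeries (fun d => planck (pole N kap d))) in *.
  set (A := q_lin N gam) in *. set (Z := zeta (RtoC (- (1 / INR N)))) in *.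
  assert (L : Clim (fun n => CSeries (fun d => em_error (pole N kap d) n))
    (S2 + A * Z + / RtoC 4 - RtoC 0 + E_zero N gam + / RtoC 2 * RtoC 0
      - / RtoC 12 * (RtoC 0 - RtoC 0) + / RtoC 12 * RtoC 0 + S1)).
  { eapply Clim_ext; [|apply (Clim_plus _ (fun _ => S1) _ _ (Clim_plus _ _ _ _ (Clim_minus _ _ _ _ (Clim_plus _ _ _ _
      (Clim_plus _ (fun _ => E_zero N gam) _ _ (Clim_minus _ _ _ _ (Clim_plus _ (fun _ => / RtoC 4) _ _ (Clim_plus _ _ _ _ HS2 (Clim_scal A _ _ L3))
        (Clim_const _)) L6) (Clim_const _)) (Clim_scal (/ RtoC 2) _ _ L4))
        (Clim_scal (/ RtoC 12) _ _ (Clim_minus _ _ _ _ L5 L4))) (Clim_scal (/ RtoC 12) _ _ L2)) (Clim_const _))].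
    intros n. cbv beta.
    rewrite (CSeries_unique _ _ (Csums_em_error N kap gam n HN Hk Hkg Hroot)).
    fold S1. assert (EG := G_sum_formula N kap gam (nth_root N n) HN Hk Hkg Hroot (nth_root_pos N n)).
    rewrite (nth_root_pow N n HN) in EG. fold A in EG. rewrite EG.
    rewrite (csum_ext (fun k => q_val N gam (nth_root N k)) (fun k => q_exp N gam (nth_root N k) +
       (A * RtoC (nth_root N k) - / RtoC 2))) by (intros; unfold q_val; fold A; ring).
    rewrite csum_plus, csum_minus, csum_scal, csum_const.
    unfold q_val. fold A. rewrite (S_INR n), RtoC_plus. field.
    apply RtoC_neq_0, not_0_INR. lia. }
  assert (E := Clim_unique _ _ _ L L1).
  replace (S1 + S2) with (S2 + A * Z + / RtoC 4 - RtoC 0 + E_zero N gam + / RtoC 2 * RtoC 0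
      - / RtoC 12 * (RtoC 0 - RtoC 0) + / RtoC 12 * RtoC 0 + S1 - / RtoC 4 - A * Z - E_zero N gam) by ring.
  rewrite E. ring.
Qed.

(** * Evaluation of the constants *)

(** A geometric sum of ratio e^{i pi/N}: multiplied by 2 i sin(pi/(2N)) it telescopes to e^{i pi/2}
    - e^{-i pi/2} = 2 i. *)
Lemma csum_root N : (1 <= N)%nat ->
  csum (root N) N * RtoC (sin (PI / (2 * INR N))) = RtoC 1.
Proof.
  intros HN. assert (HN0 : INR N <> 0%R) by (apply not_0_INR; lia).
  set (t := fun l => Cexp (Ci * RtoC (PI * (2 * INR l - INR N) / (2 * INR N)))).
  set (h := (PI / (2 * INR N))%R).
  assert (E : forall l, root N l * (RtoC 2 * Ci * RtoC (sin h)) = t (S l) - t l).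
  { intros l. replace (RtoC 2 * Ci * RtoC (sin h)) with (Cexp (Ci * RtoC h) - Cexp (Ci * RtoC (- h))).
    2:{ rewrite !Cexp_Ci, cos_neg, sin_neg. apply C_ext; simpl; ring. }
    unfold root, t. rewrite Cmult_comm. unfold Cminus at 1. rewrite Cmult_plus_distr_r.
    rewrite <- Cexp_plus.
    replace (- Cexp (Ci * RtoC (- h)) * Cexp (Ci * RtoC (PI * (2 * INR l - (INR N - 1)) / (2 * INR N)))) with
      (- (Cexp (Ci * RtoC (- h)) * Cexp (Ci * RtoC (PI * (2 * INR l - (INR N - 1)) / (2 * INR N))))) by ring.
    rewrite <- Cexp_plus, <- !Cmult_plus_distr_l, <- !RtoC_plus. unfold Cminus.
    rewrite (S_INR l). do 2 f_equal; [|f_equal]; do 2 f_equal; unfold h; field; exact HN0. }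
  assert (E2 : RtoC 2 * Ci * (csum (root N) N * RtoC (sin h)) = RtoC 2 * Ci).
  { replace (RtoC 2 * Ci * (csum (root N) N * RtoC (sin h))) with
      (RtoC 2 * Ci * RtoC (sin h) * csum (root N) N) by ring.
    rewrite <- csum_scal, (csum_ext _ (fun l => t (S l) - t l)) by (intros; rewrite <- E; ring).
    rewrite csum_telescope. unfold t.
    replace (PI * (2 * INR N - INR N) / (2 * INR N))%R with (PI / 2)%R by (field; exact HN0).
    replace (PI * (2 * INR 0 - INR N) / (2 * INR N))%R with (- (PI / 2))%R by (simpl; field; exact HN0).
    rewrite !Cexp_Ci, cos_neg, sin_neg, cos_PI2, sin_PI2. apply C_ext; simpl; ring. }
  assert (H2 : Ci <> RtoC 0) by (intros H; apply (f_equal Im) in H; simpl in H; lra).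
  replace (csum (root N) N * RtoC (sin h)) with
    (RtoC 2 * Ci * (csum (root N) N * RtoC (sin h)) / (RtoC 2 * Ci)) by (field; exact H2).
  rewrite E2. field. exact H2.
Qed.

(** The inverse N-th powers are i^(N-1) (-1)^l. Their alternating sum is 0 for even N, in accordance
    with the trivial zeros of zeta, and it reproduces the factor in [beta (S N)]. *)
Lemma csum_root_inv_pow N : (1 <= N)%nat ->
  - (RtoC 2 * csum (fun l => / root N l ^ N) N) = Ci ^ S N + (- Ci) ^ S N.
Proof.
  intros HN. destruct N as [|m]; [lia|].
  assert (HN0 : INR (S m) <> 0%R) by (apply not_0_INR; lia).
  assert (E : forall l, / root (S m) l ^ S m = Ci ^ m * (- RtoC 1) ^ l).
  { intros l. unfold root. rewrite <- Cexp_nat, <- Cexp_opp.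
    assert (H1 : Cexp (Ci * RtoC (PI / 2)) = Ci).
    { rewrite Cexp_Ci, cos_PI2, sin_PI2. reflexivity. }
    assert (H2 : Cexp (Ci * RtoC (- PI)) = - RtoC 1).
    { rewrite Cexp_Ci, cos_neg, sin_neg, cos_PI, sin_PI. apply C_ext; simpl; ring. }
    rewrite <- H1 at 2. rewrite <- H2, <- !Cexp_nat, <- Cexp_plus. f_equal.
    replace (PI * (2 * INR l - (INR (S m) - 1)) / (2 * INR (S m)))%R with
      (/ INR (S m) * (PI * INR l - PI / 2 * INR m))%R by (rewrite (S_INR m) in *; field; exact HN0).
    rewrite RtoC_mult, RtoC_inv, RtoC_minus, !RtoC_mult, RtoC_opp by exact HN0. field.
    now apply RtoC_neq_0. }
  rewrite (csum_ext _ (fun l => Ci ^ m * (- RtoC 1) ^ l)) by (intros; apply E).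
  rewrite csum_scal.
  assert (G : (RtoC 1 - - RtoC 1) * csum (Cpow (- RtoC 1)) (S m) = RtoC 1 - (- RtoC 1) ^ S m)
    by apply csum_geom.
  replace (RtoC 1 - - RtoC 1) with (RtoC 2) in G by (rewrite <- RtoC_opp, <- RtoC_minus; f_equal; ring).
  transitivity (- (Ci ^ m * (RtoC 2 * csum (Cpow (- RtoC 1)) (S m)))); [ring|].
  rewrite G. replace (- Ci) with (- RtoC 1 * Ci) by ring.
  rewrite Cpow_mult_l. cbn [Cpow].
  assert (Hci : Ci * Ci = - RtoC 1) by (apply C_ext; simpl; ring).
  replace (Ci * (Ci * Ci ^ m)) with (Ci * Ci * Ci ^ m) by ring. rewrite Hci. ring.
Qed.

(** * Principal powers in the right half-plane *)

Lemma Carg_trig z : z <> RtoC 0 ->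
  cos (Carg z) = (Re z / Cmod z)%R /\ sin (Carg z) = (Im z / Cmod z)%R.
Proof.
  intros Hz. assert (Hm : 0 < Cmod z) by now apply Cmod_gt_0.
  assert (E := Cmod2_alt z).
  assert (Hle : -1 <= Re z / Cmod z <= 1).
  { assert (H := re_le_Cmod z). assert (H1 := Rle_abs (Re z)). assert (H2 := Rle_abs (- Re z)).
    rewrite Rabs_Ropp in H2. split; [apply Rle_div_r|apply Rle_div_l]; lra. }
  assert (Hs : sqrt (1 - (Re z / Cmod z)²) = (Rabs (Im z) / Cmod z)%R).
  { apply sqrt_lem_1.
    - assert (H := Rsqr_bounds_le). unfold Rsqr. nra.
    - apply Rdiv_le_0_compat; [apply Rabs_pos|exact Hm].
    - unfold Rsqr. replace (Rabs (Im z) / Cmod z * (Rabs (Im z) / Cmod z))%R with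
        ((Rabs (Im z) * Rabs (Im z)) / (Cmod z ^ 2))%R by (field; lra).
      replace (Rabs (Im z) * Rabs (Im z))%R with (Im z ^ 2)%R.
      + apply (Rmult_eq_reg_r (Cmod z ^ 2)); [|apply pow_nonzero; lra].
        field_simplify; [|lra|lra]. lra.
      + rewrite <- pow2_abs. ring. }
  unfold Carg. destruct (Rle_dec 0 (Im z)) as [H|H].
  - rewrite cos_acos, sin_acos, Hs, Rabs_pos_eq by lra. auto.
  - rewrite cos_neg, sin_neg, cos_acos, sin_acos, Hs, Rabs_left by lra. split; [reflexivity|field; lra].
Qed.

Lemma Cexp_Clog z : z <> RtoC 0 -> Cexp (Clog z) = z.
Proof.
  intros Hz. assert (Hm : 0 < Cmod z) by now apply Cmod_gt_0.
  destruct (Carg_trig z Hz) as [H1 H2]. unfold Cexp, Clog. cbn [Re Im fst snd].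
  rewrite exp_ln, H1, H2 by exact Hm. apply C_ext; simpl; field; lra.
Qed.

Lemma Carg_abs_lt z : 0 < Re z -> Rabs (Carg z) < PI / 2.
Proof.
  intros Hz. assert (Hz0 : z <> RtoC 0) by (intros E; rewrite E in Hz; simpl in Hz; lra).
  assert (Hm : 0 < Cmod z) by now apply Cmod_gt_0.
  assert (Hpi := PI_RGT_0).
  assert (Ha : Rabs (Carg z) = acos (Re z / Cmod z)).
  { assert (H := acos_bound (Re z / Cmod z)). unfold Carg. destruct (Rle_dec 0 (Im z)).
    - apply Rabs_pos_eq. lra.
    - rewrite Rabs_Ropp. apply Rabs_pos_eq. lra. }
  rewrite Ha. assert (Hb := acos_bound (Re z / Cmod z)).
  assert (Hp : 0 < Re z / Cmod z) by now apply Rdiv_lt_0_compat.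
  assert (Hle : Re z / Cmod z <= 1).
  { assert (H := re_le_Cmod z). assert (H1 := Rle_abs (Re z)). apply Rle_div_l; lra. }
  destruct (Rlt_or_le (acos (Re z / Cmod z)) (PI / 2)) as [H|H]; [exact H|exfalso].
  assert (Hc := cos_le_0 _ H ltac:(lra)). rewrite cos_acos in Hc by lra. lra.
Qed.

(** A positive factor leaves the principal argument unchanged; this is what lets n^(1/N) be taken
    out of (2 pi n / y)^(1/N). *)
Lemma Cpower_scale x z a : 0 < x -> z <> RtoC 0 ->
  Cpower (RtoC x * z) a = rpow x a * Cpower z a.
Proof.
  intros Hx Hz. assert (Hm : 0 < Cmod z) by now apply Cmod_gt_0.
  assert (Em : Cmod (RtoC x * z) = (x * Cmod z)%R) by (rewrite Cmod_mult, Cmod_R, Rabs_pos_eq; lra).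
  assert (Er : Re (RtoC x * z) = (x * Re z)%R) by (destruct z; simpl; ring).
  assert (Ei : Im (RtoC x * z) = (x * Im z)%R) by (destruct z; simpl; ring).
  assert (El : Clog (RtoC x * z) = RtoC (ln x) + Clog z).
  { unfold Clog, Carg. rewrite Em, Er, Ei, ln_mult by assumption.
    replace (x * Re z / (x * Cmod z))%R with (Re z / Cmod z)%R by (field; lra).
    destruct (Rle_dec 0 (x * Im z)) as [H|H]; destruct (Rle_dec 0 (Im z)) as [H'|H'];
      try (exfalso; nra); apply C_ext; simpl; ring. }
  unfold Cpower, rpow. rewrite El, <- Cexp_plus. f_equal. ring.
Qed.

Lemma Cpower_nth_root_pow N z : (1 <= N)%nat -> z <> RtoC 0 ->
  Cpower z (RtoC (1 / INR N)) ^ N = z.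
Proof.
  intros HN Hz. assert (HN0 : INR N <> 0%R) by (apply not_0_INR; lia).
  unfold Cpower. rewrite <- Cexp_nat, Cmult_assoc, <- RtoC_mult.
  replace (INR N * (1 / INR N))%R with 1%R by (field; exact HN0).
  rewrite Cmult_1_l. now apply Cexp_Clog.
Qed.

(** The argument of [root N l] is at most (N-1) pi/(2N) in modulus and that of the principal N-th
    root of z is below pi/(2N), so their sum stays below pi/2. *)
Lemma Re_root_Cpower N l z : (l < N)%nat -> 0 < Re z ->
  0 < Re (root N l * Cpower z (RtoC (1 / INR N))).
Proof.
  intros Hl Hz. assert (Hpi := PI_RGT_0).
  assert (HN0 : 0 < INR N) by (apply lt_0_INR; lia).
  assert (Hl1 : INR l + 1 <= INR N) by (rewrite <- S_INR; apply le_INR; lia).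
  assert (Hl0 := pos_INR l). assert (Ha := Carg_abs_lt z Hz). apply Rabs_def2 in Ha.
  unfold root, Cpower. rewrite <- Cexp_plus. unfold Cexp at 1.
  set (e := Ci * _ + _).
  assert (Ei : Im e = ((PI * (2 * INR l - (INR N - 1)) + 2 * Carg z) / (2 * INR N))%R).
  { unfold e, Clog. simpl. field. lra. }
  change (0 < exp (Re e) * cos (Im e) - 0 * sin (Im e)).
  rewrite Rmult_0_l, Rminus_0_r. apply Rmult_lt_0_compat; [apply exp_pos|].
  apply cos_gt_0; rewrite Ei.
  - apply Rlt_div_r; [lra|]. nra.
  - apply Rlt_div_l; [lra|]. nra.
Qed.

(** Two expressions for [beta (S N)] meet: its definition through zeta(N+1), and zeta(-N) = -N!
    [beta (S N)] from Euler-Maclaurin. The sum over the roots supplies the factor i^(N+1) +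
    (-i)^(N+1). *)
Lemma E_zero_eq N gam : (1 <= N)%nat -> gam <> RtoC 0 ->
  E_zero N gam = RtoC PI / RtoC 2 / gam ^ N * zeta (RtoC (- INR N)).
Proof.
  intros HN Hg. rewrite zeta_neg_nat by exact HN. unfold E_zero.
  destruct N as [|m]; [lia|].
  change (beta (S (S m))) with
    (- (Ci ^ S (S m) + (- Ci) ^ S (S m)) / RtoC (2 * PI) ^ S (S m) * RtoC (zeta_nat (S (S m)))).
  rewrite <- csum_root_inv_pow by exact HN.
  set (n := S m) in *. set (P := RtoC (2 * PI)). set (z := RtoC (zeta_nat (S n))).
  set (f := RtoC (INR (fact n))).
  assert (HP : P <> RtoC 0) by (apply RtoC_neq_0; assert (H := PI_RGT_0); lra).
  assert (HPn := Cpow_nz P n HP). assert (Hgn := Cpow_nz gam n Hg).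
  rewrite (csum_ext _ (fun l => - (f * z) / (P ^ n * gam ^ n) * / root n l ^ n)).
  - rewrite csum_scal. set (s := csum (fun l => / root n l ^ n) n).
    replace (RtoC PI) with (P / RtoC 2) by (unfold P; rewrite RtoC_mult; field).
    change (P ^ S n) with (P * P ^ n). field. auto.
  - intros l Hl. unfold b_root. fold P. rewrite !Cpow_mult_l.
    assert (Hr := Cpow_nz (root n l) n (Cexp_neq_0 _)). field. auto.
Qed.

(** * The left-hand side as a Lambert series *)

Lemma Csum_app {I : Type} (s t : list I) (f : I -> C) : Csum (s ++ t) f = Csum s f + Csum t f.
Proof.
  induction s; unfold Csum in *; simpl; [now rewrite Cplus_0_l|]. rewrite IHs. ring.
Qed.

Lemma Csum_map_seq {I : Type} (g : nat -> I) (f : I -> C) n :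
  Csum (map g (seq 0 n)) f = csum (fun k => f (g k)) n.
Proof.
  induction n; [reflexivity|]. rewrite seq_S, map_app, Csum_app, IHn. simpl.
  unfold Csum at 1. simpl. ring.
Qed.

Lemma Csum_filter_seq (p : nat -> bool) (f : nat -> C) n :
  Csum (filter p (seq 1 n)) f = csum (fun k => if p (S k) then f (S k) else RtoC 0) n.
Proof.
  induction n; [reflexivity|]. rewrite seq_S, filter_app, Csum_app, IHn. simpl.
  destruct (p (S n)); unfold Csum at 1; simpl; ring.
Qed.

(** The quotient by D counts the positive multiples of D, so it increases exactly when a multiple is
    reached. *)
Lemma div_S_indicator n D : (1 <= D)%nat ->
  (S n / D)%nat = if Nat.eqb (S n mod D) 0 then S (n / D) else (n / D)%nat.
Proof.
  intros HD. assert (H1 := Nat.div_mod_eq n D). assert (H2 := Nat.div_mod_eq (S n) D).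
  assert (B1 := Nat.mod_upper_bound n D ltac:(lia)).
  assert (B2 := Nat.mod_upper_bound (S n) D ltac:(lia)).
  destruct (Nat.eqb_spec (S n mod D) 0) as [E|E].
  - apply (Nat.mul_cancel_l _ _ D); [lia|]. 
    assert (n mod D = D - 1)%nat; [|nia].
    assert (D * (S n / D) = D * (n / D) + n mod D + 1)%nat by lia.
    destruct (Nat.lt_total (S n / D) (S (n / D))) as [K|[K|K]]; nia.
  - destruct (Nat.lt_total (S n / D) (n / D)) as [H|[H|H]]; [nia|exact H|].
    assert (S (n / D) <= S n / D)%nat by lia. nia.
Qed.

Lemma csum_multiples q D n : (1 <= D)%nat ->
  csum (fun k => if Nat.eqb (S k mod D) 0 then q ^ S k else RtoC 0) n
    = csum (fun m => (q ^ D) ^ S m) (n / D).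
Proof.
  intros HD. induction n.
  - rewrite Nat.Div0.div_0_l. reflexivity.
  - cbn [csum]. rewrite IHn, (div_S_indicator n D HD).
    destruct (Nat.eqb_spec (S n mod D) 0) as [E|E]; [|ring].
    cbn [csum]. f_equal. rewrite <- Cpow_mult_r. f_equal.
    assert (H := div_S_indicator n D HD). rewrite E in H. cbn [Nat.eqb] in H. rewrite <- H.
    assert (H2 := Nat.div_mod_eq (S n) D). lia.
Qed.

Lemma Csums_multiples q D : (1 <= D)%nat -> Cmod (q ^ D) < 1 ->
  Csums (fun k => if Nat.eqb (S k mod D) 0 then q ^ S k else RtoC 0) (q ^ D * / (RtoC 1 - q ^ D)).
Proof.
  intros HD Hq.
  assert (H : Csums (fun m => (q ^ D) ^ S m) (q ^ D * / (RtoC 1 - q ^ D))).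
  { apply (Csums_ext (fun m => q ^ D * (q ^ D) ^ m)); [intros; reflexivity|].
    now apply Csums_scal, Csums_geom. }
  apply (Clim_ext (fun n => csum (fun m => (q ^ D) ^ S m) (n / D))).
  { intros n. symmetry. now apply csum_multiples. }
  apply Clim_eps. intros eps He. destruct (proj1 (Clim_eps _ _) H eps He) as [n0 Hn].
  exists (D * n0)%nat. intros n Hle. apply Hn.
  apply Nat.div_le_lower_bound; lia.
Qed.

Lemma INR_pow_nat d N : INR (d ^ N) = (INR d ^ N)%R.
Proof. induction N; [reflexivity|]. simpl Nat.pow. rewrite mult_INR, IHN. reflexivity. Qed.

(** With q = e^{-y}, both series sum the double series of d^N q^n over the pairs with d^N dividing
    n: rows in n are geometric, columns in d give [divisor_sigma]. The common sum stays anonymous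
    because its value comes from the [planck] series. *)
Lemma lambert_series N (y : C) : (1 <= N)%nat -> 0 < Re y ->
  exists L, Csums (fun d => RtoC (INR (S d ^ N)) / (Cexp (RtoC (INR (S d ^ N)) * y) - RtoC 1)) L /\
    Csums (fun n => divisor_sigma N (RtoC (INR N)) (S n) * Cexp (- (RtoC (INR (S n)) * y))) L.
Proof.
  intros HN Hy. set (q := Cexp (- y)).
  assert (Hqn : forall n, q ^ n = Cexp (- (RtoC (INR n) * y))).
  { intros n. unfold q. rewrite <- Cexp_nat. f_equal. ring. }
  assert (Hqm : forall n, Cmod (q ^ n) = exp (- (INR n * Re y))).
  { intros n. rewrite Hqn, Cmod_Cexp. f_equal. destruct y; simpl; ring. }
  assert (HD : forall d, (S d <= S d ^ N)%nat).
  { intros d. rewrite <- (Nat.pow_1_r (S d)) at 1. apply Nat.pow_le_mono_r; lia. }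
  set (D := fun d => (S d ^ N)%nat). 
  assert (HDr : forall d, INR (S d) <= INR (D d)) by (intros d; apply le_INR, HD).
  assert (Hq1 : forall n, (1 <= n)%nat -> Cmod (q ^ n) < 1).
  { intros n Hn. rewrite Hqm, <- exp_0. apply exp_increasing.
    assert (1 <= INR n) by (apply (le_INR 1); exact Hn). nra. }
  set (a := fun d n => RtoC (INR (D d)) * (if Nat.eqb (S n mod D d) 0 then q ^ S n else RtoC 0)).
  set (t1 := exp (- (1 * Re y))).
  assert (Ht1 : t1 < 1) by (assert (H := Hq1 1%nat (le_n _)); rewrite Hqm in H; exact H).
  (* The cubic term of the exponential gives x e^(-x Re y) <= 6 / (Re y)^3 x^(-2), and 1/(1 - t1)
     bounds the geometric sums of all rows at once. *)
  set (K := (6 / Re y ^ 3 * / (1 - t1))%R).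
  assert (Hy3 : 0 < Re y ^ 3) by now apply pow_lt.
  assert (HK : 0 <= K).
  { apply Rmult_le_pos; [apply Rdiv_le_0_compat; lra|]. left; apply Rinv_0_lt_compat; lra. }
  assert (Hmaj : forall d n, Cmod (csum (a d) n) <= K * / INR (S d) ^ 2).
  { intros d n. unfold a. rewrite csum_scal, csum_multiples by (specialize (HD d); unfold D; lia).
    assert (Hx := INR_S_ge_1 d). assert (Hx2 := HDr d). set (x := INR (D d)) in *.
    set (t := Cmod (q ^ D d)).
    assert (Et : t = exp (- (x * Re y))) by apply Hqm.
    assert (Ht0 : 0 <= t) by apply Cmod_ge_0.
    assert (Htt : t <= t1) by (rewrite Et; apply exp_le_exp; nra).
    assert (Hs : Cmod (csum (fun m => (q ^ D d) ^ S m) (n / D d)) <= t * / (1 - t1)).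
    { eapply Rle_trans; [apply (Cmod_csum_le _ (fun m => t * t1 ^ m)%R)|].
      - intros m _. rewrite Cmod_pow. fold t. simpl. apply Rmult_le_compat_l; [exact Ht0|].
        apply pow_incr. lra.
      - rewrite rsum_scal. apply Rmult_le_compat_l; [exact Ht0|].
        assert (Ht10 : 0 <= t1) by lra.
        rewrite <- Series_geom by (rewrite Rabs_pos_eq; lra).
        apply rsum_le_Series; [intros; now apply pow_le|].
        apply ex_series_geom. rewrite Rabs_pos_eq; lra. }
    rewrite Cmod_mult, Cmod_R, Rabs_pos_eq by lra.
    assert (Hxy : 0 < x * Re y) by nra.
    assert (H3 := exp_ge_pow_fact (x * Re y) 3 ltac:(lra)).
    replace (INR (fact 3)) with 6%R in H3 by (simpl; ring).
    assert (Hp3 : 0 < (x * Re y) ^ 3) by now apply pow_lt.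
    assert (Htb : t <= 6 / (x * Re y) ^ 3).
    { rewrite Et, exp_Ropp. replace (6 / (x * Re y) ^ 3)%R with (/ ((x * Re y) ^ 3 / 6))%R by (field; nra).
      apply Rinv_le_contravar; lra. }
    assert (Hi1 : 0 < / (1 - t1)) by (apply Rinv_0_lt_compat; lra).
    apply Rle_trans with (x * (6 / (x * Re y) ^ 3 * / (1 - t1)))%R.
    - apply Rmult_le_compat_l; [lra|]. eapply Rle_trans; [exact Hs|].
      apply Rmult_le_compat_r; lra.
    - replace (x * (6 / (x * Re y) ^ 3 * / (1 - t1)))%R with (K * / x ^ 2)%R
        by (unfold K; field; repeat split; lra).
      apply Rmult_le_compat_l; [exact HK|]. apply Rinv_le_contravar; [apply pow_lt; lra|].
      apply pow_incr. lra. }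
  assert (Hrow : forall d, Csums (a d) (RtoC (INR (D d)) / (Cexp (RtoC (INR (D d)) * y) - RtoC 1))).
  { intros d. assert (HDd : (1 <= D d)%nat) by (specialize (HD d); unfold D; lia).
    assert (H := Csums_scal (RtoC (INR (D d))) _ _ (Csums_multiples q (D d) HDd (Hq1 _ HDd))).
    assert (He0 := Cexp_neq_0 (RtoC (INR (D d)) * y)).
    assert (He : Cexp (RtoC (INR (D d)) * y) - RtoC 1 <> RtoC 0).
    { apply Cexp_neq_1. assert (1 <= INR (D d)) by (apply (le_INR 1); exact HDd).
      destruct y; simpl in *; nra. }
    replace (RtoC (INR (D d)) / (Cexp (RtoC (INR (D d)) * y) - RtoC 1)) with
      (RtoC (INR (D d)) * (q ^ D d * / (RtoC 1 - q ^ D d))); [exact H|].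
    rewrite Hqn, Cexp_opp. field. auto. }
  destruct (Csums_dominated (fun d => RtoC (INR (D d)) / (Cexp (RtoC (INR (D d)) * y) - RtoC 1))
    (fun d => K * / INR (S d) ^ 2)%R) as [L HL].
  - intros d. apply (Clim_Cmod_le _ _ _ (Hrow d)). intros n. apply Hmaj.
  - apply ex_series_mult_l, ex_series_inv_sq.
  - exists L. split; [exact HL|].
    apply (Csums_swap a (fun d => RtoC (INR (D d)) / (Cexp (RtoC (INR (D d)) * y) - RtoC 1)) _
      (fun d => K * / INR (S d) ^ 2)%R); auto.
    + apply ex_series_mult_l, ex_series_inv_sq.
    + intros n. unfold divisor_sigma. rewrite Csum_filter_seq, Cmult_comm, <- csum_scal.
      rewrite (csum_ext _ (fun d => a d n)).
      * apply Csums_finite. intros d Hd. unfold a.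
        (* For d >= n + 1 the power (d+1)^N exceeds n + 1, so the remainder is n + 1 itself and the
           column ends. *)
        rewrite Nat.mod_small by (specialize (HD d); unfold D; lia). cbn [Nat.eqb]. ring.
      * intros d Hd. unfold a. fold (D d). rewrite <- Hqn.
        destruct (Nat.eqb (S n mod D d) 0); [|ring].
        rewrite Cpower_pos, rpow_nat by (apply lt_0_INR; lia).
        unfold D. rewrite INR_pow_nat, RtoC_pow. ring.
Qed.

(** * Convergence of the right-hand series and their index set *)

Lemma nth_root_ge_1 N n : (1 <= N)%nat -> 1 <= nth_root N n <= INR (S n).
Proof.
  intros HN. assert (Hx := INR_S_ge_1 n).
  assert (H1 : 1 <= nth_root N n).
  { unfold nth_root. rewrite <- exp_0. apply exp_le_exp. apply Rdiv_le_0_compat.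
    - rewrite <- ln_1. apply ln_le; lra.
    - apply lt_0_INR. lia. }
  split; [exact H1|]. rewrite <- (nth_root_pow N n HN). rewrite <- (pow_1 (nth_root N n)) at 1.
  now apply Rle_pow.
Qed.

Lemma Csums_planck_term N (w e : C) : (1 <= N)%nat -> 0 < Re e ->
  let f := fun n => RtoC (nth_root N n) * w / (Cexp (e * RtoC (nth_root N n)) - RtoC 1) in
  Csums f (CSeries f).
Proof.
  (* With u = (n+1)^(1/N), u^(3N) = (n+1)^3: the exponential term of degree 3N outweighs the factor
     u <= n + 1 and leaves (n+1)^(-2). *)
  intros HN He f. set (k := (3 * N)%nat). assert (Hk : exists j, k = S j) by (exists (k - 1)%nat; lia).
  destruct Hk as [j Hj]. set (K := (Cmod w * (INR (fact k) / Re e ^ k))%R).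
  apply (Csums_of_ex f (fun n => K * / INR (S n) ^ 2)%R); [|apply ex_series_mult_l, ex_series_inv_sq].
  intros n. unfold f. assert (Hx := INR_S_ge_1 n). destruct (nth_root_ge_1 N n HN) as [Hu1 Hu2].
  assert (Hpow := nth_root_pow N n HN).
  set (u := nth_root N n) in *. set (x := INR (S n)) in *.
  assert (Eu : Re (e * RtoC u) = (Re e * u)%R) by (destruct e; simpl; ring).
  assert (Heu : 0 < Re e * u) by nra.
  assert (Hne := Cexp_neq_1 (e * RtoC u) ltac:(rewrite Eu; exact Heu)).
  assert (Hek : 0 < Re e ^ k) by now apply pow_lt.
  assert (Hf := INR_fact_lt_0 k).
  assert (Hden : Re e ^ k * x ^ 3 / INR (fact k) <= Cmod (Cexp (e * RtoC u) - RtoC 1)).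
  { assert (H := Cmod_rev_triangle (Cexp (e * RtoC u)) (- RtoC 1)).
    rewrite Cmod_opp, Cmod_1, Cmod_Cexp, Eu in H.
    assert (H2 := exp_minus_1_ge (Re e * u) j ltac:(lra)). rewrite <- Hj in H2.
    rewrite Rpow_mult_distr in H2. unfold k in H2 at 2. rewrite Nat.mul_comm, pow_mult, Hpow in H2.
    unfold Cminus. lra. }
  assert (Hx3 : 0 < x ^ 3) by (apply pow_lt; lra).
  assert (Hd0 : 0 < Re e ^ k * x ^ 3 / INR (fact k)).
  { apply Rdiv_lt_0_compat; [now apply Rmult_lt_0_compat|exact Hf]. }
  rewrite Cmod_div, Cmod_mult, Cmod_R, Rabs_pos_eq by (assumption || lra).
  replace (K * / x ^ 2)%R with (x * Cmod w * / (Re e ^ k * x ^ 3 / INR (fact k)))%R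
    by (unfold K; field; repeat split; lra).
  assert (Hw := Cmod_ge_0 w). unfold Rdiv at 1. apply Rmult_le_compat.
  - apply Rmult_le_pos; lra.
  - left. apply Rinv_0_lt_compat. lra.
  - apply Rmult_le_compat_r; lra.
  - now apply Rinv_le_contravar.
Qed.

(** The value of b makes N - 1 + b even, so both integer divisions are exact and the interval has N
    elements. The substitution j = l - m yields 2j + b = 2l - (N - 1) whatever the parity. *)
Lemma Zinterval_halves N b : (1 <= N)%nat -> (Nat.Odd N -> b = 0%Z) -> (Nat.Even N -> b = 1%Z) ->
  exists m, (Z.of_nat N - 1 + b = 2 * m)%Z /\
    Zinterval (- ((Z.of_nat N - 1 + b) / 2)) ((Z.of_nat N - 1 - b) / 2)
      = map (fun l => (- m + Z.of_nat l)%Z) (seq 0 N).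
Proof.
  intros HN Ho He. unfold Zinterval.
  assert (Hm : exists m, (Z.of_nat N - 1 + b = 2 * m)%Z).
  { destruct (Nat.Even_or_Odd N) as [Hp|Hp].
    - rewrite (He Hp). destruct Hp as [m ->]. exists (Z.of_nat m). lia.
    - rewrite (Ho Hp). destruct Hp as [m ->]. exists (Z.of_nat m). lia. }
  destruct Hm as [m Hm]. exists m. split; [exact Hm|].
  assert (E1 : ((Z.of_nat N - 1 + b) / 2 = m)%Z) by (rewrite Hm, Z.mul_comm; apply Z.div_mul; lia).
  assert (E2 : ((Z.of_nat N - 1 - b) / 2 = m - b)%Z).
  { replace (Z.of_nat N - 1 - b)%Z with ((m - b) * 2)%Z by lia. apply Z.div_mul. lia. }
  rewrite E1, E2. replace (Z.to_nat (m - b - - m + 1)) with N by lia. reflexivity.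
Qed.

Theorem theorem2p6 (N : nat) (hN : (1 <= N)%nat)
    (b : Z) (hodd : Nat.Odd N -> b = 0%Z) (heven : Nat.Even N -> b = 1%Z)
    (y : C) (hy : (0 < Re y)%R) :
  let js := Zinterval (- ((Z.of_nat N - 1 + b) / 2)) ((Z.of_nat N - 1 - b) / 2) in
  let w (j : Z) : C := Cexp (Ci * RtoC (PI * IZR (2 * j + b) / (2 * INR N))%R) in
  let lhs_term (n : nat) : C :=
    divisor_sigma N (RtoC (INR N)) n * Cexp (- (RtoC (INR n) * y)) in
  let rhs_term (j : Z) (n : nat) : C :=
    (Cpower (RtoC (INR n)) (RtoC (1 / INR N)%R) * w j) /
    (Cexp (RtoC (2 * PI)%R * w j *
           Cpower (RtoC (2 * PI * INR n)%R / y) (RtoC (1 / INR N)%R)) - RtoC 1) in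
  let prefactor : C := Cpower (RtoC (2 * PI)%R / y) (RtoC (1 + 1 / INR N)%R) in
  Cex_series (fun n => lhs_term (S n)) /\
  (forall j : Z, List.In j js -> Cex_series (fun n => rhs_term j (S n))) /\
  CSeries (fun n => lhs_term (S n)) + RtoC (1 / 2)%R * zeta (RtoC (- INR N)%R) =
    - (RtoC 1 / (RtoC 2 * y))
    - RtoC (1 / (2 * INR N * sin (PI / (2 * INR N))))%R
        * prefactor * zeta (RtoC (- (1 / INR N))%R)
    - RtoC (1 / INR N)%R * prefactor
        * Csum js (fun j => CSeries (fun n => rhs_term j (S n))).
Proof.
  intros js w lhs_term rhs_term prefactor.
  assert (Hpi := PI_RGT_0).
  assert (HN0 : 0 < INR N) by (apply lt_0_INR; lia).
  assert (HN0C : RtoC (INR N) <> RtoC 0) by (apply RtoC_neq_0; lra).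
  assert (Hy0 : y <> RtoC 0) by (intros E; rewrite E in hy; simpl in hy; lra).
  assert (HpiC := RtoC_PI_neq_0).
  (* The pole parameter of d is kap d^N = d^N y/(2 pi), and [gam] is the principal N-th root of
     1/kap, as the partial fractions require. *)
  set (c := RtoC (2 * PI) / y). set (gam := Cpower c (RtoC (1 / INR N))).
  set (kap := RtoC (/ (2 * PI)) * y).
  assert (H2pi : RtoC (2 * PI) <> RtoC 0) by (apply RtoC_neq_0; lra).
  assert (Hc0 : c <> RtoC 0).
  { intros E. apply H2pi. replace (RtoC (2 * PI)) with (c * y) by (unfold c; field; exact Hy0).
    rewrite E. ring. }
  assert (Hkap : 0 < Re kap).
  { unfold kap. assert (0 < / (2 * PI)) by (apply Rinv_0_lt_compat; lra). destruct y; simpl in *. nra. }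
  assert (Hgam : gam ^ N = c) by (apply Cpower_nth_root_pow; assumption).
  assert (Hkg : kap * gam ^ N = RtoC 1).
  { rewrite Hgam. unfold kap, c. rewrite RtoC_inv by lra. field. auto. }
  assert (Hgam0 : gam <> RtoC 0).
  { intros E. apply Hc0. rewrite <- Hgam, E. destruct N; [lia|]. simpl. ring. }
  (* 1/y is the conjugate of y divided by |y|^2, so it lies in the right half-plane with y. *)
  assert (Hrec : 0 < Re c).
  { replace c with (RtoC (2 * PI * / (Re y ^ 2 + Im y ^ 2)) * Cconj y).
    - assert (H0 : 0 < 2 * PI * / (Re y ^ 2 + Im y ^ 2)).
      { apply Rmult_lt_0_compat; [lra|]. apply Rinv_0_lt_compat.
        assert (0 < Re y ^ 2) by now apply pow_lt. assert (Him := pow2_ge_0 (Im y)). lra. }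
      set (t := (2 * PI * / (Re y ^ 2 + Im y ^ 2))%R) in *. destruct y; simpl in *. nra.
    - unfold c. rewrite RtoC_mult, RtoC_inv.
      2:{ assert (0 < Re y ^ 2) by now apply pow_lt. assert (Him := pow2_ge_0 (Im y)). lra. }
      rewrite <- Cmod2_alt, Cmod2_conj.
      assert (Hcy : Cconj y <> RtoC 0).
      { apply Cmod_gt_0. rewrite Cmod_conj. now apply Cmod_gt_0. }
      field. auto. }
  assert (Hroot : forall l, (l < N)%nat -> 0 < Re (root N l * gam)).
  { intros l Hl. now apply Re_root_Cpower. }
  assert (Hcpow : forall n, Cpower (RtoC (2 * PI * INR (S n)) / y) (RtoC (1 / INR N)) =
    RtoC (nth_root N n) * gam).
  { intros n. replace (RtoC (2 * PI * INR (S n)) / y) with (RtoC (INR (S n)) * c)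
      by (unfold c; rewrite (RtoC_mult (2 * PI)); field; exact Hy0).
    rewrite Cpower_scale, rpow_nth_root by (assumption || (apply lt_0_INR; lia)). reflexivity. }
  set (R := fun l n => RtoC (nth_root N n) * root N l /
    (Cexp (RtoC (2 * PI) * (root N l * gam) * RtoC (nth_root N n)) - RtoC 1)).
  assert (HR : forall j l, (l < N)%nat -> (2 * j + b = 2 * Z.of_nat l - (Z.of_nat N - 1))%Z ->
    forall n, rhs_term j (S n) = R l n).
  { intros j l Hl Hjl n. unfold rhs_term. rewrite Hcpow.
    assert (Hw : w j = root N l).
    { unfold w, root. rewrite Hjl. do 4 f_equal.
      rewrite !minus_IZR, mult_IZR, <- !INR_IZR_INZ. reflexivity. }
    rewrite Hw, Cpower_pos, rpow_nth_root by (apply lt_0_INR; lia). unfold R.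
    replace (RtoC (2 * PI) * root N l * (RtoC (nth_root N n) * gam)) with
      (RtoC (2 * PI) * (root N l * gam) * RtoC (nth_root N n)) by ring. reflexivity. }
  assert (HRs : forall l, (l < N)%nat -> Csums (R l) (CSeries (R l))).
  { intros l Hl. apply (Csums_planck_term N (root N l) (RtoC (2 * PI) * (root N l * gam)) hN).
    now apply Re_b_root, Hroot. }
  destruct (Zinterval_halves N b hN hodd heven) as [m [Hm Hjs]]. fold js in Hjs.
  assert (Hidx : forall l, (2 * (- m + Z.of_nat l) + b = 2 * Z.of_nat l - (Z.of_nat N - 1))%Z) by lia.
  destruct (lambert_series N y hN hy) as [L [HL1 HL2]].
  set (S1 := CSeries (fun d => planck (pole N kap d))).
  (* (2/y) pi kap d^N = d^N and 2 pi kap = y, which turns [planck] into the Lambert summand. *)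
  assert (HS1 : L = RtoC 2 / y * S1).
  { apply (Csums_unique _ _ _ HL1).
    eapply Csums_ext; [|exact (Csums_scal (RtoC 2 / y) _ _ (proj1 (planck_summable N kap hN Hkap)))].
    intros d. cbv beta. unfold planck, pole. rewrite <- INR_pow_nat.
    set (D := RtoC (INR (S d ^ N))).
    replace (RtoC (2 * PI) * (kap * D)) with (D * y).
    - assert (E2 : RtoC 2 / y * (RtoC PI * (kap * D)) = D).
      { unfold kap. rewrite RtoC_inv by lra. rewrite RtoC_mult. field. auto. }
      transitivity (RtoC 2 / y * (RtoC PI * (kap * D)) / (Cexp (D * y) - RtoC 1)); [unfold Cdiv; ring|].
      rewrite E2. reflexivity.
    - unfold kap. rewrite RtoC_inv by lra. field. exact H2pi. }
  set (T := csum (fun l => CSeries (R l)) N).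
  assert (HS2 : Csums (fun n => q_exp N gam (nth_root N n)) (RtoC PI * gam / RtoC (INR N) * T)).
  { eapply Csums_ext; [|exact (Csums_scal (RtoC PI * gam / RtoC (INR N)) _ _ (Csums_csum R _ N HRs))].
    intros n. cbv beta. unfold q_exp. rewrite <- !csum_scal. apply csum_ext. intros l _.
    unfold planck, R, Cdiv.
    replace (RtoC (2 * PI) * (root N l * gam * RtoC (nth_root N n))) with
      (RtoC (2 * PI) * (root N l * gam) * RtoC (nth_root N n)) by ring. ring. }
  assert (Hmain := planck_sum_identity N kap gam _ hN Hkap Hkg Hroot HS2). fold S1 in Hmain.
  rewrite E_zero_eq, Hgam in Hmain by assumption.
  set (sn := sin (PI / (2 * INR N))).
  assert (Hsum := csum_root N hN). fold sn in Hsum.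
  assert (Hsn : RtoC sn <> RtoC 0).
  { intros E. rewrite E in Hsum. apply (RtoC_neq_0 1); [lra|]. rewrite <- Hsum. ring. }
  assert (Hq : q_lin N gam = RtoC PI / (RtoC 2 * RtoC (INR N)) * gam / RtoC sn).
  { unfold q_lin. rewrite (csum_ext _ (fun l => gam * root N l)) by (intros; ring).
    rewrite csum_scal. change (csum (fun l => root N l) N) with (csum (root N) N).
    replace (csum (root N) N) with (csum (root N) N * RtoC sn / RtoC sn) by (field; exact Hsn).
    rewrite Hsum. unfold Rdiv. rewrite RtoC_mult, RtoC_inv, RtoC_mult by lra. field. auto. }
  rewrite Hq in Hmain.
  (* The exponent 1 + 1/N splits because both powers are taken with the same logarithm of 2 pi /
     y. *)
  assert (Hpre : prefactor = c * gam).
  { unfold prefactor, gam, Cpower. fold c.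
    rewrite RtoC_plus, Cmult_plus_distr_r, Cexp_plus, Cmult_1_l, Cexp_Clog by exact Hc0. reflexivity. }
  repeat split.
  - exists L. now apply Cis_series_Csums.
  - intros j Hj. rewrite Hjs in Hj. apply in_map_iff in Hj. destruct Hj as [l [<- Hl]].
    apply in_seq in Hl. exists (CSeries (R l)). apply Cis_series_Csums.
    apply (Csums_ext (R l)); [intros n; symmetry; apply HR; [lia|apply Hidx]|apply HRs; lia].
  - change (CSeries (fun n => lhs_term (S n))) with (CSeries (fun n => divisor_sigma N (RtoC (INR N)) (S n) * Cexp (- (RtoC (INR (S n)) * y)))).
    rewrite (CSeries_unique _ _ HL2), HS1.
    assert (HT : Csum js (fun j => CSeries (fun n => rhs_term j (S n))) = T).
    { rewrite Hjs, Csum_map_seq. apply csum_ext. intros l Hl.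
      apply CSeries_unique. apply (Csums_ext (R l)); [|now apply HRs].
      intros n. symmetry. apply HR; [exact Hl|apply Hidx]. }
    rewrite HT, Hpre.
    set (Z1 := zeta (RtoC (- (1 / INR N)))) in *. set (Z2 := zeta (RtoC (- INR N))) in *.
    (* Solves the identity for [S1]. Multiplied by 2/y, its constant -1/4 becomes -1/(2y), and
       pi/(2c) zeta(-N) becomes zeta(-N)/2, since c y = 2 pi. *)
    replace S1 with (S1 + RtoC PI * gam / RtoC (INR N) * T - RtoC PI * gam / RtoC (INR N) * T) by ring.
    rewrite Hmain. fold sn.
    assert (Hsn' : sn <> 0%R) by (intros E; apply Hsn; now rewrite E).
    assert (H1 : RtoC (1 / 2) = / RtoC 2) by (rewrite <- RtoC_inv by lra; f_equal; lra).
    assert (H2 : RtoC (1 / INR N) = / RtoC (INR N)) by (rewrite <- RtoC_inv by lra; f_equal; lra).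
    assert (H3 : RtoC (1 / (2 * INR N * sn)) = / (RtoC 2 * RtoC (INR N) * RtoC sn)).
    { rewrite <- !RtoC_mult, <- RtoC_inv.
      - f_equal. field. split; [exact Hsn'|lra].
      - repeat apply Rmult_integral_contrapositive_currified; lra. }
    rewrite H1, H2, H3. unfold c. rewrite !RtoC_mult. field. repeat split; auto.
Qed.
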